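(* Let $N>0$ be an integer and fix either sign in the equation $$u_{tt}-\Delta u\pm|u|^Nu=0\ \text{ on }\mathbb R^{3+1},\qquad u(0)=u_0,\quad u_t(0)=u_1 .\qquad(\ast)$$ There exist constants $C>0$ and $C'<\infty$ (depending only on $N$) such that, whenever the initial data $(u_0,u_1)$ are radial and outgoing and $u_0\in L^\infty$, there exists a corresponding solution $u$ of $(\ast)$ on $\mathbb R^3\times I$, $I=[0,T]$, such that $T\ge C\|u_0\|_{L^\infty}^{-N/2}$ and $$\|u\|_{L^\infty_{t,x}(\mathbb R^3\times I)}\le C'\|u_0\|_{L^\infty}.$$
   Context: All functions are real-valued; $r=|x|$, and subscript $r$ denotes the radial derivative. A pair $(u_0,u_1)$ of radially symmetric functions or distributions on $\mathbb R^3$ is called outgoing if $u_1=-(u_0)_r-\frac{u_0}{r}$. Solutions are understood as mild solutions, i.e. solutions of $$u(t)=\cos(t\sqrt{-\Delta})u_0+\frac{\sin(t\sqrt{-\Delta})}{\sqrt{-\Delta}}u_1\mp\int_0^t\frac{\sin((t-s)\sqrt{-\Delta})}{\sqrt{-\Delta}}|u(s)|^Nu(s)\,ds .$$ *)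

(* Defs.v *)
From HB Require Import structures.
From mathcomp Require Import all_boot all_order all_algebra.
From mathcomp Require Import all_classical all_reals all_analysis.
Set Implicit Arguments.
Unset Strict Implicit.
Unset Printing Implicit Defensive.
Import Order.TTheory GRing.Theory Num.Theory.
Import numFieldNormedType.Exports.
Local Open Scope classical_set_scope.
Local Open Scope ring_scope.

Section euclidean_space.
Context {R : realType}.
Local Notation R3 := (R * R * R)%type.

Definition dot3 (x y : R3) : R :=
  x.1.1 * y.1.1 + x.1.2 * y.1.2 + x.2 * y.2.

(* The library's norm on a product is the sup norm. *)
Definition norm3 (x : R3) : R := Num.sqrt (dot3 x x).

Definition basis3 (i : 'I_3) : R3 :=
  ((i == 0 :> nat)%:R, (i == 1 :> nat)%:R, (i == 2 :> nat)%:R).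

Fixpoint pderiv3 (s : seq 'I_3) (phi : R3 -> R) : R3 -> R :=
  if s is i :: s' then fun x => 'D_(basis3 i) (pderiv3 s' phi) x else phi.

(* Iterated partial derivatives of every order exist and decay rapidly; since
   they are all bounded, they are all Lipschitz, so that phi is smooth. *)
Definition schwartz (phi : R3 -> R) : Prop :=
  forall s : seq 'I_3,
    (forall (i : 'I_3) (x : R3), derivable (pderiv3 s phi) x (basis3 i)) /\
    (forall k : nat, exists M : R, forall x : R3,
       norm3 x ^+ k * `|pderiv3 s phi x| <= M).

End euclidean_space.

(* The library's sigma-finite instance on m1 \x m2 is shadowed by the one for
   subprobabilities, hence the named products below. *)
Lemma sigma_finite_product d1 d2 (T1 : measurableType d1)
    (T2 : measurableType d2) (R : realType)
    (m1 : {sigma_finite_measure set T1 -> \bar R})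
    (m2 : {sigma_finite_measure set T2 -> \bar R}) :
  sigma_finite setT (m1 \x m2)%E.
Proof.
have /sigma_finiteP[F [TF ndF Foo]] := sigma_finiteT m1.
have /sigma_finiteP[G [TG ndG Goo]] := sigma_finiteT m2.
exists (fun n => F n `*` G n).
  rewrite -setXTT TF TG predeqE => -[x y]; split.
    move=> [/= [n _ Fnx] [k _ Gky]]; exists (maxn n k) => //; split.
    - by move: x Fnx; exact/subsetPset/ndF/leq_maxl.
    - by move: y Gky; exact/subsetPset/ndG/leq_maxr.
  by move=> [n _ []/= ? ?]; split; exists n.
move=> k; have [? ?] := Foo k; have [? ?] := Goo k.
split; first exact: measurableX.
by rewrite product_measure1E// lte_mul_pinfty// ge0_fin_numE.
Qed.

Section lebesgue_products.
Context (R : realType).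

Definition lebesgue2 := (@lebesgue_measure R \x @lebesgue_measure R)%E.
HB.instance Definition _ := Measure.on lebesgue2.
HB.instance Definition _ := Measure_isSigmaFinite.Build _ _ _ lebesgue2
  (sigma_finite_product _ _).

Definition lebesgue3 := (lebesgue2 \x @lebesgue_measure R)%E.
HB.instance Definition _ := Measure.on lebesgue3.
HB.instance Definition _ := Measure_isSigmaFinite.Build _ _ _ lebesgue3
  (sigma_finite_product _ _).

Definition lebesgue_tx := (@lebesgue_measure R \x lebesgue3)%E.
HB.instance Definition _ := Measure.on lebesgue_tx.
HB.instance Definition _ := Measure_isSigmaFinite.Build _ _ _ lebesgue_tx
  (sigma_finite_product _ _).

End lebesgue_products.
Arguments lebesgue2 : clear implicits.
Arguments lebesgue3 : clear implicits.
Arguments lebesgue_tx : clear implicits.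

Section distributions.
Context {R : realType}.
Local Notation R3 := (R * R * R)%type.
Local Notation mu := (lebesgue3 R).

(* Tempered distributions, as functionals on real test functions. Only the
   values at Schwartz functions are meaningful. *)
Definition tdistr : Type := (R3 -> R) -> R.

Definition distr_of (f : R3 -> R) : tdistr :=
  fun phi => \int[mu]_x (f x * phi x).

Definition radial (f : R3 -> R) : Prop :=
  exists2 g : R -> R, measurable_fun setT g &
    {ae mu, forall x, f x = g (norm3 x)}.

(* x / |x| . grad phi(x), away from the origin *)
Definition rderiv (phi : R3 -> R) (x : R3) : R :=
  'D_((norm3 x)^-1 *: x) phi x.

(* f_r in the sense of distributions: the formal adjoint of d/dr with respect
   to Lebesgue measure on R^3 is - d/dr - 2/r, and 1/r is locally integrable. *)
Definition distr_rderiv (f : R3 -> R) : tdistr :=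
  fun phi => - \int[mu]_x (f x * (rderiv phi x + 2 / norm3 x * phi x)).

Definition distr_over_r (f : R3 -> R) : tdistr :=
  fun phi => \int[mu]_x (f x / norm3 x * phi x).

(* u1 = - (u0)_r - u0 / r as tempered distributions. When u0 is radial, this
   forces u1 to be radial, too. *)
Definition outgoing (u0 : R3 -> R) (u1 : tdistr) : Prop :=
  forall phi, schwartz phi ->
    u1 phi = - distr_rderiv u0 phi - distr_over_r u0 phi.

(* Real and imaginary parts of the Fourier transform of a real distribution,
   <F f, psi> = <f, F psi> with F psi(x) = \int e^(- i x . xi) psi(xi) d xi,
   tested against real psi. *)
Definition fourier_re (f : tdistr) : tdistr :=
  fun psi => f (fun x => \int[mu]_xi (cos (dot3 x xi) * psi xi)).

Definition fourier_im (f : tdistr) : tdistr :=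
  fun psi => - f (fun x => \int[mu]_xi (sin (dot3 x xi) * psi xi)).

Definition distr_mul (m : R3 -> R) (f : tdistr) : tdistr :=
  fun psi => f (fun xi => m xi * psi xi).

(* Fourier multipliers of cos(t sqrt(-Delta)) and
   sin(t sqrt(-Delta)) / sqrt(-Delta) *)
Definition cos_symbol (t : R) (xi : R3) : R := cos (t * norm3 xi).

Definition sin_symbol (t : R) (xi : R3) : R :=
  if norm3 xi == 0 then t else sin (t * norm3 xi) / norm3 xi.

Definition nonlin (N : nat) (f : R3 -> R) : R3 -> R :=
  fun x => `|f x| ^+ N * f x.

(* The Duhamel formula at time t for u_tt - Delta u + (-1)^sg |u|^N u = 0,
   after applying the component F of the Fourier transform: by definition,
   m(sqrt(-Delta)) f is the tempered distribution whose Fourier transform is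
   m(|xi|) times that of f. The integral in s is taken weakly. *)
Definition duhamel (F : tdistr -> tdistr) (N : nat) (sg : bool)
    (u0 : R3 -> R) (u1 : tdistr) (u : R -> R3 -> R) (t : R) : Prop :=
  forall psi, schwartz psi ->
    F (distr_of (u t)) psi =
      distr_mul (cos_symbol t) (F (distr_of u0)) psi
    + distr_mul (sin_symbol t) (F u1) psi
    - (-1) ^+ sg * \int[lebesgue_measure]_(s in `[0, t])
        distr_mul (sin_symbol (t - s)) (F (distr_of (nonlin N (u s)))) psi.

(* u on I x R^3, extended by zero to other times *)
Definition on_slab (I : set R) (u : R -> R3 -> R) : R * R3 -> R :=
  (fun p => u p.1 p.2) \_ (I `*` setT).

Definition mild_solution (N : nat) (sg : bool)
    (u0 : R3 -> R) (u1 : tdistr) (I : set R) (u : R -> R3 -> R) : Prop :=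
  [/\ on_slab I u \in Lfun (lebesgue_tx R) +oo%E,
      forall t, I t -> u t \in Lfun mu +oo%E &
      forall t, I t -> duhamel fourier_re N sg u0 u1 u t /\
                       duhamel fourier_im N sg u0 u1 u t].

Definition Linfty (f : R3 -> R) : \bar R := 'N[mu]_+oo [EFin \o f].

Definition Linfty_tx (I : set R) (u : R -> R3 -> R) : \bar R :=
  'N[lebesgue_tx R]_+oo [EFin \o on_slab I u].

(* [0, T], read as [0, +oo) when T = +oo *)
Definition time_interval (T : \bar R) : set R :=
  [set t | 0 <= t /\ (t%:E <= T)%E].

End distributions.
Arguments tdistr : clear implicits.

(* Main.v *)
Require Import Defs.
From HB Require Import structures.
From mathcomp Require Import all_boot all_order all_algebra.
From mathcomp Require Import all_classical all_reals all_analysis.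
From mathcomp Require Import measurable_realfun ess_sup_inf ring lra.
Set Implicit Arguments.
Unset Strict Implicit.
Unset Printing Implicit Defensive.
Import Order.TTheory GRing.Theory Num.Theory.
Import numFieldNormedType.Exports.
Local Open Scope classical_set_scope.
Local Open Scope ring_scope.

(* With the outgoing condition the free radial evolution is pure translation of r u: its
   profile at time t is (r - t)/r g(r - t) for r > t and 0 otherwise, so it does not increase
   the sup norm. On radial functions the operator sin(t sqrt(-Delta))/sqrt(-Delta) is the average
   (2r)^-1 int_(|r - t|)^(r + t) rho F(rho) d rho, which has norm at most t on L^infty. Hence a
   Picard iteration for the profile f(t, r) converges in the ball of radius 2 |u_0|_infty as long
   as t^2 |u_0|_infty^N is small.

   That the fixed point solves the Duhamel formula is checked on the Fourier side. For bounded,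
   compactly supported F, polar coordinates give
     int F(|x|) cos(x.xi) dx = 4 |D| int_0^oo r F(r) sin_symbol r xi dr,
   D being the unit disc, and the two explicit formulas reduce to addition formulas for sin.
   They extend to all bounded profiles by dominated convergence along cutoffs, since the Fourier
   transforms of m(xi) psi(xi), m one of the wave symbols, are again Schwartz functions. The imaginary
   parts vanish because radial distributions pair to zero with odd functions. *)

(** * Measure-preserving maps and rotations *)

(** Polar coordinates are obtained without surface measure. After a rotation only the joint law of
    |x| and one coordinate z is needed; its density is 2|D|r on |z| < r, because the plane at height
    z meets the ball of radius b in a disc of area |D|(b^2 - z^2). The value of |D| cancels
    everywhere.

    The outgoing condition turns the pairing of u_1 with phi into the pairing of u_0 with phi_r +
    phi/r. On a cosine wave this is |x|^-1 K(s) with s = x.xi and K(s) = (s cos s)' = cos s - s sin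
    s; the integral of K over |z| < r is elementary, and the weight r absorbs the factor 1/r.

    The obstacle on the Fourier side is that u_1 is prescribed on Schwartz functions only, while
    |xi| is singular at 0. The gradient of cos(t|xi|) is expressed by the sine symbol, and the
    gradient of the sine symbol is a multiple of xi times the Fourier integral of a ball indicator,
    which can be differentiated under the integral any number of times. This yields a class of
    multipliers closed under differentiation.

    The iteration uses functions defined everywhere, with pointwise bounds, so restriction to a time
    slice causes no trouble with null sets. *)

Section measure_preserving.
Local Open Scope ereal_scope.
Context {d} {T : measurableType d} {R : realType}.
Variable m : {measure set T -> \bar R}.

Definition preserves (f : T -> T) : Prop :=
  measurable_fun setT f /\ forall A, measurable A -> m (f @^-1` A) = m A.

Lemma preserves_comp f g : preserves f -> preserves g -> preserves (f \o g).
Proof.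
move=> [mf pf] [mg pg]; split; first exact: measurableT_comp.
move=> A mA; rewrite comp_preimage pg ?pf//.
by rewrite -[_ @^-1` _]setTI; exact: mf.
Qed.

Lemma ge0_integral_preserves f (g : T -> \bar R) : preserves f ->
  measurable_fun setT g -> (forall x, 0 <= g x) ->
  \int[m]_x g (f x) = \int[m]_x g x.
Proof.
move=> [mf pf] mg g0.
rewrite (_ : (fun x => g (f x)) = g \o f)//.
rewrite -[X in \int[m]_(_ in X) (g \o f) _](preimage_setT f).
rewrite -ge0_integral_pushforward//.
by apply: eq_measure_integral => A mA _; rewrite -pf.
Qed.

Lemma integral_preserves f (g : T -> \bar R) : preserves f ->
  measurable_fun setT g -> \int[m]_x g (f x) = \int[m]_x g x.
Proof.
move=> pf mg; rewrite integralE [RHS]integralE; congr (_ - _).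
  rewrite -(ge0_integral_preserves (g := g^\+) pf)//; last exact: measurable_funepos.
  by under eq_integral do rewrite (funepos_comp g f).
rewrite -(ge0_integral_preserves (g := g^\-) pf)//; last exact: measurable_funeneg.
by under eq_integral do rewrite (funeneg_comp g f).
Qed.

Lemma integrable_preserves f (g : T -> R) : preserves f ->
  m.-integrable setT (EFin \o g) -> m.-integrable setT (EFin \o (g \o f)).
Proof.
move=> pf /integrableP[mg ig]; apply/integrableP; split.
  apply/measurable_EFinP; apply: measurableT_comp; last exact: pf.1.
  exact/measurable_EFinP.
by rewrite (ge0_integral_preserves (g := fun x => `|(g x)%:E|) pf)//;
  exact: measurableT_comp.
Qed.

End measure_preserving.

Lemma Rintegral_preserves d (T : measurableType d) (R : realType)
    (m : {measure set T -> \bar R}) f (g : T -> R) : preserves m f ->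
  measurable_fun setT g -> \int[m]_x g (f x) = \int[m]_x g x.
Proof.
move=> pf mg; rewrite /Rintegral.
by rewrite (integral_preserves (g := EFin \o g) pf)//; exact: measurableT_comp.
Qed.

Section lebesgue_affine.
Context {R : realType}.
Local Notation leb := (@lebesgue_measure R).

Lemma preserves_translation (c : R) : preserves leb (fun x : R => x + c).
Proof.
have mf : measurable_fun setT ((fun x : R => x + c) : _ -> measurableTypeR R).
  exact: measurable_funD.
split=> // A mA; apply/esym.
rewrite -[RHS]/(pushforward leb ((fun x : R => x + c) : _ -> measurableTypeR R) A).
apply: lebesgue_measure_unique => //= _ [[a b]] _ <-.
rewrite /pushforward (_ : _ @^-1` _ = `](a - c)%R, (b - c)%R]%classic); last first.
  by apply/seteqP; split=> x /=; rewrite !in_itv/= ltrBlDr lerBrDr.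
by rewrite !lebesgue_measure_itv/= !lte_fin ltrD2r -!EFinB; case: ifPn => // _;
  congr EFin; ring.
Qed.

Lemma lebesgue_measure_scale (s : R) (A : set R) : 0 < s -> measurable A ->
  leb ((fun x => s * x) @^-1` A) = (s^-1%:E * leb A)%E.
Proof.
move=> s0 mA.
have s0' : 0 <= s by exact: ltW.
have mf : measurable_fun setT ((fun x : R => s * x) : _ -> measurableTypeR R).
  exact: measurable_funM.
suff -> : leb A = mscale (NngNum s0')
    (pushforward leb ((fun x : R => s * x) : _ -> measurableTypeR R)) A.
  by rewrite /mscale/= muleA -EFinM mulVf ?gt_eqF// mul1e.
move=> mf'; apply: lebesgue_measure_unique => //= _ [[a b]] _ <-.
rewrite /mscale/= /pushforward (_ : _ @^-1` _ = `](a / s)%R, (b / s)%R]%classic); last first.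
  by apply/seteqP; split=> x /=; rewrite !in_itv/= ltr_pdivrMr// ler_pdivlMr// !(mulrC x).
rewrite !lebesgue_measure_itv/= !lte_fin ltr_pM2r ?invr_gt0// -!EFinB.
case: ifPn => _; last by rewrite mule0.
by rewrite -EFinM; congr EFin; field; rewrite gt_eqF.
Qed.

End lebesgue_affine.

Section lebesgue3_invariance.
Context {R : realType}.
Local Notation leb := (@lebesgue_measure R).
Local Notation R3 := (R * R * R)%type.
Local Notation mu := (lebesgue3 R).
Local Notation R' := (measurableTypeR R).

(** On each fibre over [T] the map is a translation, and the product measure sees only the measures
    of the fibres. Combined with coordinate swaps, this yields all the translations and rotations of
    space used below. *)
Lemma preserves_shear d (T : measurableType d)
    (m : {sigma_finite_measure set T -> \bar R}) (c : T -> R) :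
  measurable_fun setT c ->
  preserves (m \x leb)%E (fun p => (p.1, p.2 + c p.1)).
Proof.
move=> mc; split.
  apply: measurable_fun_pair => //=.
  by apply: measurable_funD => //; exact: measurableT_comp.
move=> A mA; rewrite /product_measure1; apply: eq_integral => x _ /=.
rewrite -[RHS](proj2 (preserves_translation (c x))); last exact: measurable_xsection.
by congr (leb _); apply/seteqP; split=> y; rewrite /= /xsection/= !inE.
Qed.

Lemma preserves_swap : preserves (lebesgue2 R) (fun p => (p.2, p.1)).
Proof.
have ms : measurable_fun setT (fun p : R * R => (p.2, p.1)).
  exact: measurable_fun_pair.
split=> // A mA.
(* The swap turns sections in one variable into sections in the other; the two iterated
   constructions of the product agree by uniqueness on rectangles. *)
transitivity (product_measure2 leb leb A).
  rewrite /lebesgue2 /product_measure1 /product_measure2.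
  apply: eq_integral => x _ /=.
  by congr (leb _); apply/seteqP; split=> y; rewrite /= /xsection/ysection/= !inE.
by apply/esym/product_measure_unique => // B C mB mC; rewrite /= product_measure2E.
Qed.

Lemma preserves_fst_swap : preserves mu (fun x => (x.1.2, x.1.1, x.2)).
Proof.
have ms : measurable_fun setT (fun x : R3 => (x.1.2, x.1.1, x.2)).
  apply: measurable_fun_pair => //; apply: measurable_fun_pair.
    exact: measurableT_comp.
  exact: measurableT_comp.
split=> // A mA.
rewrite /lebesgue3 /product_measure1.
rewrite -[RHS](ge0_integral_preserves preserves_swap) //=.
exact: measurable_fun_xsection.
Qed.

Lemma ge0_integral_lebesgue2 (f : R' * R' -> \bar R) : measurable_fun setT f ->
  (forall x, 0 <= f x)%E ->
  (\int[lebesgue2 R]_p f p = \int[leb]_x \int[leb]_y f (x, y))%E.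
Proof. exact: fubini_tonelli1. Qed.

Lemma lebesgue3_xsection (A : set (R' * R' * R')) : measurable A ->
  mu A = (\int[leb]_x (lebesgue2 R) [set p : R * R | A (x, p.1, p.2)])%E.
Proof.
move=> mA; rewrite /lebesgue3 /product_measure1.
rewrite (ge0_integral_lebesgue2 (f := leb \o xsection A)) //; last exact: measurable_fun_xsection.

Qed.

(** [lebesgue3] nests the first two coordinates, so the last two are not a factor of it. Slicing at
    a fixed first coordinate reduces the claim to the planar swap. *)
Lemma preserves_snd_swap : preserves mu (fun x => (x.1.1, x.2, x.1.2)).
Proof.
have ms : measurable_fun setT (fun x : R3 => (x.1.1, x.2, x.1.2)).
  apply: measurable_fun_pair => //; last exact: measurableT_comp.
  by apply: measurable_fun_pair => //; exact: measurableT_comp.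
split=> // A mA.
apply: etrans (etrans _ (esym (lebesgue3_xsection mA))).
  by apply: lebesgue3_xsection; rewrite -[X in measurable X]setTI; exact: ms.
apply: eq_integral => x _ /=.
rewrite -[RHS](proj2 preserves_swap)//.
have mx : measurable_fun setT (fun p : R * R => (x, p.1, p.2)).
  by apply: measurable_fun_pair => //; apply: measurable_fun_pair.
by rewrite -[X in measurable X]setTI; apply: mx.
Qed.

Definition shear3 (a : R) (x : R3) : R3 := (x.1.1, x.1.2, x.2 + a * x.1.2).

Lemma preserves_shear3 a : preserves mu (shear3 a).
Proof.
have -> : shear3 a = (fun x => (x.1, x.2 + (fun p => a * p.2) x.1)).
  by apply/funext => -[[]].
apply: (@preserves_shear _ _ (lebesgue2 R) (fun p => a * p.2)).
exact: measurable_funM.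
Qed.

Definition rot23 (c s : R) (x : R3) : R3 :=
  (x.1.1, c * x.1.2 - s * x.2, s * x.1.2 + c * x.2).

Definition rot13 (c s : R) (x : R3) : R3 :=
  (c * x.1.1 - s * x.2, x.1.2, s * x.1.1 + c * x.2).

(* A plane rotation is a product of three shears. *)
Lemma preserves_rot23 (c s : R) : 0 <= c -> c ^+ 2 + s ^+ 2 = 1 ->
  preserves mu (rot23 c s).
Proof.
move=> c0 cs.
(* For an angle with cosine [c] and sine [s], this is minus the tangent of the half angle, the slope
   of the two outer shears; [0 <= c] keeps the denominator away from 0. *)
pose a := - s / (1 + c).
have c1 : 1 + c != 0 by rewrite gt_eqF// ltr_pwDl.
have -> : rot23 c s =
    (fun x => (x.1.1, x.2, x.1.2)) \o shear3 a \o
    (fun x => (x.1.1, x.2, x.1.2)) \o shear3 s \o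
    ((fun x => (x.1.1, x.2, x.1.2)) \o shear3 a \o (fun x => (x.1.1, x.2, x.1.2))).
  have sa : 1 + s * a = c.
    rewrite /a mulrA mulrN -expr2 (_ : s ^+ 2 = (1 - c) * (1 + c)); last first.
      by rewrite -[s ^+ 2](addKr (c ^+ 2)) cs; ring.
    by rewrite -mulNr mulfK//; ring.
  have saa : a + a * (1 + s * a) = - s.
    by rewrite sa /a; field.
  apply/funext => -[[x y] z]; rewrite /rot23/shear3/=.
  congr (_, _, _).
    by rewrite -(addr0 (- (s * z))) -mulNr -saa -sa; ring.
  by rewrite -sa; ring.
have p1 := preserves_snd_swap; have p2 := preserves_shear3.
exact: (preserves_comp (preserves_comp (preserves_comp (preserves_comp p1 (p2 a)) p1)
  (p2 s)) (preserves_comp (preserves_comp p1 (p2 a)) p1)).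
Qed.

Lemma preserves_rot13 (c s : R) : 0 <= c -> c ^+ 2 + s ^+ 2 = 1 ->
  preserves mu (rot13 c s).
Proof.
move=> c0 cs.
have -> : rot13 c s = (fun x => (x.1.2, x.1.1, x.2)) \o rot23 c s \o
    (fun x => (x.1.2, x.1.1, x.2)).
  by apply/funext => -[[x y] z].
have p1 := preserves_fst_swap.
exact: (preserves_comp (preserves_comp p1 (preserves_rot23 c0 cs)) p1).
Qed.

(** The sign of [d] follows that of [b], which makes the cosine nonnegative, as the factorization
    into shears requires. *)
Lemma plane_rotation (a b : R) : exists c s d : R,
  [/\ 0 <= c, c ^+ 2 + s ^+ 2 = 1, a = d * s, b = d * c & d ^+ 2 = a ^+ 2 + b ^+ 2].
Proof.
have [ab0|ab0] := eqVneq (a ^+ 2 + b ^+ 2) 0.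
  exists 1, 0, 0; move: ab0 => /eqP; rewrite paddr_eq0 ?sqr_ge0// !sqrf_eq0.
  by move=> /andP[/eqP -> /eqP ->]; rewrite ler01; split=> //; ring.
have ab1 : 0 < a ^+ 2 + b ^+ 2.
  by rewrite lt_neqAle eq_sym ab0 addr_ge0// sqr_ge0.
pose n := Num.sqrt (a ^+ 2 + b ^+ 2).
have n0 : 0 < n by rewrite sqrtr_gt0.
have n2 : n ^+ 2 = a ^+ 2 + b ^+ 2 by rewrite sqr_sqrtr// ltW.
have nn : n != 0 by rewrite gt_eqF.
have [b0|b0] := leP 0 b.
  exists (b / n), (a / n), n; split => //; try by field.
    by rewrite divr_ge0// ltW.
  by rewrite !expr_div_n -mulrDl [b ^+ 2 + _]addrC -n2; field.
exists (- b / n), (- a / n), (- n); split => //; try by field.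
- by rewrite divr_ge0// ?(ltW n0)// oppr_ge0 ltW.
- rewrite !expr_div_n !sqrrN -mulrDl addrC -n2; by field.
- by rewrite sqrrN.
Qed.

(** A rotation in coordinates 1 and 3 removes the first component of [xi], then one in coordinates 2
    and 3 removes the second. The number [d] is |xi| only up to sign, which is harmless since the
    symbols are even functions of it. *)
Lemma rotate_to_axis (xi : R3) : exists (L : R3 -> R3) (d : R),
  [/\ preserves mu L, forall x, norm3 (L x) = norm3 x,
      forall x, dot3 x xi = d * (L x).2 & d ^+ 2 = dot3 xi xi].
Proof.
have [c [s [d [c0 cs e1 e2 ed]]]] := plane_rotation xi.1.1 xi.2.
have [c' [s' [d' [c0' cs' e1' e2' ed']]]] := plane_rotation xi.1.2 d.
exists (rot23 c' s' \o rot13 c s), d'; split.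
- by apply: preserves_comp; [exact: preserves_rot23|exact: preserves_rot13].
- move=> x; rewrite /norm3; congr Num.sqrt; rewrite /dot3 /rot23 /rot13 /=.
  transitivity ((c ^+ 2 + s ^+ 2) * x.1.1 ^+ 2 + (c ^+ 2 + s ^+ 2) * x.2 ^+ 2
      + x.1.2 ^+ 2); last by rewrite cs; ring.
  transitivity ((c * x.1.1 - s * x.2) ^+ 2 + (c' ^+ 2 + s' ^+ 2) * (x.1.2 ^+ 2 +
      (s * x.1.1 + c * x.2) ^+ 2)); first by ring.
  by rewrite cs'; ring.
- by move=> x; rewrite /dot3 /= e1 e2 e1' e2'; ring.
- by rewrite ed' ed /dot3; ring.
Qed.

End lebesgue3_invariance.

(** * Distribution of the distance to the origin on horizontal planes *)

Lemma ge0_integral_mrestr d (T : measurableType d) (R : realType)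
    (m : {measure set T -> \bar R}) (D : set T) (mD : measurable D)
    (f : T -> \bar R) : measurable_fun setT f -> (forall x, 0 <= f x)%E ->
  (\int[mrestr m mD]_x f x = \int[m]_(x in D) f x)%E.
Proof.
move=> mf f0.
rewrite [LHS](ge0_negligible_integral (N := ~` D))//; last 2 first.
- exact: measurableC.
- by rewrite /= /mrestr setICl measure0.
rewrite setTD setCK; apply: eq_measure_integral => A mA AD.
by rewrite /= /mrestr (setIidl AD).
Qed.

(** Proportional image measures have proportional integrals. A density can thus be replaced by a
    second map [g] with a known image measure. *)
Lemma ge0_integral_pushforward_mscale d1 d2 d3 (T1 : measurableType d1)
    (T2 : measurableType d2) (S : measurableType d3) (R : realType)
    (m1 : {measure set T1 -> \bar R}) (m2 : {measure set T2 -> \bar R})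
    (f : T1 -> S) (g : T2 -> S) (k : {nonneg R}) (H : S -> \bar R) :
  measurable_fun setT f -> measurable_fun setT g ->
  (forall A, measurable A -> m1 (f @^-1` A) = k%:num%:E * m2 (g @^-1` A))%E ->
  measurable_fun setT H -> (forall x, 0 <= H x)%E ->
  (\int[m1]_x H (f x) = k%:num%:E * \int[m2]_y H (g y))%E.
Proof.
move=> mf mg fg mH H0.
have H0' : {in setT, forall y, (0 <= H y)%E} by [].
apply: etrans (esym (ge0_integral_pushforward mf m1 measurableT mH H0')) _.
rewrite -[X in (_ = _ * X)%E](ge0_integral_pushforward mg m2 measurableT mH H0').
rewrite -ge0_integral_mscale//.
by apply: eq_measure_integral => A mA _; rewrite /=/mscale/=/pushforward fg.
Qed.

(** * Measurability of elementary operations *)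

Section measurability.
Context {R : realType} d {T : measurableType d}.
Implicit Types f g : T -> R.

(** The inverse of [x] is [x] times a real power of [x ^+ 2], and real powers are measurable; the
    factor [x] also reproduces the convention that 0 has inverse 0. *)
Lemma measurable_funV f : measurable_fun setT f -> measurable_fun setT (fun x => (f x)^-1).
Proof.
move=> mf.
have -> : (fun x => (f x)^-1) = (fun x => f x * (f x ^+ 2) `^ (-1)).
  apply/funext => x; have [->|fx] := eqVneq (f x) 0; first by rewrite invr0 mul0r.
  by rewrite powR_inv1 ?sqr_ge0// expr2 invfM mulrA divff// mul1r.
apply: measurable_funM => //.
apply: (measurableT_comp (f := fun x : R => x `^ (-1))).
  exact: measurable_powR.
exact: measurable_funX.
Qed.

Lemma measurable_fun_sqrt f : measurable_fun setT f -> measurable_fun setT (fun x => Num.sqrt (f x)).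
Proof.
move=> mf; apply: (measurableT_comp (f := @Num.sqrt R)) => //.
exact: continuous_measurable_fun (@sqrt_continuous R).
Qed.

Lemma measurable_fun_cos f : measurable_fun setT f -> measurable_fun setT (fun x => cos (f x)).
Proof.
move=> mf; apply: (measurableT_comp (f := @cos R)) => //.
exact: continuous_measurable_fun (@continuous_cos R).
Qed.

Lemma measurable_fun_sin f : measurable_fun setT f -> measurable_fun setT (fun x => sin (f x)).
Proof.
move=> mf; apply: (measurableT_comp (f := @sin R)) => //.
exact: continuous_measurable_fun (@continuous_sin R).
Qed.

Lemma measurable_set_lt f g : measurable_fun setT f -> measurable_fun setT g ->
  measurable [set x | f x < g x].
Proof.
move=> mf mg.
rewrite -[X in measurable X]setTI.
by apply: (measurable_fun_ltr mf mg measurableT (Y := [set true])).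
Qed.

Lemma measurable_fun_indlt (f g : T -> R) (h k : T -> R) :
  measurable_fun setT f -> measurable_fun setT g ->
  measurable_fun setT h -> measurable_fun setT k ->
  measurable_fun setT (fun x => if f x < g x then h x else k x).
Proof. by move=> mf mg mh mk; apply: measurable_fun_ifT => //; exact: measurable_fun_ltr. Qed.

End measurability.

Section polar.
Context {R : realType}.
Local Notation leb := (@lebesgue_measure R).
Local Notation R3 := (R * R * R)%type.
Local Notation mu := (lebesgue3 R).
Local Notation R' := (measurableTypeR R).

Lemma ge0_integral_scale (s : R) (f : R' -> \bar R) : 0 < s ->
  measurable_fun setT f -> (forall x, 0 <= f x)%E ->
  (\int[leb]_x f (s * x)%R = s^-1%:E * \int[leb]_x f x)%E.
Proof.
move=> s0 mf f0.
have ms : measurable_fun setT ((fun x : R => s * x) : R' -> R').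
  exact: measurable_funM.
have si0 : 0 <= s^-1 by rewrite invr_ge0 ltW.
rewrite -(ge0_integral_mscale leb measurableT (NngNum si0))//.
have f0' : {in setT, forall y, (0 <= f y)%E} by [].
apply: etrans (esym (ge0_integral_pushforward ms leb measurableT mf f0')) _.
by apply: eq_measure_integral => A mA _; rewrite /= /mscale/= -lebesgue_measure_scale.
Qed.

Lemma lebesgue2_scale (s : R) (A : set (R' * R')) : 0 < s -> measurable A ->
  lebesgue2 R ((fun p => (s * p.1, s * p.2)) @^-1` A) =
  ((s ^- 2)%:E * lebesgue2 R A)%E.
Proof.
move=> s0 mA; rewrite /lebesgue2 /product_measure1.
transitivity (\int[leb]_x (s^-1%:E * leb (xsection A (s * x)%R)))%E.
  apply: eq_integral => x _ /=.
  rewrite -lebesgue_measure_scale//; last exact: measurable_xsection.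
have mx : measurable_fun setT (fun x : R' => leb (xsection A x)).
  exact: measurable_fun_xsection.
rewrite ge0_integralZl//=.
- rewrite (ge0_integral_scale (f := fun x => leb (xsection A x)))//.
  by rewrite muleA -EFinM -expr2 exprVn.
- apply: (measurableT_comp mx); exact: measurable_funM.
- by rewrite lee_fin invr_ge0 ltW.
Qed.

Definition unit_disc : set (R' * R') := [set p | p.1 ^+ 2 + p.2 ^+ 2 < 1].

(** The number is pi, but its value is never computed: it enters both sides of each identity through
    the same factor, and finiteness and positivity suffice. *)
Definition disc_area : R := fine (lebesgue2 R unit_disc).

Lemma measurable_disc (q : R) : measurable [set p : R' * R' | p.1 ^+ 2 + p.2 ^+ 2 < q].
Proof.
apply: measurable_set_lt => //.
by apply: measurable_funD; apply: measurable_funX.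
Qed.

Lemma disc_areaE : lebesgue2 R unit_disc = disc_area%:E.
Proof.
rewrite /disc_area fineK// ge0_fin_numE//.
apply: (@le_lt_trans _ _ (lebesgue2 R (`[-1, 1]%classic `*` `[-1, 1]%classic))).
  apply: le_measure; rewrite ?inE//.
  - exact: measurable_disc.
  - exact: measurableX.
  - move=> [x y] /=; rewrite !in_itv/= /unit_disc/= => xy.
    by split; apply/andP; split; nra.
by rewrite /lebesgue2 product_measure1E//= !lebesgue_measure_itv/= lte_fin;
  case: ifP => _; rewrite ?mule0 ?ltry// -EFinB -EFinM ltry.
Qed.

Lemma disc_area_gt0 : 0 < disc_area.
Proof.
rewrite -lte_fin -disc_areaE.
apply: (@lt_le_trans _ _ (lebesgue2 R (`[0, 2^-1]%classic `*` `[0, 2^-1]%classic))).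
  rewrite /lebesgue2 product_measure1E//=.
  rewrite !lebesgue_measure_itv/=.
  rewrite lte_fin invr_gt0 ltr0n.
  by rewrite -EFinB -EFinM lte_fin subr0 mulr_gt0// invr_gt0 ltr0n.
apply: le_measure; rewrite ?inE//.
- exact: measurableX.
- exact: measurable_disc.
- move=> [x y] /=; rewrite !in_itv/= => -[/andP[x0 x1] /andP[y0 y1]].
  rewrite /unit_disc/=; nra.
Qed.

Lemma lebesgue2_disc (q : R) :
  lebesgue2 R [set p | p.1 ^+ 2 + p.2 ^+ 2 < q] = (disc_area * Num.max q 0)%:E.
Proof.
have [q0|q0] := leP q 0.
  rewrite mulr0 (_ : [set p | _] = set0) ?measure0//.
  apply/seteqP; split=> p //=; apply/negP; rewrite -leNgt (le_trans q0)//.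
  by rewrite addr_ge0// sqr_ge0.
pose s := (Num.sqrt q)^-1.
have s0 : 0 < s by rewrite invr_gt0 sqrtr_gt0.
have sq : s ^- 2 = q by rewrite /s exprVn invrK sqr_sqrtr// ltW.
rewrite EFinM muleC -disc_areaE -{2}sq.
apply: etrans (lebesgue2_scale s0 (measurable_disc 1)).
have s2 : s ^+ 2 = q^-1 by rewrite -sq invrK.
congr (lebesgue2 R _); apply/seteqP; split=> p /=; rewrite /unit_disc/= !exprMn -mulrDr s2.
  by move=> h; rewrite mulrC ltr_pdivrMr// mul1r.
by rewrite mulrC ltr_pdivrMr// mul1r.
Qed.


Definition axis_radius (z : R) (p : R' * R') : R' := Num.sqrt (p.1 ^+ 2 + p.2 ^+ 2 + z ^+ 2).

(** An auxiliary planar region whose section over [r] has length 2r for r > |z|. Projecting it to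
    the first coordinate realizes the measure 2r dr on r > |z| as an image of Lebesgue measure. *)
Definition axis_cone (z : R) : set (R' * R') := [set p | `|z| < p.1 /\ `|p.2| < p.1].

Lemma measurable_axis_radius z : measurable_fun setT (axis_radius z).
Proof.
apply: measurable_fun_sqrt; apply: measurable_funD => //.
by apply: measurable_funD; apply: measurable_funX.
Qed.

Lemma measurable_axis_cone z : measurable (axis_cone z).
Proof.
rewrite (_ : axis_cone z = [set p | `|z| < p.1] `&` [set p | `|p.2| < p.1])//.
apply: measurableI; first exact: measurable_set_lt.
apply: measurable_set_lt => //.
exact: (measurableT_comp (@normr_measurable R setT)).
Qed.

Lemma integral_cone_slice (z r : R) :
  (\int[leb]_y (\1_(axis_cone z) (r, y))%:E = (if `|z| < r then 2 * r else 0)%:E)%E.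
Proof.
rewrite (_ : (fun y => _) = (fun y => (\1_(xsection (axis_cone z) r) y)%:E)); last first.
  by apply/funext => y; rewrite !indicE mem_xsection.
rewrite integral_indic//=; last by apply: measurable_xsection; exact: measurable_axis_cone.
rewrite setIT (_ : xsection _ _ = if `|z| < r then `]-r, r[%classic else set0); last first.
  apply/seteqP; split => y; rewrite /xsection/= inE /axis_cone/=.
    by move=> [-> yr]; rewrite /= in_itv/= -ltr_norml.
  by case: ifP => // zr; rewrite /= in_itv/= -ltr_norml.
case: ifPn => zr; last by rewrite measure0.
have r0 : 0 < r by rewrite (le_lt_trans _ zr).
rewrite lebesgue_measure_itv/= lte_fin ifT; last by lra.
by rewrite -EFinD; congr EFin; lra.
Qed.

Lemma integral_linear (a b : R) : 0 <= a -> a < b ->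
  (\int[leb]_r (if (a < r) && (r < b) then 2 * r else 0)%:E = (b ^+ 2 - a ^+ 2)%:E)%E.
Proof.
move=> a0 ab.
rewrite (_ : (fun r => _) = ((fun r : R => (2 * r)%:E) \_ `]a, b[)); last first.
  by apply/funext => r; rewrite /patch mem_setE in_itv/=; case: ifP.
rewrite -integral_mkcond -[LHS](@integral_itv_bndoo _ a b _ true false)//; last first.
  apply/measurable_EFinP; exact: measurable_funM.
rewrite (@continuous_FTC2 _ (fun r => 2 * r) (fun r => r ^+ 2))//.
- apply: continuous_subspaceT => x; apply: cvgM; [exact: cvg_cst|exact: cvg_id].
- split.
  + by move=> x _; exact: ex_derive.
  + by apply: cvg_at_right_filter; exact: exprn_continuous.
  + by apply: cvg_at_left_filter; exact: exprn_continuous.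
- by move=> x _; rewrite derive1E derive_val; rewrite /GRing.scale/=; lra.
Qed.

Lemma measure_unique_rays (m1 m2 : {measure set R' -> \bar R}) :
  (forall b : R, m1 `]-oo, b[%classic = m2 `]-oo, b[%classic) ->
  (forall n : nat, m1 `]-oo, n%:R[%classic < +oo)%E ->
  forall A, measurable A -> m1 A = m2 A.
Proof.
move=> m12 m1oo A mA.
refine (@measure_unique _ R R' (@RGenInftyO.G R) (fun n => `]-oo, n%:R[%classic) _ _ _ _ m1 m2 _ _ A mA) => //.
- exact: RGenInftyO.measurableE.
- move=> _ _ [x ->] [y ->]; exists (Num.min x y).
  apply/seteqP; split=> t /=; rewrite !in_itv/= lt_min; first by case=> -> ->.
  by move=> /andP.
- by move=> i; exists i%:R.
- rewrite -subTset => x _; exists (Num.trunc `|x|).+1 => //=.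
  rewrite in_itv/= (le_lt_trans (ler_norm _))//.
  by have := truncn_itv (normr_ge0 x) => /andP[].
- by move=> _ [b ->].
Qed.

(** It suffices to compare both measures on rays r < b. On the left this is a disc of squared radius
    b^2 - z^2, hence area |D|(b^2 - z^2); on the right it is |D| times the integral of 2r from |z|
    to b. *)
Lemma axis_radius_distribution (z : R) (A : set R') : measurable A ->
  lebesgue2 R (axis_radius z @^-1` A) =
  (disc_area%:E * lebesgue2 R (axis_cone z `&` fst @^-1` A))%E.
Proof.
move=> mA.
have k0 : 0 <= disc_area by exact/ltW/disc_area_gt0.
have mr := measurable_axis_radius z.
have mf : measurable_fun setT (fst : R' * R' -> R') by [].
suff /(_ mf): pushforward (lebesgue2 R) (axis_radius z) A =
    mscale (NngNum k0) (pushforward (mrestr (lebesgue2 R) (measurable_axis_cone z)) fst) A.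
  by rewrite /pushforward/mscale/mrestr/= setIC.
have cylinder b : lebesgue2 R (axis_radius z @^-1` `]-oo, b[) =
    (disc_area * (if `|z| < b then b ^+ 2 - z ^+ 2 else 0))%:E.
  rewrite (_ : _ @^-1` _ = if `|z| < b then [set p | p.1 ^+ 2 + p.2 ^+ 2 < b ^+ 2 - z ^+ 2]
      else set0); last first.
    apply/seteqP; split=> p /=; rewrite in_itv/= /axis_radius.
      move=> h.
      have b0 : 0 < b by rewrite (le_lt_trans _ h)// sqrtr_ge0.
      have h2 : p.1 ^+ 2 + p.2 ^+ 2 + z ^+ 2 < b ^+ 2.
        rewrite -(@ltr_sqrt _ _ (b ^+ 2)) ?exprn_gt0//.
        by rewrite [X in _ < X]sqrtr_sqr gtr0_norm.
      have p1 := sqr_ge0 p.1; have p2 := sqr_ge0 p.2.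
      rewrite ifT; first by rewrite /= ltrBrDr.
      by rewrite -(gtr0_norm b0) -sqrtr_sqr -[X in _ < X]sqrtr_sqr ltr_sqrt ?exprn_gt0//; lra.
    case: ifP => // zb; rewrite /= ltrBrDr => h.
    have b0 : 0 < b by rewrite (le_lt_trans _ zb).
    by rewrite -(gtr0_norm b0) -sqrtr_sqr ltr_sqrt// exprn_gt0.
  case: ifPn => zb; last by rewrite measure0 mulr0.
  rewrite lebesgue2_disc max_l// subr_ge0 -[z ^+ 2]real_normK ?num_real//.
  by rewrite lerXn2r ?nnegrE ?(ltW zb)// (le_trans _ (ltW zb)).
move=> mf'; apply: measure_unique_rays => //.
- move=> b /=; rewrite /mscale/= /pushforward/mrestr/= cylinder EFinM; congr (_ * _)%E.
  have mB : measurable (fst @^-1` `]-oo, b[ `&` axis_cone z).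
    apply: measurableI; last exact: measurable_axis_cone.
    by rewrite -[X in measurable X]setTI; exact: mf.
  apply/esym; rewrite -[LHS]mule1.
  transitivity (\int[lebesgue2 R]_p (\1_(fst @^-1` `]-oo, b[ `&` axis_cone z) p)%:E)%E.
    by rewrite integral_indic//= setIT mule1.
  rewrite ge0_integral_lebesgue2//; last first.
    by apply/measurable_EFinP; exact: measurable_indic.
  transitivity (\int[leb]_r (if (`|z| < r) && (r < b) then 2 * r else 0)%:E)%E.
    apply: eq_integral => r _.
    have [rb|rb] := ltP r b; last first.
      rewrite andbF integral0_eq// => y _; rewrite indicE memNset//= in_itv/=.
      by move=> []; rewrite ltNge rb.
    rewrite andbT -integral_cone_slice; apply: eq_integral => y _.
    congr EFin; rewrite !indicE; congr (nat_of_bool _)%:R.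
    by apply/idP/idP; rewrite !inE/= in_itv/= rb; [case|split].
  case: ifPn => zb; first by rewrite integral_linear// real_normK ?num_real.
  rewrite integral0_eq// => r _; case: ifP => // /andP[zr rb].
  by rewrite (lt_trans zr rb) in zb.
- by move=> n /=; rewrite /pushforward cylinder ltry.
Qed.

Lemma ge0_integral_axis_radius (z : R) (H : R' -> \bar R) : measurable_fun setT H ->
  (forall r, 0 <= H r)%E ->
  (\int[lebesgue2 R]_p H (axis_radius z p) =
   \int[leb]_r ((if `|z| < r then 2 * disc_area * r else 0)%:E * H r))%E.
Proof.
move=> mH H0.
have k0 : 0 <= disc_area by exact/ltW/disc_area_gt0.
have mr := measurable_axis_radius z.
have mf : measurable_fun setT (fst : R' * R' -> R') by [].
have H0' : {in setT, forall y, (0 <= H y)%E} by [].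
have mc := measurable_axis_cone z.
rewrite (ge0_integral_pushforward_mscale (m2 := mrestr (lebesgue2 R) mc)
  (g := fst) (k := NngNum k0))//=; last first.
  by move=> A mA; rewrite axis_radius_distribution// /mrestr setIC.
rewrite (@ge0_integral_mrestr _ _ _ _ _ mc (H \o fst))//=; last exact: measurableT_comp.
rewrite integral_mkcond ge0_integral_lebesgue2//=; last 2 first.
- apply/(measurable_restrictT _ _).1 => //; apply: measurable_funTS.
  exact: (measurableT_comp mH).
- by move=> p; rewrite /patch; case: ifP => _ //=.
rewrite -ge0_integralZl//=; last 2 first.
- apply: (measurable_fun_fubini_tonelli_F (m2 := leb) (fun p => ((H \o fst) \_ (axis_cone z)) p)).
    apply/(measurable_restrictT _ _).1 => //; apply: measurable_funTS.
    exact: (measurableT_comp mH).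
  by move=> p; rewrite /patch; case: ifP => _ //=.
- by move=> r _; apply: integral_ge0 => y _; rewrite /patch; case: ifP => _ //=.
apply: eq_integral => r _.
transitivity (disc_area%:E * \int[leb]_y ((\1_(axis_cone z) (r, y))%:E * H r))%E.
  congr (_ * _)%E; apply: eq_integral => y _; rewrite /patch indicE/=.
  by case: ifP => _; rewrite ?mul1e ?mul0e.
rewrite ge0_integralZr//=; last first.
  apply/measurable_EFinP; apply: (measurableT_comp (f := \1_(axis_cone z) : _ -> R)) => //.
rewrite integral_cone_slice muleA -EFinM; congr (_%:E * _)%E.
by case: ifP => _; ring.
Qed.

End polar.

(** * Real-valued Fubini theorem and polar coordinates *)

Section Rintegral_utilities.
Context d {T : measurableType d} {R : realType} (m : {measure set T -> \bar R}).

Lemma integrable_measurable_fun (f : T -> R) :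
  m.-integrable setT (EFin \o f) -> measurable_fun setT f.
Proof. by move=> /(measurable_int m) /measurable_EFinP. Qed.

Lemma integrable_dominated (f g : T -> R) :
  m.-integrable setT (EFin \o g) -> measurable_fun setT f ->
  (forall x, `|f x| <= g x) -> m.-integrable setT (EFin \o f).
Proof.
move=> ig mf fg; apply: (le_integrable _ _ _ ig) => //.
  exact/measurable_EFinP.
by move=> x _ /=; rewrite lee_fin (le_trans (fg x))// ler_norm.
Qed.

Lemma integrable_indic_dominated (f : T -> R) (S : set T) (M : R) :
  measurable S -> (m S < +oo)%E -> measurable_fun setT f ->
  (forall x, S x -> `|f x| <= M) -> (forall x, ~ S x -> f x = 0) ->
  m.-integrable setT (EFin \o f).
Proof.
move=> mS Soo mf fM f0.
apply: (@integrable_dominated _ (fun x => `|M| * \1_S x)) => //.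
  apply: (@integrableZl _ _ _ m _ measurableT `|M| (fun x => (\1_S x)%:E)).
  apply/integrableP; split; first by apply/measurable_EFinP; exact: measurable_indic.
  under eq_integral do rewrite gee0_abs ?lee_fin//.
  by rewrite integral_indic// setIT.
move=> x; rewrite indicE; have [xS|xS] := boolP (x \in S).
  by rewrite mulr1 (le_trans (fM x _))// ?ler_norm//; exact: set_mem.
have nS : ~ S x by move=> /mem_set; rewrite (negbTE xS).
by rewrite f0// normr0 mulr0.
Qed.

Lemma le_normr_Rintegral_dominated (f g : T -> R) :
  m.-integrable setT (EFin \o g) -> measurable_fun setT f ->
  (forall x, `|f x| <= g x) -> `|\int[m]_x f x| <= \int[m]_x g x.
Proof.
move=> ig mf fg; have fi := integrable_dominated ig mf fg.
apply: (le_trans (le_normr_Rintegral _ fi)) => //.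
apply: le_Rintegral => //.
exact: integrable_norm.
Qed.

End Rintegral_utilities.

Section Rintegral_fubini.
Context d1 d2 {T1 : measurableType d1} {T2 : measurableType d2} {R : realType}.
Variables (m1 : {sigma_finite_measure set T1 -> \bar R})
  (m2 : {sigma_finite_measure set T2 -> \bar R}).

Lemma measurable_fun_Rintegral (f : T1 * T2 -> R) : measurable_fun setT f ->
  measurable_fun setT (fun x => \int[m2]_y f (x, y)).
Proof.
move=> mf; have mf' : measurable_fun setT (EFin \o f) by exact/measurable_EFinP.
apply: (measurableT_comp (f := fine)) => //.
rewrite (_ : (fun x => _) = fubini_F m2 (EFin \o f)^\+ \- fubini_F m2 (EFin \o f)^\-)%E.
  apply: emeasurable_funB.
    by apply: measurable_fun_fubini_tonelli_F => //; exact: measurable_funepos.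
  by apply: measurable_fun_fubini_tonelli_F => //; exact: measurable_funeneg.
apply/funext => x; rewrite integralE; congr (_ - _)%E.
  by apply: eq_integral => y _; rewrite !funeposE.
by apply: eq_integral => y _; rewrite !funenegE.
Qed.

Lemma Rintegral_prod1 (f : T1 * T2 -> R) :
  (m1 \x m2)%E.-integrable setT (EFin \o f) ->
  \int[m1]_x \int[m2]_y f (x, y) = \int[(m1 \x m2)%E]_z f z.
Proof.
move=> fi; rewrite /Rintegral -(integral12_prod_meas1 fi); congr fine.
have mf : measurable_fun setT f by exact: (integrable_measurable_fun fi).
apply: ae_eq_integral => //.
- by apply/measurable_EFinP; exact: measurable_fun_Rintegral.
- exact: (measurable_int m1 (integrable_fubini_F fi)).
- have := ae_integrable1 fi; apply: filterS => x fxi _ /=.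
  by rewrite fineK//; exact: integrable_fin_num.
Qed.

Lemma integrable_Rintegral1 (f : T1 * T2 -> R) :
  (m1 \x m2)%E.-integrable setT (EFin \o f) ->
  m1.-integrable setT (EFin \o (fun x => \int[m2]_y f (x, y))).
Proof.
move=> fi.
have mf : measurable_fun setT f by exact: (integrable_measurable_fun fi).
apply: (le_integrable _ _ _ (integrable_fubini_F fi)) => //.
  by apply/measurable_EFinP; exact: measurable_fun_Rintegral.
move=> x _; rewrite /fubini_F /= /Rintegral; move: (integral m2 setT _) => -[r||] /=.
- by [].
- by rewrite normr0 leey.
- by rewrite normr0 leey.
Qed.

End Rintegral_fubini.

Section Rintegral_fubini2.
Context d1 d2 {T1 : measurableType d1} {T2 : measurableType d2} {R : realType}.
Variables (m1 : {sigma_finite_measure set T1 -> \bar R})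
  (m2 : {sigma_finite_measure set T2 -> \bar R}).

Lemma integrable_swap (f : T1 * T2 -> R) :
  (m1 \x m2)%E.-integrable setT (EFin \o f) ->
  (m2 \x m1)%E.-integrable setT (EFin \o (fun z => f (z.2, z.1))).
Proof.
move=> fi; have mf := integrable_measurable_fun fi.
apply/integrable21ltyP.
  by apply/measurable_EFinP/(measurableT_comp mf); exact: measurable_fun_pair.
by move/integrable12ltyP : fi; apply; exact/measurable_EFinP.
Qed.

Lemma Rintegral_prod2 (f : T1 * T2 -> R) :
  (m1 \x m2)%E.-integrable setT (EFin \o f) ->
  \int[m2]_y \int[m1]_x f (x, y) = \int[(m1 \x m2)%E]_z f z.
Proof.
move=> fi; have mf := integrable_measurable_fun fi.
have /= -> := Rintegral_prod1 (integrable_swap fi).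
rewrite /Rintegral -(integral12_prod_meas1 (integrable_swap fi)) -(integral21_prod_meas1 fi).
by [].
Qed.

Lemma Rintegral_exchange (f : T1 * T2 -> R) :
  (m1 \x m2)%E.-integrable setT (EFin \o f) ->
  \int[m1]_x \int[m2]_y f (x, y) = \int[m2]_y \int[m1]_x f (x, y).
Proof. by move=> fi; rewrite Rintegral_prod1// Rintegral_prod2. Qed.

Lemma integrable_tensor (f : T1 * T2 -> R) (a : T1 -> R) (b : T2 -> R) :
  m1.-integrable setT (EFin \o a) -> m2.-integrable setT (EFin \o b) ->
  measurable_fun setT f -> (forall z, `|f z| <= a z.1 * b z.2) ->
  (m1 \x m2)%E.-integrable setT (EFin \o f).
Proof.
move=> ia ib mf fab.
have ma : measurable_fun setT a by exact: (integrable_measurable_fun ia).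
have mb : measurable_fun setT b by exact: (integrable_measurable_fun ib).
apply: (@integrable_dominated _ _ _ _ _ (fun z => `|a z.1| * `|b z.2|)) => //; last first.
  by move=> z; rewrite -normrM (le_trans (fab z))// ler_norm.
have mab : measurable_fun setT (fun z : T1 * T2 => `|a z.1| * `|b z.2|).
  apply: measurable_funM.
    by apply: (measurableT_comp (@normr_measurable R setT)); exact: measurableT_comp.
  by apply: (measurableT_comp (@normr_measurable R setT)); exact: measurableT_comp.
apply/integrable12ltyP; first exact/measurable_EFinP.
have /integrableP[_ ia'] := ia; have /integrableP[_ ib'] := ib.
have ib0 : (0 <= \int[m2]_y `|b y|%:E)%E by apply: integral_ge0 => y _; rewrite lee_fin.
under eq_integral.
  move=> x _.
  under eq_integral do rewrite /= ger0_norm ?mulr_ge0// EFinM.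
  rewrite ge0_integralZl//; last first.
    by apply/measurable_EFinP; exact: (measurableT_comp (@normr_measurable R setT)).
  over.
rewrite ge0_integralZr//; last first.
  by apply/measurable_EFinP; exact: (measurableT_comp (@normr_measurable R setT)).
have ia0 : (0 <= \int[m1]_x `|a x|%:E)%E by apply: integral_ge0 => x _; rewrite lee_fin.
by apply: lte_mul_pinfty => //; rewrite ge0_fin_numE.
Qed.

End Rintegral_fubini2.

Section polar_coordinates.
Context {R : realType}.
Local Notation leb := (@lebesgue_measure R).
Local Notation R3 := (R * R * R)%type.
Local Notation mu := (lebesgue3 R).
Local Notation R' := (measurableTypeR R).
Local Notation kappa := (@disc_area R).

Lemma measurable_dot3 (xi : R3) : measurable_fun setT (fun x : R3 => dot3 x xi).
Proof.
by rewrite /dot3; apply: measurable_funD; [apply: measurable_funD|];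
  apply: measurable_funM => //; do ?exact: measurableT_comp.
Qed.

Lemma measurable_dot3_pair : measurable_fun setT (fun z : R3 * R3 => dot3 z.1 z.2).
Proof.
by rewrite /dot3; apply: measurable_funD; [apply: measurable_funD|];
  apply: measurable_funM => //; do ?exact: measurableT_comp;
  do 2 apply: measurableT_comp => //.
Qed.

Lemma measurable_norm3 : measurable_fun setT (fun x : R3 => norm3 x).
Proof.
apply: measurable_fun_sqrt.
by rewrite /dot3; apply: measurable_funD; [apply: measurable_funD|];
  apply: measurable_funM => //; do ?exact: measurableT_comp.
Qed.

(** Density of the joint law of |x| and the third coordinate. Inside |z| < r it does not depend on
    z: by Archimedes, the height on a sphere is uniformly distributed. *)
Definition polar_weight (p : R' * R') : R := if `|p.2| < p.1 then 2 * kappa * p.1 else 0.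

Lemma polar_weight_ge0 p : 0 <= polar_weight p.
Proof.
rewrite /polar_weight; case: ifPn => // p21.
by rewrite !mulr_ge0// ?(ltW disc_area_gt0)// (le_trans _ (ltW p21)).
Qed.

Lemma measurable_polar_weight : measurable_fun setT polar_weight.
Proof.
apply: measurable_fun_indlt => //; last exact: measurable_funM.
by apply: (measurableT_comp (@normr_measurable R setT)).
Qed.

Lemma ge0_integral_polar_axis (H : R' * R' -> \bar R) : measurable_fun setT H ->
  (forall p, 0 <= H p)%E ->
  (\int[mu]_x H (norm3 x, x.2) =
   \int[lebesgue2 R]_p ((polar_weight p)%:E * H p))%E.
Proof.
move=> mH H0.
have mf : measurable_fun setT (fun x : R3 => H (norm3 x, x.2)).
  by apply: (measurableT_comp mH); apply: measurable_fun_pair => //; exact: measurable_norm3.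
have mw : measurable_fun setT (fun p => (polar_weight p)%:E * H p)%E.
  by apply: emeasurable_funM => //; apply/measurable_EFinP; exact: measurable_polar_weight.
have wH0 p : (0 <= (polar_weight p)%:E * H p)%E.
  by rewrite mule_ge0// lee_fin polar_weight_ge0.
have E1 := fubini_tonelli2 (m1 := lebesgue2 R) (m2 := leb) _ mf (fun x => H0 _).
have E2 := fubini_tonelli2 (m1 := leb) (m2 := leb) _ mw wH0.
apply: (etrans E1); apply/esym/(etrans E2); apply: eq_integral => z _.
rewrite /fubini_G.
have mHz : measurable_fun setT (fun r : R' => H (r, z)).
  by apply: (measurableT_comp mH); exact: measurable_fun_pair.
apply: etrans (esym (@ge0_integral_axis_radius R z (fun r => H (r, z)) mHz (fun r => H0 _))) _.
by apply: eq_integral => -[x y] _; rewrite /axis_radius /norm3 /dot3/= !expr2.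
Qed.

(** The rotation carries x.xi to [d] times the third coordinate and keeps |x|. Signed integrands are
    split into positive and negative parts, which commute with multiplication by the nonnegative
    weight. *)
Lemma integral_polar (xi : R3) : exists2 d : R, d ^+ 2 = dot3 xi xi &
  forall H : R' * R' -> \bar R, measurable_fun setT H ->
  (\int[mu]_x H (norm3 x, dot3 x xi) =
   \int[lebesgue2 R]_p ((polar_weight p)%:E * H (p.1, (d * p.2)%R)))%E.
Proof.
have [L [d [pL nL dL d2]]] := rotate_to_axis xi.
exists d => // H mH.
have mS : measurable_fun setT (fun p : R' * R' => (p.1, d * p.2)).
  by apply: measurable_fun_pair => //; exact: measurable_funM.
have ge0 (G : R' * R' -> \bar R) : measurable_fun setT G -> (forall p, 0 <= G p)%E ->
    (\int[mu]_x G (norm3 x, dot3 x xi) =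
     \int[lebesgue2 R]_p ((polar_weight p)%:E * G (p.1, (d * p.2)%R)))%E.
  move=> mG G0.
  have mG' : measurable_fun setT (fun p => G (p.1, d * p.2)).
    exact: (measurableT_comp mG mS).
  rewrite -(ge0_integral_polar_axis mG')//=.
  have mf : measurable_fun setT (fun x : R3 => G (norm3 x, d * x.2)).
    apply: (measurableT_comp mG); apply: measurable_fun_pair; first exact: measurable_norm3.
    exact: measurable_funM.
  rewrite -(ge0_integral_preserves pL mf)//.
  by apply: eq_integral => x _; rewrite nL dL.
rewrite integralE [RHS]integralE; congr (_ - _)%E.
  transitivity (\int[mu]_x (H^\+ (norm3 x, dot3 x xi)))%E.
    by apply: eq_integral => x _; rewrite !funeposE.
  rewrite ge0//; last exact: measurable_funepos.
  apply: eq_integral => p _; rewrite !funeposE maxe_pMr ?lee_fin ?polar_weight_ge0//.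
  by rewrite mule0.
transitivity (\int[mu]_x (H^\- (norm3 x, dot3 x xi)))%E.
  by apply: eq_integral => x _; rewrite !funenegE.
rewrite ge0//; last exact: measurable_funeneg.
apply: eq_integral => p _; rewrite !funenegE maxe_pMr ?lee_fin ?polar_weight_ge0//.
by rewrite mule0 muleN.
Qed.

Lemma integral_interval_derive (f F : R -> R) (a b : R) : a <= b ->
  (forall z : R, is_derive z (1 : R) F (f z)) -> continuous f ->
  \int[leb]_z (if (a < z) && (z < b) then f z else 0) = F b - F a.
Proof.
move=> ab dF cf.
rewrite (_ : (fun z => _) = f \_ `]a, b[); last first.
  by apply/funext => z; rewrite /patch mem_setE in_itv/=; case: ifP.
rewrite -Rintegral_mkcond /Rintegral.
rewrite -[X in fine X](@integral_itv_bndoo _ a b _ true false)//; last first.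
  apply/measurable_EFinP/measurable_funTS; exact: continuous_measurable_fun.
move: ab; rewrite le_eqVlt => /predU1P[->|ab].
  by rewrite set_itv1 integral_set1 subrr.
have cF : continuous F.
  by move=> z; apply: differentiable_continuous; apply/derivable1_diffP; exact: ex_derive.
rewrite (@continuous_FTC2 _ f F)//.
- exact: continuous_subspaceT.
- split.
  + by move=> z _; exact: ex_derive.
  + by apply: cvg_at_right_filter; exact: cF.
  + by apply: cvg_at_left_filter; exact: cF.
- by move=> z _; rewrite derive1E derive_val.
Qed.

Lemma integrable_bounded_interval (f : R' -> R) (a b M : R) :
  measurable_fun setT f -> (forall z, a < z -> z < b -> `|f z| <= M) ->
  leb.-integrable setT (EFin \o (fun z => if (a < z) && (z < b) then f z else 0)).
Proof.
move=> mf fM.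
apply: (@integrable_indic_dominated _ _ _ _ _ (`]a, b[%classic : set R') M) => //.
- by rewrite /= lebesgue_measure_itv/=; case: ifP => _; rewrite ?ltry// -EFinB ltry.
- apply: measurable_fun_ifT => //.
  by apply: measurable_and; apply: measurable_fun_ltr.
- by move=> z /=; rewrite in_itv/= => /andP[az zb]; rewrite az zb/= fM.
- by move=> z /=; rewrite in_itv/=; case: ifP.
Qed.

(* The factor F may be singular like 1/r at the origin. *)
Lemma Rintegral_radial (xi : R3) : exists2 d : R, d ^+ 2 = dot3 xi xi &
  forall (F K : R' -> R) (A B C : R), measurable_fun setT F -> measurable_fun setT K ->
  (forall r, A <= r -> F r = 0) -> (forall r, 0 < r -> r * `|F r| <= B) ->
  (forall s, `|K s| <= C * (1 + `|s|)) ->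
  mu.-integrable setT (fun x => (F (norm3 x) * K (dot3 x xi))%:E) /\
  \int[mu]_x (F (norm3 x) * K (dot3 x xi)) =
  \int[leb]_r (2 * kappa * r * F r *
    \int[leb]_z (if (- r < z) && (z < r) then K (d * z) else 0)).
Proof.
have [d d2 Hd] := integral_polar xi.
exists d => // F K A B C mF mK F0 FB KC.
have C0 : 0 <= C by have := KC 0; rewrite normr0 addr0 mulr1; apply: le_trans.
have B0 : 0 <= B by have := FB 1 ltr01; rewrite mul1r; apply: le_trans.
have mH : measurable_fun setT (fun p : R' * R' => F p.1 * K p.2).
  by apply: measurable_funM; exact: measurableT_comp.
have mHd : measurable_fun setT (fun p : R' * R' => polar_weight p * (F p.1 * K (d * p.2))).
  apply: measurable_funM; first exact: measurable_polar_weight.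
  apply: measurable_funM; first exact: measurableT_comp.
  by apply: (measurableT_comp mK); exact: measurable_funM.
have ki := ltW (@disc_area_gt0 R).
have Kb r z : `|z| < r -> r < A -> `|K (d * z)| <= C * (1 + `|d| * A).
  move=> zr rA; rewrite (le_trans (KC _))// ler_wpM2l// lerD2l normrM ler_wpM2l//.
  by rewrite ltW// (lt_trans zr).
(* The weight forces |z| < r and the support of [F] forces r < A, so the integrand lives on this
   square. There the factor r of the weight turns the hypothesis on r|F| into a plain bound. *)
pose S := `[- A, A]%classic `*` `[- A, A]%classic : set (R' * R').
have iw : (lebesgue2 R).-integrable setT
    (EFin \o (fun p => polar_weight p * (F p.1 * K (d * p.2)))).
  apply: (@integrable_indic_dominated _ _ _ _ _ S (`|2 * kappa * B * (C * (1 + `|d| * A))|)) => //.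
  - exact: measurableX.
  - rewrite /= /S /lebesgue2 product_measure1E//= !lebesgue_measure_itv/= lte_fin.
    by case: ifP => _; rewrite ?mule0 ?ltry// -EFinB -EFinM ltry.
  - move=> [r z] _; rewrite /polar_weight/=.
    have [zr|zr] := ltP `|z| r; last by rewrite mul0r normr0.
    have [rA|rA] := ltP r A; last by rewrite F0// mul0r mulr0 normr0.
    rewrite mulrA (_ : 2 * kappa * r * F r = 2 * kappa * (r * F r)); last by ring.
    have r0 : 0 < r by rewrite (le_lt_trans _ zr).
    rewrite (le_trans _ (ler_norm _))// normrM ler_pM//; last exact: (Kb r).
    rewrite normrM ger0_norm ?mulr_ge0// ler_wpM2l ?mulr_ge0// normrM gtr0_norm//.
    exact: FB.
  - move=> [r z] nS; rewrite /polar_weight/=.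
    have [zr|zr] := ltP `|z| r; last by rewrite mul0r.
    have [rA|rA] := ltP r A; last by rewrite F0// mul0r mulr0.
    exfalso; apply: nS; have r0 : 0 < r by rewrite (le_lt_trans _ zr).
    move: zr; rewrite ltr_norml => /andP[z1 z2].
    by split; rewrite /= in_itv/=; apply/andP; split; lra.
split.
  apply/integrableP; split.
    apply/measurable_EFinP.
    apply: (measurableT_comp mH (f := fun p => F p.1 * K p.2)
      (g := fun x : R3 => (norm3 x, dot3 x xi))).
    by apply: measurable_fun_pair; [exact: measurable_norm3|exact: measurable_dot3].
  rewrite (Hd (fun p => `|(F p.1 * K p.2)%:E|%E)); last first.
    by apply: measurableT_comp => //; exact/measurable_EFinP.
  have /integrableP[_] := iw; apply: le_lt_trans.
  rewrite le_eqVlt; apply/orP; left; apply/eqP/eq_integral => p _ /=.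
  by rewrite -EFinM; congr EFin; rewrite [RHS]normrM (ger0_norm (polar_weight_ge0 _)).
transitivity (\int[lebesgue2 R]_p (polar_weight p * (F p.1 * K (d * p.2)))).
  rewrite /Rintegral; congr fine.
  by apply: (Hd (fun p => (F p.1 * K p.2)%:E)); exact/measurable_EFinP.
apply: (etrans (esym (Rintegral_prod1 (m1 := leb) (m2 := leb) iw))).
apply: eq_Rintegral => r _ /=.
rewrite -RintegralZl//.
  apply: eq_Rintegral => z _; rewrite /polar_weight/= ltr_norml.
  by case: ifP => _; ring.
have [rA|rA] := ltP r A.
  apply: (integrable_bounded_interval (M := C * (1 + `|d| * A))).
    by apply: (measurableT_comp mK); exact: measurable_funM.
  by move=> z z1 z2; apply: (Kb r) => //; rewrite ltr_norml z1.
apply: (integrable_bounded_interval (M := C * (1 + `|d| * r))).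
  by apply: (measurableT_comp mK); exact: measurable_funM.
move=> z z1 z2; rewrite (le_trans (KC _))// ler_wpM2l// lerD2l normrM ler_wpM2l//.
by rewrite ltW// ltr_norml z1.
Qed.

End polar_coordinates.

(** * Rapidly decreasing functions *)

Section rapid_decrease.
Context {R : realType}.
Local Notation leb := (@lebesgue_measure R).
Local Notation R3 := (R * R * R)%type.
Local Notation mu := (lebesgue3 R).
Local Notation R' := (measurableTypeR R).
Local Notation kappa := (@disc_area R).

(** A polynomial weight that is at least 1, so its powers increase with the exponent and decay
    estimates need no separate treatment near the origin. *)
Definition bracket (x : R3) : R := 1 + dot3 x x.

Lemma dot3_ge0 (x : R3) : 0 <= dot3 x x.
Proof. by rewrite /dot3 -!expr2 !addr_ge0// sqr_ge0. Qed.

Lemma norm3_ge0 (x : R3) : 0 <= norm3 x. Proof. exact: sqrtr_ge0. Qed.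

Lemma sqr_norm3 (x : R3) : norm3 x ^+ 2 = dot3 x x.
Proof. by rewrite sqr_sqrtr// dot3_ge0. Qed.

Lemma dot3C (x y : R3) : dot3 x y = dot3 y x.
Proof. by rewrite /dot3; ring. Qed.

Lemma dot3Dl (x y z : R3) : dot3 (x + y) z = dot3 x z + dot3 y z.
Proof. by rewrite /dot3/=; ring. Qed.

Lemma dot3Zl (a : R) (x z : R3) : dot3 (a *: x) z = a * dot3 x z.
Proof. by rewrite /dot3/= /GRing.scale/=; ring. Qed.

Lemma bracket_ge1 (x : R3) : 1 <= bracket x.
Proof. by rewrite lerDl dot3_ge0. Qed.

Lemma bracket_gt0 (x : R3) : 0 < bracket x.
Proof. exact: lt_le_trans (bracket_ge1 x). Qed.

Lemma measurable_bracket : measurable_fun setT bracket.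
Proof.
apply: measurable_funD => //; rewrite (_ : (fun x => _) = (fun x : R3 => norm3 x ^+ 2)).
  by apply: measurable_funX; exact: measurable_norm3.
by apply/funext => x; rewrite sqr_norm3.
Qed.

Lemma dot3_bracket (v x : R3) : `|dot3 v x| <= (1 + dot3 v v) * bracket x.
Proof.
rewrite /bracket ler_norml /dot3; apply/andP; split.
  have := sqr_ge0 (v.1.1 + x.1.1); have := sqr_ge0 (v.1.2 + x.1.2).
  have := sqr_ge0 (v.2 + x.2); have := mulr_ge0 (dot3_ge0 v) (dot3_ge0 x).
  have := dot3_ge0 v; have := dot3_ge0 x; rewrite /dot3; nra.
have := sqr_ge0 (v.1.1 - x.1.1); have := sqr_ge0 (v.1.2 - x.1.2).
have := sqr_ge0 (v.2 - x.2); have := mulr_ge0 (dot3_ge0 v) (dot3_ge0 x).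
have := dot3_ge0 v; have := dot3_ge0 x; rewrite /dot3; nra.
Qed.

(** One majorant for two purposes: the summand 1 dominates rapidly decreasing functions, the summand
    1/r their quotients by |x|. *)
Definition radial_weight (r : R') : R := (1 + r^-1) * ((1 + r ^+ 2) ^- 2).

Lemma measurable_radial_weight : measurable_fun setT radial_weight.
Proof.
apply: measurable_funM.
  by apply: measurable_funD => //; exact: measurable_funV.
apply: (@measurable_funV _ _ _ (fun r : R' => (1 + r ^+ 2) ^+ 2)).
by apply: measurable_funX; apply: measurable_funD => //; exact: measurable_funX.
Qed.

Lemma integrable_oneDsqrV :
  leb.-integrable setT (EFin \o (fun r => if 0 < r then (1 + r ^+ 2)^-1 else 0)).
Proof.
have mf : measurable_fun setT (fun r : R' => (1 + r ^+ 2)^-1).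
  by apply: measurable_funV; apply: measurable_funD => //; exact: measurable_funX.
apply/integrableP; split.
  by apply/measurable_EFinP; apply: measurable_fun_indlt.
apply: (@le_lt_trans _ _ (\int[leb]_(r in `[0%R, +oo[) (oneDsqr r)^-1%:E)%E); last first.
  by rewrite integral0y_oneDsqr ltry.
rewrite [leRHS]integral_mkcond; apply: ge0_le_integral => //.
- by apply/measurable_EFinP; apply: measurableT_comp => //; exact: measurable_fun_indlt.
- apply/(measurable_restrictT _ _).1 => //; apply: measurable_funTS.
  exact/measurable_EFinP.
- move=> r _; rewrite /= /patch mem_setE in_itv/= andbT.
  have V0 : 0 <= (1 + r ^+ 2)^-1 by rewrite invr_ge0 addr_ge0// sqr_ge0.
  have [r0|r0] := ltP 0 r; last by rewrite normr0; case: ifP => _; rewrite ?lee_fin.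
  by rewrite (ltW r0) lee_fin ger0_norm.
Qed.

(** In polar form the integral over z contributes 2r, so the radial integrand is 4|D|(r^2 + r)/(1 +
    r^2)^2. This is at most 8|D|/(1 + r^2), whose integral is an arctangent. *)
Lemma integrable_radial_weight :
  mu.-integrable setT (EFin \o (fun x => radial_weight (norm3 x))).
Proof.
have mw := measurable_radial_weight.
have w0 r : 0 <= r -> 0 <= radial_weight r.
  by move=> r0; rewrite mulr_ge0 ?addr_ge0 ?invr_ge0// exprn_ge0// addr_ge0// sqr_ge0.
have mw2 : measurable_fun setT (fun p : R' * R' => `|(radial_weight p.1)%:E|%E).
  apply: (measurableT_comp (f := abse)) => //; apply/measurable_EFinP.
  exact: (measurableT_comp mw).
apply/integrableP; split.
  apply/measurable_EFinP; apply: (measurableT_comp mw); exact: measurable_norm3.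
have [d _ Hd] := integral_polar (0 : R3).
rewrite (Hd (fun p => `|(radial_weight p.1)%:E|%E)); last first.
  exact: mw2.
rewrite ge0_integral_lebesgue2; last 2 first.
- apply: emeasurable_funM; first by apply/measurable_EFinP; exact: measurable_polar_weight.
  exact: mw2.
- by move=> p; rewrite mule_ge0// lee_fin polar_weight_ge0.
pose g := fun r : R => if 0 < r then (1 + r ^+ 2)^-1 else 0.
have mJ : measurable_fun setT (fun r : R' => `|(g r)%:E|%E).
  apply: (measurableT_comp (f := abse)) => //.
  exact: (measurable_int leb integrable_oneDsqrV).
have /integrableP[_] := integrable_oneDsqrV; set J := integral _ _ _ => Joo.
apply: (@le_lt_trans _ _ ((8 * kappa)%:E * J)%E); last first.
  apply: lte_mul_pinfty => //.
  by rewrite lee_fin mulr_ge0// ltW// disc_area_gt0.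
rewrite /J -ge0_integralZl//=; last first.
  by rewrite lee_fin mulr_ge0// ltW// disc_area_gt0.
apply: ge0_le_integral => //.
- by move=> r _; apply: integral_ge0 => z _; rewrite mule_ge0// lee_fin polar_weight_ge0.
- apply: (measurable_fun_fubini_tonelli_F (m2 := leb)
    (fun p => (polar_weight p)%:E * `|(radial_weight p.1)%:E|)%E).
    apply: emeasurable_funM; first by apply/measurable_EFinP; exact: measurable_polar_weight.
    exact: mw2.
  by move=> p; rewrite mule_ge0// lee_fin polar_weight_ge0.
- exact: emeasurable_funM.
move=> r _ /=.
have [r0|r0] := ltP 0 r; last first.
  rewrite integral0_eq ?normr0 ?mule0// => z _.
  by rewrite /polar_weight/= ltNge (le_trans r0)//= mul0e.
have -> : (fun z => (polar_weight (r, z))%:E * (`|radial_weight r|)%:E)%E =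
    (fun z => (2 * kappa * r * radial_weight r)%:E * (\1_`]- r, r[ z)%:E)%E.
  apply/funext => z; rewrite /polar_weight/= indicE mem_setE in_itv/= -ltr_norml.
  rewrite (ger0_norm (w0 _ (ltW r0))) -!EFinM; congr EFin.
  by case: ifP => _; rewrite ?mulr1 ?mulr0 ?mul0r.
have kr0 : 0 <= 2 * kappa * r * radial_weight r.
  apply: mulr_ge0; last exact: w0 (ltW r0).
  by apply: mulr_ge0; [exact: mulr_ge0 (ltW disc_area_gt0)|exact: ltW].
rewrite ge0_integralZl//; last by apply/measurable_EFinP; exact: measurable_indic.
rewrite integral_indic//= setIT lebesgue_measure_itv/= lte_fin ifT; last by lra.
rewrite -EFinB -!EFinM lee_fin ger0_norm ?invr_ge0 ?addr_ge0 ?sqr_ge0//.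
rewrite /radial_weight.
have r1 : 0 < 1 + r ^+ 2 by rewrite ltr_pwDl// sqr_ge0.
rewrite -(@ler_pM2r _ ((1 + r ^+ 2) ^+ 2)) ?exprn_gt0//.
rewrite [leRHS](_ : _ = 8 * kappa * (1 + r ^+ 2)); last by field; rewrite gt_eqF.
rewrite [leLHS](_ : _ = 4 * kappa * (r ^+ 2 + r)); last first.
  by field; rewrite !gt_eqF.
rewrite -subr_ge0 (_ : _ - _ = 4 * kappa * (2 * (1 + r ^+ 2) - (r ^+ 2 + r))); last by ring.
rewrite !mulr_ge0 ?(ltW disc_area_gt0)//; nra.
Qed.

(** Decay without smoothness, so that indicators of balls are included besides Schwartz
    functions. *)
Definition rapid (f : R3 -> R) : Prop :=
  measurable_fun setT f /\ forall k : nat, exists M : R, forall x, bracket x ^+ k * `|f x| <= M.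

Lemma rapid_mul (m f : R3 -> R) (C : R) (j : nat) : measurable_fun setT m ->
  (forall x, `|m x| <= C * bracket x ^+ j) -> rapid f -> rapid (fun x => m x * f x).
Proof.
move=> mm mC [mf rf]; split; first exact: measurable_funM.
move=> k; have [M fM] := rf (k + j)%N; exists (`|C| * M) => x.
rewrite normrM mulrCA mulrC.
have bk : 0 <= bracket x ^+ k by rewrite exprn_ge0// ltW// bracket_gt0.
have bj : 0 <= bracket x ^+ j by rewrite exprn_ge0// ltW// bracket_gt0.
apply: (@le_trans _ _ (`|C| * (bracket x ^+ (k + j) * `|f x|))); last by rewrite ler_wpM2l.
rewrite (_ : `|C| * _ = bracket x ^+ k * `|f x| * (`|C| * bracket x ^+ j)); last first.
  by rewrite exprD; ring.
by rewrite ler_wpM2l ?mulr_ge0// (le_trans (mC x))// ler_wpM2r// ler_norm.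
Qed.

Lemma rapid_bounded_mul (m f : R3 -> R) (C : R) : measurable_fun setT m ->
  (forall x, `|m x| <= C) -> rapid f -> rapid (fun x => m x * f x).
Proof.
by move=> mm mC; apply: (@rapid_mul _ _ C 0) => // x; rewrite expr0 mulr1.
Qed.

Lemma rapid_dot (v : R3) (f : R3 -> R) : rapid f -> rapid (fun x => dot3 v x * f x).
Proof.
apply: (@rapid_mul _ _ (1 + dot3 v v) 1).
  rewrite (_ : dot3 v = fun x => dot3 x v); first exact: measurable_dot3.
  by apply/funext => x; exact: dot3C.
by move=> x; rewrite expr1; exact: dot3_bracket.
Qed.

Lemma rapid_bound (f : R3 -> R) : rapid f ->
  exists M, forall x, `|f x| <= M * (bracket x) ^- 2.
Proof.
move=> [_ /(_ 2%N)[M fM]]; exists M => x.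
by rewrite ler_pdivlMr ?exprn_gt0 ?bracket_gt0// mulrC.
Qed.

Lemma integrable_rapid (f : R3 -> R) : rapid f -> mu.-integrable setT (EFin \o f).
Proof.
move=> rf; have [M fM] := rapid_bound rf.
apply: (@integrable_dominated _ _ _ mu _ (fun x : R3 => `|M| * radial_weight (norm3 x))).
- apply: (@integrableZl _ _ _ mu _ measurableT `|M| (fun x => (radial_weight (norm3 x))%:E)).
  exact: integrable_radial_weight.
- by case: rf.
- move=> x; apply: (le_trans (fM x)).
  have b0 : 0 <= (bracket x ^+ 2)^-1 by rewrite invr_ge0 exprn_ge0// ltW// bracket_gt0.
  apply: ler_pM => //.
    have := fM x; rewrite -ler_pdivrMr; last by rewrite invr_gt0 exprn_gt0// bracket_gt0.
    by apply: le_trans; rewrite divr_ge0.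
    exact: ler_norm.
  by rewrite /radial_weight sqr_norm3 ler_peMl// lerDl invr_ge0 norm3_ge0.
Qed.

Lemma integrable_rapid_over_norm (f : R3 -> R) : rapid f ->
  mu.-integrable setT (EFin \o (fun x => (norm3 x)^-1 * f x)).
Proof.
move=> rf; have [M fM] := rapid_bound rf.
apply: (@integrable_dominated _ _ _ mu _ (fun x : R3 => `|M| * radial_weight (norm3 x))).
- apply: (@integrableZl _ _ _ mu _ measurableT `|M| (fun x => (radial_weight (norm3 x))%:E)).
  exact: integrable_radial_weight.
- apply: measurable_funM; last by case: rf.
  by apply: measurable_funV; exact: measurable_norm3.
- move=> x; rewrite normrM ger0_norm ?invr_ge0 ?norm3_ge0//.
  have b0 : 0 <= (bracket x ^+ 2)^-1 by rewrite invr_ge0 exprn_ge0// ltW// bracket_gt0.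
  have n0 : 0 <= (norm3 x)^-1 by rewrite invr_ge0 norm3_ge0.
  apply: (@le_trans _ _ ((norm3 x)^-1 * (`|M| * (bracket x ^+ 2)^-1))).
    by rewrite ler_wpM2l// (le_trans (fM x))// ler_wpM2r// ler_norm.
  rewrite mulrCA ler_wpM2l// /radial_weight sqr_norm3 ler_wpM2r// lerDr ler01.
  by [].
Qed.

End rapid_decrease.

(** * One-variable calculus *)

Section real_derivatives.
Context {R : realType}.

(** A quadratic remainder is stable under integration in a parameter, so this criterion
    differentiates under the integral with a single estimate. It also serves at the origin, where
    the norm is not differentiable. *)
Lemma is_derive_quadratic (V : normedModType R) (f : V -> R) (x v : V) (D C : R) :
  (forall h : R, `|f (h *: v + x) - f x - h * D| <= C * h ^+ 2) -> is_derive x v f D.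
Proof.
move=> fC.
have C0 : 0 <= C by have := fC 1; rewrite expr1n mulr1; apply: le_trans.
have cD : h^-1 *: ((f \o shift x) (h *: v) - f x) @[h --> 0^'] --> D.
  apply/cvgrPdist_le => e e0; near=> h.
  have h0 : h != 0 by near: h; exact: nbhs_dnbhs_neq.
  rewrite /= distrC -(@ler_pM2l _ `|h|) ?normr_gt0// -normrM.
  rewrite (_ : h * _ = f (h *: v + x) - f x - h * D); last first.
    by rewrite mulrBr /GRing.scale/= mulrA divff// mul1r.
  rewrite (le_trans (fC h))// -real_normK ?num_real// expr2 mulrCA ler_wpM2l//.
  have : `|h| <= e / (C + 1).
    near: h; apply: dnbhs0_le; by rewrite divr_gt0// ltr_pwDr.
  rewrite ler_pdivlMr ?ltr_pwDr// => he.
  by rewrite (le_trans _ he)// mulrC ler_wpM2l// lerDl.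
apply: DeriveDef; last exact: cvg_lim cD.
by apply/cvg_ex; exists D.
Unshelve. all: by end_near. Qed.

Lemma derive_along_line (V : normedModType R) (f : V -> R) (x v : V) (t : R) :
  derivable f (t *: v + x) v ->
  is_derive t (1 : R) (fun s => f (s *: v + x)) ('D_v f (t *: v + x)).
Proof.
move=> df.
have E : (fun h : R => h^-1 *: (((fun s => f (s *: v + x)) \o shift t) (h *: 1) -
      (fun s => f (s *: v + x)) t)) =
    (fun h : R => h^-1 *: ((f \o shift (t *: v + x)) (h *: v) - f (t *: v + x))).
  apply/funext => h; rewrite /shift/= (_ : h *: (1 : R) = h) ?scalerDl ?addrA//.
  exact: mulr1.
by apply: DeriveDef; [rewrite /derivable E|rewrite /derive E].
Qed.

Lemma MVT_abs (f df : R -> R) (b C : R) : (forall t : R, is_derive t (1 : R) f (df t)) ->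
  (forall t, `|t| <= `|b| -> `|df t| <= C) -> `|f b - f 0| <= C * `|b|.
Proof.
move=> fdf dfC.
have cf a c : {within `[a, c], continuous f}.
  apply: continuous_subspaceT => t; apply: differentiable_continuous.
  by apply/derivable1_diffP; exact: ex_derive.
have [b0|b0] := leP 0 b.
  have [c cb ->] := MVT_segment b0 (fun t _ => fdf t) (cf _ _).
  rewrite subr0 normrM ler_wpM2r// dfC//.
  by move: cb; rewrite in_itv/= => /andP[c0 cb]; rewrite !ger0_norm.
have [c cb E] := MVT_segment (ltW b0) (fun t _ => fdf t) (cf _ _).
rewrite distrC E sub0r normrM normrN ler_wpM2r// dfC//.
by move: cb; rewrite in_itv/= => /andP[cb c0]; rewrite !ler0_norm ?lerN2// ltW.
Qed.

Lemma norm_sin_le (b : R) : `|sin b| <= `|b|.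
Proof.
have := @MVT_abs (@sin R) (@cos R) b 1 (fun t => is_derive_sin t) (fun t _ => cos_max t).
by rewrite sin0 subr0 mul1r.
Qed.

Lemma norm_cosB1_le (b : R) : `|cos b - 1| <= b ^+ 2.
Proof.
have := @MVT_abs (@cos R) (fun t => - sin t) b `|b| (fun t => is_derive_cos t).
rewrite cos0 -expr2 real_normK ?num_real//; apply => t tb.
by rewrite normrN (le_trans (norm_sin_le t)).
Qed.

Lemma norm_sinB_le (b : R) : `|sin b - b| <= `|b| ^+ 3.
Proof.
have dE (t : R) : is_derive t (1 : R) (fun t => sin t - t) (cos t - 1).
  exact: is_deriveB.
have := @MVT_abs _ _ b (`|b| ^+ 2) dE.
rewrite sin0 !subr0 -exprSr; apply => t tb.
rewrite (le_trans (norm_cosB1_le t))// -[t ^+ 2]real_normK ?num_real//.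
by rewrite lerXn2r ?nnegrE.
Qed.

(** The derivative is written as a quarter turn of the phase, so that cosines remain cosines. The
    mean value theorem is applied to the remainder, and again to the sine difference that is its
    derivative. *)
Lemma cos_taylor (a b : R) : `|cos (b + a) - cos a - b * cos (a + pi / 2)| <= b ^+ 2.
Proof.
have dE (t : R) : is_derive t (1 : R) (fun t => cos (t + a) + t * sin a) (sin a - sin (t + a)).
  apply: is_derive_eq; rewrite /GRing.scale/=; ring.
have dS (t : R) : is_derive t (1 : R) (fun t => sin (t + a)) (cos (t + a)).
  apply: is_derive_eq; rewrite /GRing.scale/=; ring.
have := @MVT_abs _ _ b `|b| dE.
rewrite -expr2 real_normK ?num_real// cosDpihalf mul0r addr0 add0r.
rewrite (_ : cos (b + a) - cos a - _ = cos (b + a) + b * sin a - cos a); last by ring.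
apply => t tb; rewrite distrC.
have := @MVT_abs _ _ t 1 dS (fun t _ => cos_max _).
by rewrite add0r mul1r => /le_trans; apply.
Qed.

End real_derivatives.

Section caratheodory.
Context {R : realType}.
Local Notation R' := (measurableTypeR R).

(* Approximate in the second variable by step functions. *)
Lemma measurable_separately d (T : measurableType d) (f : T * R' -> R) :
  (forall y, measurable_fun setT (fun x => f (x, y))) ->
  (forall x, continuous (fun y : R => f (x, y))) -> measurable_fun setT f.
Proof.
move=> mf cf.
pose step (n : nat) (y : R) : R := (Num.floor (n.+1%:R * y))%:~R / n.+1%:R.
apply: (@measurable_fun_cvg _ _ _ setT (fun n z => f (z.1, step n z.2))).
  move=> n _ Y mY; rewrite setTI.
  rewrite (_ : _ @^-1` _ = \bigcup_(k in [set: int])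
      (((fun x => f (x, k%:~R / n.+1%:R)) @^-1` Y) `*`
       ((fun y : R => Num.floor (n.+1%:R * y)) @^-1` [set k]))); last first.
    apply/seteqP; split => [[x y] /= fY|[x y] /= [k _ [/= fY kE]]].
      by exists (Num.floor (n.+1%:R * y)).
    by rewrite /step kE.
  apply: countable_bigcupT_measurable => // k; apply: measurableX.
    by rewrite -[X in measurable X]setTI; exact: mf.
  rewrite (_ : _ @^-1` _ = `[k%:~R / n.+1%:R, (k + 1)%:~R / n.+1%:R[%classic)//.
  apply/seteqP; split => y /=; rewrite in_itv/= ler_pdivrMr// ltr_pdivlMr// (mulrC y).
    by move=> <-; rewrite ge_floor lt_succ_floor.
  by move=> h; apply: floor_def.
move=> [x y] _ /=.
apply: (@cvg_comp _ _ _ (step ^~ y) (fun y => f (x, y)) _ (nbhs y) _); last exact: cf.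
apply/cvgrPdist_le => e e0; near=> n.
have n0 : (0 : R) < n.+1%:R by [].
have h1 : step n y <= y by rewrite ler_pdivrMr// mulrC ge_floor.
have h2 : y < step n y + n.+1%:R^-1.
  rewrite /step -[X in _ + X]mul1r -mulrDl ltr_pdivlMr// mulrC.
  by have := lt_succ_floor (n.+1%:R * y); rewrite intrD.
rewrite ger0_norm ?subr_ge0// (@le_trans _ _ n.+1%:R^-1)//; first by rewrite lerBlDl ltW.
rewrite invf_ple ?posrE//.
near: n; exists (Num.trunc e^-1).+1 => // n /= ne.
rewrite ltW// (lt_le_trans (truncnS_gt _))// ler_nat.
exact: leqW.
Unshelve. all: by end_near. Qed.

End caratheodory.

(** * Trigonometric transforms with a phase *)

Section phase_fourier.
Context {R : realType}.
Local Notation leb := (@lebesgue_measure R).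
Local Notation R3 := (R * R * R)%type.
Local Notation mu := (lebesgue3 R).
Local Notation R' := (measurableTypeR R).

Lemma RintegralN d (T : measurableType d) (m : {measure set T -> \bar R}) (f : T -> R) :
  m.-integrable setT (EFin \o f) -> \int[m]_x (- f x) = - \int[m]_x f x.
Proof.
move=> fi; rewrite -mulN1r -RintegralZl//.
by apply: eq_Rintegral => x _; rewrite mulN1r.
Qed.

(* Cosine (theta = 0) and sine (theta = - pi / 2) transforms, treated uniformly:
   differentiation and integration by parts shift the phase by a quarter turn. *)
Definition Fph (theta : R) (chi : R3 -> R) (x : R3) : R :=
  \int[mu]_xi (cos (dot3 x xi + theta) * chi xi).

Lemma measurable_wave (theta : R) : measurable_fun setT (fun z : R3 * R3 => cos (dot3 z.1 z.2 + theta)).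
Proof.
apply: measurable_fun_cos; apply: measurable_funD => //; exact: measurable_dot3_pair.
Qed.

Lemma measurable_wave1 (theta : R) x : measurable_fun setT (fun xi : R3 => cos (dot3 x xi + theta)).
Proof.
apply: measurable_fun_cos; apply: measurable_funD => //.
by rewrite (_ : dot3 x = fun xi => dot3 xi x); [exact: measurable_dot3|
  apply/funext => xi; exact: dot3C].
Qed.

Lemma rapid_wave (theta : R) x chi : rapid chi ->
  rapid (fun xi => cos (dot3 x xi + theta) * chi xi).
Proof.
by apply: (rapid_bounded_mul (C := 1)) => [|xi]; [exact: measurable_wave1|exact: cos_max].
Qed.

Lemma measurable_Fph theta chi : rapid chi -> measurable_fun setT (Fph theta chi).
Proof.
move=> [mc _]; apply: (@measurable_fun_Rintegral _ _ _ _ _ mu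
  (fun z : R3 * R3 => cos (dot3 z.1 z.2 + theta) * chi z.2)).
by apply: measurable_funM; [exact: measurable_wave|exact: (measurableT_comp mc)].
Qed.

Lemma Fph_bounded theta chi x : rapid chi -> `|Fph theta chi x| <= \int[mu]_xi `|chi xi|.
Proof.
move=> rc; apply: le_normr_Rintegral_dominated.
- exact: (integrable_norm (integrable_rapid rc)).
- by case: (rapid_wave theta x rc).
- by move=> xi; rewrite normrM ler_piMl// cos_max.
Qed.

(** By [cos_taylor] the remainder is at most h^2 times the integral of |v.xi|^2 |chi|, finite
    because the decay of [chi] absorbs polynomial factors. Only decay enters, so [chi] may be the
    indicator of a ball. *)
Lemma is_derive_Fph theta chi x v : rapid chi ->
  is_derive x v (Fph theta chi) (Fph (theta + pi / 2) (fun xi => dot3 v xi * chi xi) x).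
Proof.
move=> rc; have rv := rapid_dot v rc; have rvv := rapid_dot v rv.
apply: (@is_derive_quadratic _ _ _ _ _ _ (\int[mu]_xi `|dot3 v xi * (dot3 v xi * chi xi)|)) => h.
have i0 := integrable_rapid (rapid_wave theta x rc).
have i1 := integrable_rapid (rapid_wave theta (h *: v + x) rc).
have i2 := integrable_rapid (rapid_wave (theta + pi / 2) x rv).
have i2h : mu.-integrable setT (EFin \o
    (fun xi => h * (cos (dot3 x xi + (theta + pi / 2)) * (dot3 v xi * chi xi)))).
  exact: (integrableZl measurableT h i2).
have ivv := integrable_norm (integrable_rapid rvv).
have i10 := integrableB measurableT i1 i0.
rewrite /Fph -RintegralZl// -RintegralB// -RintegralB//.
rewrite -RintegralZr//.
apply: le_normr_Rintegral_dominated.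
- exact: (integrableZr measurableT (h ^+ 2) ivv).
- apply: measurable_funB; last exact: integrable_measurable_fun i2h.
  by apply: measurable_funB; [exact: integrable_measurable_fun i1|exact: integrable_measurable_fun i0].
- move=> xi.
  rewrite (_ : _ - _ - _ = (cos (h * dot3 v xi + (dot3 x xi + theta)) - cos (dot3 x xi + theta)
     - h * dot3 v xi * cos (dot3 x xi + theta + pi / 2)) * chi xi); last first.
    rewrite dot3Dl dot3Zl !addrA; ring.
  rewrite normrM (le_trans (ler_wpM2r _ (cos_taylor _ _)))// !normrM.
  by rewrite exprMn -[dot3 v xi ^+ 2]real_normK ?num_real// expr2 le_eqVlt; apply/orP; left; apply/eqP; ring.
Qed.

Lemma is_derive_wave (theta : R) (x xi v : R3) :
  is_derive xi v (fun xi : R3 => cos (dot3 x xi + theta) : R) (dot3 x v * cos (dot3 x xi + theta + pi / 2)).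
Proof.
apply: (@is_derive_quadratic _ _ _ _ _ _ (dot3 x v ^+ 2)) => h.
have := cos_taylor (dot3 x xi + theta) (h * dot3 x v); rewrite exprMn mulrC.
have -> : dot3 x (h *: v + xi) = dot3 x v * h + dot3 x xi.
  by rewrite dot3C dot3Dl dot3Zl mulrC !(dot3C _ x).
by rewrite -!addrA mulrA (mulrC h (dot3 x v)) (mulrC (h ^+ 2)).
Qed.

Lemma preserves_translation3 (i : 'I_3) (h : R) : preserves mu (fun x => h *: basis3 i + x).
Proof.
have p2 : preserves mu (fun x => (x.1, x.2 + h)).
  by apply: (@preserves_shear _ _ _ (lebesgue2 R) (fun=> h)).
have p1 := preserves_comp (preserves_comp (@preserves_snd_swap R) p2) (@preserves_snd_swap R).
have p0 := preserves_comp (preserves_comp (@preserves_fst_swap R) p1) (@preserves_fst_swap R).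
case: i => -[|[|[|//]]] il.
- rewrite (_ : (fun x => _) = (fun x => (x.1.2, x.1.1, x.2)) \o
    ((fun x => (x.1.1, x.2, x.1.2)) \o (fun x => (x.1, x.2 + h)) \o (fun x => (x.1.1, x.2, x.1.2)))
    \o (fun x => (x.1.2, x.1.1, x.2)))//.
  apply/funext => -[[a b] c] /=; rewrite /basis3/=; congr (_, _, _) => /=;
    by rewrite /GRing.scale/= ?mulr1 ?mulr0 ?add0r// addrC.
- rewrite (_ : (fun x => _) =
    (fun x => (x.1.1, x.2, x.1.2)) \o (fun x => (x.1, x.2 + h)) \o (fun x => (x.1.1, x.2, x.1.2)))//.
  apply/funext => -[[a b] c] /=; rewrite /basis3/=; congr (_, _, _) => /=;
    by rewrite /GRing.scale/= ?mulr1 ?mulr0 ?add0r// addrC.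
- rewrite (_ : (fun x => _) = (fun x => (x.1, x.2 + h)))//.
  apply/funext => -[[a b] c] /=; rewrite /basis3/=; congr (_, _, _) => /=;
    by rewrite /GRing.scale/= ?mulr1 ?mulr0 ?add0r// addrC.
Qed.

Lemma measurable_line (i : 'I_3) :
  measurable_fun setT (fun z : R3 * R' => (z.2 : R) *: basis3 i + z.1).
Proof.
rewrite (_ : (fun z => _) = (fun z : R3 * R' => (z.2 * (i == 0 :> nat)%:R + z.1.1.1,
   z.2 * (i == 1 :> nat)%:R + z.1.1.2, z.2 * (i == 2 :> nat)%:R + z.1.2)))//.
have m1 : measurable_fun setT (fun z : R3 * R' => z.1.1.1).
  by apply: (measurableT_comp (f := fun x : R3 => x.1.1)) => //; exact: measurableT_comp.
have m2 : measurable_fun setT (fun z : R3 * R' => z.1.1.2).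
  by apply: (measurableT_comp (f := fun x : R3 => x.1.2)) => //; exact: measurableT_comp.
have m3 : measurable_fun setT (fun z : R3 * R' => z.1.2).
  exact: (measurableT_comp measurable_snd measurable_fst).
apply: measurable_fun_pair; first apply: measurable_fun_pair.
all: by apply: measurable_funD => //; apply: measurable_funM.
Qed.

(* Translation invariance: 0 = int (g (e_i + x) - g x) = int int_0^1 D_i g (s e_i + x). *)
Lemma Rintegral_derive_eq0 (i : 'I_3) (g : R3 -> R) :
  (forall x, derivable g x (basis3 i)) ->
  mu.-integrable setT (EFin \o g) ->
  mu.-integrable setT (EFin \o (fun x => 'D_(basis3 i) g x)) ->
  (forall x, continuous (fun s : R => 'D_(basis3 i) g (s *: basis3 i + x))) ->
  \int[mu]_x ('D_(basis3 i) g x) = 0.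
Proof.
move=> dg ig idg cdg.
set Dg := fun x => 'D_(basis3 i) g x.
have mg := integrable_measurable_fun ig.
have mDg := integrable_measurable_fun idg.
have shift0 : \int[mu]_x (g (1 *: basis3 i + x) - g x) = 0.
  rewrite RintegralB//; last exact: (integrable_preserves (preserves_translation3 i 1) ig).
  by rewrite (Rintegral_preserves (preserves_translation3 i 1) mg) subrr.
have absDg (s : R) : (\int[mu]_x `|(Dg (s *: basis3 i + x))%:E| = \int[mu]_x `|(Dg x)%:E|)%E.
  have mabs : measurable_fun setT (fun x => `|(Dg x)%:E|%E).
    by apply: (measurableT_comp (f := abse)) => //; exact/measurable_EFinP.
  exact: (ge0_integral_preserves (preserves_translation3 i s) mabs (fun x => abse_ge0 _)).
pose k (z : R3 * R') : R := if (0 < (z.2 : R)) && ((z.2 : R) < 1) then Dg ((z.2 : R) *: basis3 i + z.1) else 0.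
have mk : measurable_fun setT k.
  apply: measurable_fun_ifT => //; last exact: (measurableT_comp mDg (measurable_line i)).
  by apply: measurable_and; apply: measurable_fun_ltr.
have ftc x : g (1 *: basis3 i + x) - g x = \int[leb]_s k (x, s).
  rewrite -[X in _ - g X](add0r x) -(scale0r (basis3 i)).
  have dline (s : R) : is_derive s (1 : R) (fun s => g (s *: basis3 i + x))
      (Dg (s *: basis3 i + x)) by exact: derive_along_line.
  by rewrite -(integral_interval_derive ler01 dline (cdg x)).
(* By translation invariance the integral over x is the same for every s in (0, 1), so by Tonelli
   the double integral of |k| is at most the L^1 norm of the derivative. *)
have ik : (mu \x leb)%E.-integrable setT (EFin \o k).
  apply/integrable21ltyP; first exact/measurable_EFinP.
  apply: (@le_lt_trans _ _ (\int[leb]_s ((\1_`]0%R, 1%R[ s)%:E * \int[mu]_x `|Dg x|%:E))%E).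
    apply: ge0_le_integral => //.
    - by move=> s _; apply: integral_ge0 => x _.
    - by apply: (measurable_fun_fubini_tonelli_G (m1 := mu) (fun z => `|(k z)%:E|)%E) => //;
        apply: measurableT_comp => //; exact/measurable_EFinP.
    - by apply: emeasurable_funM => //; apply/measurable_EFinP; exact: measurable_indic.
    - move=> s _; rewrite /k/= indicE mem_setE in_itv/=.
      have [_|_] := boolP ((0 < s) && (s < 1)); last first.
        by rewrite mul0e integral0_eq// => x _; rewrite normr0.
      rewrite mul1e.
      by rewrite -(absDg s).
  rewrite ge0_integralZr//; last 2 first.
  - by apply/measurable_EFinP; exact: measurable_indic.
  - by apply: integral_ge0 => x _; rewrite lee_fin.
  rewrite integral_indic//= setIT lebesgue_measure_itv/= lte_fin ltr01 oppr0 adde0 mul1e.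
  by have /integrableP[] := idg.
rewrite -shift0; under [RHS]eq_Rintegral do rewrite ftc.
rewrite (Rintegral_exchange ik).
transitivity (\int[leb]_s (if (0 < s) && (s < 1) then \int[mu]_x Dg x else 0)).
  have dlin (s : R) : is_derive s (1 : R) (fun s => s * \int[mu]_x Dg x) (\int[mu]_x Dg x).
    by apply: is_derive_eq; rewrite /GRing.scale/=; ring.
  rewrite (integral_interval_derive (f := fun=> \int[mu]_x Dg x) ler01 dlin).
    by rewrite mul1r mul0r subr0.
  exact: cst_continuous.
apply: eq_Rintegral => s _; rewrite /k/=.
have [_|_] := boolP ((0 < s) && (s < 1)); last first.
  by rewrite /Rintegral integral0_eq.
by rewrite (Rintegral_preserves (preserves_translation3 i s) mDg).
Qed.

End phase_fourier.

(** * The symbols of the wave propagators *)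

Section symbols.
Context {R : realType}.
Local Notation leb := (@lebesgue_measure R).
Local Notation R3 := (R * R * R)%type.
Local Notation mu := (lebesgue3 R).
Local Notation R' := (measurableTypeR R).
Local Notation kappa := (@disc_area R).

Lemma norm3_root (d : R) (xi : R3) : d ^+ 2 = dot3 xi xi -> norm3 xi = `|d|.
Proof. by move=> dE; rewrite /norm3 -dE sqrtr_sqr. Qed.

Lemma cos_symbol_root (d t : R) (xi : R3) : d ^+ 2 = dot3 xi xi ->
  cos_symbol t xi = cos (t * d).
Proof.
move=> /norm3_root nE; rewrite /cos_symbol nE.
have [d0|d0] := ger0P d; first by [].
by rewrite mulrN cosN.
Qed.

(** The sine symbol as a function of a square root [d] of |xi|^2. It is even in [d], hence
    insensitive to the sign that the rotation leaves open. *)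
Definition sinc_root (t d : R) : R := if d == 0 then t else sin (t * d) / d.

Lemma sin_symbol_root (d t : R) (xi : R3) : d ^+ 2 = dot3 xi xi ->
  sin_symbol t xi = sinc_root t d.
Proof.
move=> /norm3_root nE; rewrite /sin_symbol /sinc_root nE normr_eq0.
case: eqP => // _; have [d0|d0] := ger0P d; first by [].
by rewrite mulrN sinN invrN mulrNN.
Qed.

Lemma integral_ball_cos (d r : R) :
  \int[leb]_z (if (- r < z) && (z < r) then cos (d * z) else 0) =
  if 0 < r then 2 * sinc_root r d else 0.
Proof.
have cc : continuous (fun z : R => cos (d * z)).
  move=> z; apply: (@continuous_comp _ _ _ (fun z => d * z) (@cos R)).
    exact: mulrl_continuous.
  exact: continuous_cos.
case: ifPn => r0; last first.
  rewrite /Rintegral integral0_eq// => z _; case: ifPn => // /andP[zr rz].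
  by exfalso; move: r0; apply/negP; rewrite negbK; lra.
have rr : - r <= r by lra.
rewrite /sinc_root; have [->|d0] := eqVneq d 0.
  have dz (z : R) : is_derive z (1 : R) (fun z => z) (cos (0 * z)).
    by rewrite mul0r cos0; exact: is_derive_id.
  rewrite (integral_interval_derive rr dz); first by ring.
  by under eq_fun do rewrite mul0r; exact: cst_continuous.
have dz (z : R) : is_derive z (1 : R) (fun z => d^-1 * sin (d * z)) (cos (d * z)).
  by apply: is_derive_eq; rewrite /GRing.scale/=; field.
by rewrite (integral_interval_derive rr dz)// mulrN sinN [d * r]mulrC; field.
Qed.

(* The kernel K(s) = (s cos s)' *)
Lemma integral_ball_kernel (d r : R) :
  \int[leb]_z (if (- r < z) && (z < r) then cos (d * z) - d * z * sin (d * z) else 0) =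
  if 0 < r then 2 * r * cos (r * d) else 0.
Proof.
have cc : continuous (fun z : R => cos (d * z) - d * z * sin (d * z)).
  have cd : continuous (fun z : R => d * z) by exact: mulrl_continuous.
  move=> z; apply: cvgB.
    apply: (@continuous_comp _ _ _ (fun z => d * z) (@cos R)); first exact: cd.
    exact: continuous_cos.
  apply: cvgM; first exact: cd.
  apply: (@continuous_comp _ _ _ (fun z => d * z) (@sin R)); first exact: cd.
  exact: continuous_sin.
case: ifPn => r0; last first.
  rewrite /Rintegral integral0_eq// => z _; case: ifPn => // /andP[zr rz].
  by exfalso; move: r0; apply/negP; rewrite negbK; lra.
have rr : - r <= r by lra.
have dz (z : R) : is_derive z (1 : R) (fun z => z * cos (d * z))
    (cos (d * z) - d * z * sin (d * z)).
  by apply: is_derive_eq; rewrite /GRing.scale/=; ring.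
by rewrite (integral_interval_derive rr dz)// mulrN cosN [d * r]mulrC; ring.
Qed.

Definition ball_ind (t : R) (x : R3) : R := if norm3 x < t then 1 else 0.

Lemma rapid_ball_ind t : rapid (ball_ind t).
Proof.
split; first by apply: measurable_fun_indlt => //; exact: measurable_norm3.
move=> k; exists ((1 + t ^+ 2) ^+ k) => x; rewrite /ball_ind.
case: ifPn => xt; last by rewrite normr0 mulr0 exprn_ge0// addr_ge0// sqr_ge0.
rewrite normr1 mulr1 lerXn2r ?nnegrE ?addr_ge0 ?sqr_ge0 ?dot3_ge0// /bracket lerD2l.
rewrite -sqr_norm3 lerXn2r ?nnegrE ?norm3_ge0 ?ltW//.
exact: le_lt_trans (norm3_ge0 _) xt.
Qed.

(** The right-hand side is -4|D|/d times the derivative in d of sin(td)/d. This is what identifies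
    the gradient of the sine symbol with a Fourier integral. *)
Lemma Fph_ball_ind (t d : R) (xi : R3) : 0 <= t -> d ^+ 2 = dot3 xi xi -> d != 0 ->
  Fph 0 (ball_ind t) xi = 4 * kappa * (sin (t * d) - t * d * cos (t * d)) / d ^+ 3.
Proof.
move=> t0 dE d0.
have [d' d'E H] := Rintegral_radial xi.
have : d' = d \/ d' = - d.
  have : (d' == d) || (d' == - d) by rewrite -eqf_sqr d'E dE.
  by move=> /orP[] /eqP; [left|right].
suff : d' != 0 -> Fph 0 (ball_ind t) xi =
    4 * kappa * (sin (t * d') - t * d' * cos (t * d')) / d' ^+ 3.
  move=> h [dd|dd]; first by rewrite h dd.
  rewrite h dd ?oppr_eq0// !mulrN cosN sinN; field.
  by rewrite d0.
move=> {d dE d0} d0.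
pose F : R' -> R := fun r => if r < t then 1 else 0.
have [] := H F (@cos R) t t 1.
- exact: measurable_fun_indlt.
- exact: measurable_fun_cos.
- by move=> r tr; rewrite /F ltNge tr.
- move=> r r0; rewrite /F; case: ifPn => rt; last by rewrite normr0 mulr0.
  by rewrite normr1 mulr1 ltW.
- by move=> s; rewrite mul1r (le_trans (cos_max _))// lerDl.
move=> _ E.
transitivity (\int[mu]_x (F (norm3 x) * cos (dot3 x xi))).
  by apply: eq_Rintegral => x _; rewrite addr0 mulrC dot3C.
rewrite {}E.
transitivity (\int[leb]_r (if (0 < r) && (r < t) then 4 * kappa * (r * sin (r * d') / d') else 0)).
  apply: eq_Rintegral => r _; rewrite integral_ball_cos /F /sinc_root (negbTE d0).
  have [_|_] := boolP (0 < (r : R)); last by rewrite mulr0.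
  by case: ifP => _ /=; ring.
have dz (r : R) : is_derive r (1 : R)
    (fun r => 4 * kappa * ((d' ^- 3) * sin (r * d') - d' ^- 2 * (r * cos (r * d'))))
    (4 * kappa * (r * sin (r * d') / d')).
  by apply: is_derive_eq; rewrite /GRing.scale/=; field.
have cs : continuous (fun r : R => sin (r * d')).
  rewrite (_ : (fun r : R => _) = (fun r : R => sin (d' * r))); last first.
    by apply/funext => r; rewrite mulrC.
  move=> r; apply: (@continuous_comp _ _ _ (fun r : R => d' * r) (@sin R)).
    exact: mulrl_continuous.
  exact: continuous_sin.
rewrite (integral_interval_derive t0 dz); first by rewrite !mul0r sin0; field.
move=> r; apply: cvgM; first exact: cvg_cst.
apply: cvgM; last exact: cvg_cst.
apply: cvgM; first exact: cvg_id.
exact: cs.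
Qed.

Lemma is_derive_from_line (V : normedModType R) (f : V -> R) (x v : V) (D : R) :
  is_derive (0 : R) (1 : R) (fun s : R => f (s *: v + x)) D -> is_derive x v f D.
Proof.
have E : (fun h : R => h^-1 *: (((fun s => f (s *: v + x)) \o shift 0) (h *: 1) -
      (fun s => f (s *: v + x)) 0)) =
    (fun h : R => h^-1 *: ((f \o shift x) (h *: v) - f x)).
  apply/funext => h; rewrite /shift/= (_ : h *: (1 : R) = h) ?addr0 ?scale0r ?add0r//.
  exact: mulr1.
by move=> [dl dv]; apply: DeriveDef; [rewrite /derivable -E|rewrite /derive -E].
Qed.

Lemma is_derive_norm3 (xi v : R3) : norm3 xi != 0 ->
  is_derive (0 : R) (1 : R) (fun s : R => norm3 (s *: v + xi)) (dot3 xi v / norm3 xi).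
Proof.
move=> n0; have n1 : 0 < norm3 xi by rewrite lt_neqAle eq_sym n0 norm3_ge0.
pose q (s : R) := s ^+ 2 * dot3 v v + 2 * s * dot3 xi v + dot3 xi xi.
have -> : (fun s : R => norm3 (s *: v + xi)) = Num.sqrt \o q.
  by apply/funext => s; rewrite /= /norm3 /q; congr Num.sqrt; rewrite /dot3/= /GRing.scale/=; ring.
have q0 : 0 < q 0.
  by rewrite /q expr0n/= !mul0r mulr0 mul0r !add0r -sqr_norm3 exprn_gt0.
have dq : is_derive (0 : R) (1 : R) q (2 * dot3 xi v).
  by rewrite /q; apply: is_derive_eq; rewrite /GRing.scale/=; ring.
have ds := is_derive1_sqrt q0.
apply: (is_derive_eq (is_derive1_comp ds dq)); rewrite /GRing.scale/=.
rewrite (_ : Num.sqrt (q 0) = norm3 xi); first by field.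
by rewrite /q expr0n/= !mul0r mulr0 mul0r !add0r.
Qed.

Lemma dot3_basis_sqr (i : 'I_3) : dot3 (basis3 i) (basis3 i) = 1 :> R.
Proof. by case: i => -[|[|[|k]]] il //; rewrite /dot3/basis3/=; ring. Qed.

Lemma norm3_eq0 (xi : R3) : norm3 xi = 0 -> xi = 0.
Proof.
move=> n0; have : dot3 xi xi = 0 by rewrite -sqr_norm3 n0 expr0n.
case: xi n0 => -[a b] c _; rewrite /dot3/= -!expr2 => /eqP.
rewrite paddr_eq0 ?addr_ge0 ?sqr_ge0// paddr_eq0 ?sqr_ge0// !sqrf_eq0.
by move=> /andP[/andP[/eqP -> /eqP ->] /eqP ->].
Qed.

Lemma norm3Z_basis (i : 'I_3) (h : R) : norm3 (h *: basis3 i + 0) = `|h|.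
Proof.
by rewrite addr0; apply: norm3_root; rewrite dot3Zl dot3C dot3Zl dot3_basis_sqr; ring.
Qed.

(** Away from the origin this is the chain rule. At the origin cos(t|h|) - 1 is quadratically small,
    so the derivative is 0, in agreement with the factor that is linear in [xi]. *)
Lemma is_derive_cos_symbol (t : R) (xi : R3) (i : 'I_3) :
  is_derive xi (basis3 i) (cos_symbol t) (- t * (dot3 (basis3 i) xi * sin_symbol t xi)).
Proof.
have [n0|n0] := eqVneq (norm3 xi) 0.
  rewrite (norm3_eq0 n0).
  apply: (@is_derive_quadratic _ _ _ _ _ _ (t ^+ 2)) => h.
  rewrite /cos_symbol norm3Z_basis.
  have -> : norm3 (0 : R3) = 0 by rewrite -n0 (norm3_eq0 n0).
  rewrite mulr0 cos0 (_ : dot3 (basis3 i) 0 = 0); last by rewrite /dot3/=; ring.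
  rewrite mul0r !mulr0 subr0 (le_trans (norm_cosB1_le _))// exprMn.
  by rewrite real_normK ?num_real.
apply: is_derive_from_line.
have dn := is_derive_norm3 (basis3 i) n0.
rewrite /cos_symbol.
have dc := is_derive_cos (t * norm3 (0 *: basis3 i + xi)).
apply: is_derive_eq; rewrite scale0r add0r /GRing.scale/=.
by rewrite /sin_symbol (negbTE n0) dot3C; ring.
Qed.

(** Written as a Fourier integral over the ball of radius t, the derivative has no singular quotient
    at the origin, and [is_derive_Fph] can differentiate it again without end. *)
Lemma is_derive_sin_symbol (t : R) (xi : R3) (i : 'I_3) : 0 <= t ->
  is_derive xi (basis3 i) (sin_symbol t)
    (- (4 * kappa)^-1 * (dot3 (basis3 i) xi * Fph 0 (ball_ind t) xi)).
Proof.
move=> t0.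
have [n0|n0] := eqVneq (norm3 xi) 0.
  rewrite (norm3_eq0 n0).
  apply: (@is_derive_quadratic _ _ _ _ _ _ (t ^+ 3)) => h.
  have n00 : norm3 (0 : R3) = 0 by rewrite -n0 (norm3_eq0 n0).
  rewrite /sin_symbol norm3Z_basis n00 eqxx normr_eq0.
  rewrite (_ : dot3 (basis3 i) 0 = 0); last by rewrite /dot3/=; ring.
  rewrite mul0r !mulr0 subr0; case: eqP => [->|/eqP h0].
    by rewrite subrr normr0 expr0n mulr0.
  rewrite -(@ler_pM2r _ `|h|) ?normr_gt0// -[X in `|_| * X]normr_id -normrM.
  rewrite mulrBl divfK ?normr_eq0// (le_trans (norm_sinB_le _))//.
  rewrite normrM normr_id (ger0_norm t0) -[h ^+ 2](@real_normK _ h) ?num_real//.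
  by rewrite le_eqVlt; apply/orP; left; apply/eqP; ring.
have nl : 0 < norm3 xi by rewrite lt_neqAle eq_sym n0 norm3_ge0.
apply: is_derive_from_line.
have dn := is_derive_norm3 (basis3 i) n0.
(* Near a nonzero frequency the case distinction in [sin_symbol] is inactive, so the explicit
   quotient may be differentiated instead. *)
have E : \forall s \near (0 : R), sin (t * norm3 (s *: basis3 i + xi)) / norm3 (s *: basis3 i + xi)
    = sin_symbol t (s *: basis3 i + xi).
  have : {for 0, continuous (fun s : R => norm3 (s *: basis3 i + xi))}.
    by apply: differentiable_continuous; apply/derivable1_diffP; exact: ex_derive.
  move=> /cvgr_neq0; rewrite scale0r add0r => /(_ n0); apply: filterS => s sn.
  by rewrite /sin_symbol (negbTE sn).
apply: (near_eq_is_derive E).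
have nz : norm3 (0 *: basis3 i + xi) != 0 by rewrite scale0r add0r.
have dV : is_derive (0 : R) (1 : R) (fun s : R => (norm3 (s *: basis3 i + xi))^-1)
    (- (norm3 xi) ^- 2 *: (dot3 xi (basis3 i) / norm3 xi)).
  by have := @is_deriveV _ (fun s : R => norm3 (s *: basis3 i + xi)) _ _ _ nz dn; rewrite scale0r add0r.
apply: is_derive_eq; rewrite scale0r add0r /GRing.scale/=.
rewrite (@Fph_ball_ind t (norm3 xi) xi t0 (sqr_norm3 xi) n0) (dot3C xi); field.
by rewrite n0 gt_eqF ?disc_area_gt0.
Qed.

End symbols.

(** * Schwartz functions *)

Section schwartz_class.
Context {R : realType}.
Local Notation leb := (@lebesgue_measure R).
Local Notation R3 := (R * R * R)%type.
Local Notation mu := (lebesgue3 R).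
Local Notation R' := (measurableTypeR R).
Local Notation kappa := (@disc_area R).

(** A coinduction principle: being Schwartz is the largest property that gives partial derivatives
    and decay and passes to the partial derivatives. It suffices to exhibit an invariant class [P],
    with no explicit formula for iterated derivatives. *)
Lemma schwartz_coind (P : (R3 -> R) -> Prop) (f : R3 -> R) :
  (forall g, P g ->
    [/\ forall (i : 'I_3) (x : R3), derivable g x (basis3 i),
        forall k : nat, exists M : R, forall x, bracket x ^+ k * `|g x| <= M &
        forall i : 'I_3, P (fun x => 'D_(basis3 i) g x)]) ->
  P f -> schwartz f.
Proof.
move=> HP Pf s; have : P (pderiv3 s f).
  by elim: s => [//|i s IH] /=; have [_ _] := HP _ IH; exact.
move=> /HP[dg rg _]; split=> // k; have [M gM] := rg k; exists M => x.
rewrite (le_trans _ (gM x))// ler_wpM2r// lerXn2r ?nnegrE ?norm3_ge0 ?(ltW (bracket_gt0 _))//.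
rewrite /bracket -sqr_norm3; have := norm3_ge0 x; have := sqr_ge0 (norm3 x - 1); nra.
Qed.

Lemma schwartz_derive (i : 'I_3) (f : R3 -> R) :
  schwartz f -> schwartz (fun x => 'D_(basis3 i) f x).
Proof.
move=> sf s; have -> : pderiv3 s (fun x => 'D_(basis3 i) f x) = pderiv3 (s ++ [:: i]) f.
  by elim: s => //= j s ->.
exact: sf.
Qed.

Lemma schwartz_derivable (i : 'I_3) (f : R3 -> R) x :
  schwartz f -> derivable f x (basis3 i).
Proof. by move=> /(_ [::])[]. Qed.

Lemma schwartz_line_continuous (i : 'I_3) (f : R3 -> R) x :
  schwartz f -> continuous (fun s : R => f (s *: basis3 i + x)).
Proof.
move=> sf s; apply: differentiable_continuous; apply/derivable1_diffP.
have := derive_along_line (@schwartz_derivable i f (s *: basis3 i + x) sf).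
by move=> ?; exact: ex_derive.
Qed.

(** The definition provides derivatives along the axes only, hence continuity in each variable
    separately. Measurability follows by applying [measurable_separately] to one coordinate at a
    time. *)
Lemma schwartz_measurable (f : R3 -> R) : schwartz f -> measurable_fun setT f.
Proof.
move=> sf.
have c0 y z : continuous (fun s : R => f (s, y, z)).
  rewrite (_ : (fun s : R => _) = (fun s : R => f (s *: basis3 (@Ordinal 3 0 isT) + (0, y, z)))).
    exact: schwartz_line_continuous.
  apply/funext => s; congr f; congr (_, _, _);
    by rewrite /= /GRing.scale/= ?mulr1 ?mulr0 ?addr0 ?add0r.
have c1 y z : continuous (fun s : R => f (y, s, z)).
  rewrite (_ : (fun s : R => _) = (fun s : R => f (s *: basis3 (@Ordinal 3 1 isT) + (y, 0, z)))).
    exact: schwartz_line_continuous.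
  apply/funext => s; congr f; congr (_, _, _);
    by rewrite /= /GRing.scale/= ?mulr1 ?mulr0 ?addr0 ?add0r.
have c2 y z : continuous (fun s : R => f (y, z, s)).
  rewrite (_ : (fun s : R => _) = (fun s : R => f (s *: basis3 (@Ordinal 3 2 isT) + (y, z, 0)))).
    exact: schwartz_line_continuous.
  apply/funext => s; congr f; congr (_, _, _);
    by rewrite /= /GRing.scale/= ?mulr1 ?mulr0 ?addr0 ?add0r.
apply: measurable_separately; last by move=> [a b]; exact: c2.
move=> z; apply: (@measurable_separately _ _ _ (fun p => f (p, z))) => [b|a]; last exact: c1.
exact: continuous_measurable_fun (c0 b z).
Qed.

Lemma schwartz_rapid (f : R3 -> R) : schwartz f -> rapid f.
Proof.
move=> sf; split; first exact: schwartz_measurable.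
move=> k; have [_ /(_ 0%N)[M0 f0]] := sf [::]; have [_ /(_ (2 * k)%N)[M1 f1]] := sf [::].
(* With q = |x|^2, (1 + q)^k is at most 2^k (1 + q^k), as seen by separating q <= 1 from q > 1. *)
exists (2 ^+ k * (M0 + M1)) => x.
have {}f0 := f0 x; have {}f1 := f1 x; rewrite /= expr0 mul1r in f0; rewrite /= in f1.
apply: (@le_trans _ _ (2 ^+ k * (`|f x| + norm3 x ^+ (2 * k) * `|f x|))); last first.
  by rewrite ler_wpM2l ?exprn_ge0// lerD.
rewrite exprM -{2}[`|f x|]mul1r -mulrDl mulrA ler_wpM2r//.
have n0 := sqr_ge0 (norm3 x); rewrite /bracket -sqr_norm3.
move: n0; set q := norm3 x ^+ 2 => n0.
have [n1|n1] := leP q 1.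
  apply: (@le_trans _ _ (2 ^+ k)).
    by rewrite lerXn2r ?nnegrE ?addr_ge0//; lra.
  by rewrite ler_peMr ?exprn_ge0// lerDl exprn_ge0.
apply: (@le_trans _ _ (2 ^+ k * q ^+ k)).
  rewrite -exprMn; apply: lerXn2r; rewrite ?nnegrE; lra.
by rewrite ler_wpM2l ?exprn_ge0// lerDr.
Qed.

Lemma sum_basis_sqr (x : R3) :
  dot3 x x = dot3 (basis3 (@Ordinal 3 0 isT)) x ^+ 2 + dot3 (basis3 (@Ordinal 3 1 isT)) x ^+ 2
    + dot3 (basis3 (@Ordinal 3 2 isT)) x ^+ 2.
Proof. by rewrite /dot3/basis3/=; ring. Qed.

(* Integration by parts *)
Lemma Fph_derive (theta : R) (i : 'I_3) (chi : R3 -> R) (x : R3) : schwartz chi ->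
  dot3 (basis3 i) x * Fph theta chi x =
  Fph (theta + pi / 2) (fun xi => 'D_(basis3 i) chi xi) x.
Proof.
move=> sc.
have rc := schwartz_rapid sc; have sd := schwartz_derive i sc; have rd := schwartz_rapid sd.
(* The phase is turned back by a quarter, so that differentiating the wave restores the phase
   [theta] of the left-hand side. *)
pose g xi := cos (dot3 x xi + (theta - pi / 2)) * chi xi.
have dg xi : is_derive xi (basis3 i) g (dot3 (basis3 i) x * (cos (dot3 x xi + theta) * chi xi)
    - cos (dot3 x xi + (theta + pi / 2)) * 'D_(basis3 i) chi xi).
  have dw := is_derive_wave (theta - pi / 2) x xi (basis3 i).
  have dc : is_derive xi (basis3 i) chi ('D_(basis3 i) chi xi).
    by apply: DeriveDef => //; exact: schwartz_derivable.
  apply: (is_derive_eq (is_deriveM dw dc)); rewrite /GRing.scale/= !addrA subrK.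
  by rewrite cosBpihalf cosDpihalf (dot3C x (basis3 i)); ring.
have Dg xi : 'D_(basis3 i) g xi = dot3 (basis3 i) x * (cos (dot3 x xi + theta) * chi xi)
    - cos (dot3 x xi + (theta + pi / 2)) * 'D_(basis3 i) chi xi.
  by have := dg xi; move=> ?; exact: derive_val.
have i1 := integrable_rapid (rapid_wave theta x rc).
have i1' := integrableZl measurableT (dot3 (basis3 i) x) i1.
have i2 := integrable_rapid (rapid_wave (theta + pi / 2) x rd).
have iD : mu.-integrable setT (EFin \o (fun xi => 'D_(basis3 i) g xi)).
  have := integrableB measurableT i1' i2.
  by congr (_.-integrable _ _); apply/funext => xi /=; rewrite Dg.
have := @Rintegral_derive_eq0 _ i g (fun xi => @ex_derive _ _ _ _ _ _ _ (dg xi))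
  (integrable_rapid (rapid_wave _ x rc)) iD.
have -> : \int[mu]_xi 'D_(basis3 i) g xi = dot3 (basis3 i) x * Fph theta chi x -
    Fph (theta + pi / 2) (fun xi => 'D_(basis3 i) chi xi) x.
  rewrite /Fph -RintegralZl// -RintegralB//.
  by apply: eq_Rintegral => xi _; exact: Dg.
move=> H; apply/eqP; rewrite -subr_eq0; apply/eqP; apply: H => y.
have cw theta' : continuous (fun s : R => cos (dot3 x (s *: basis3 i + y) + theta')).
  move=> s; apply: differentiable_continuous; apply/derivable1_diffP.
  have dd : derivable (fun xi => cos (dot3 x xi + theta')) (s *: basis3 i + y) (basis3 i).
    by have := is_derive_wave theta' x (s *: basis3 i + y) (basis3 i); move=> ?; exact: ex_derive.
  by have := derive_along_line dd; move=> ?; exact: ex_derive.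
rewrite (_ : (fun s : R => _) = (fun s : R => dot3 (basis3 i) x *
   (cos (dot3 x (s *: basis3 i + y) + theta) * chi (s *: basis3 i + y))
    - cos (dot3 x (s *: basis3 i + y) + (theta + pi / 2)) * 'D_(basis3 i) chi (s *: basis3 i + y))); last first.
  by apply/funext => s; exact: Dg.
move=> s; apply: cvgB.
  apply: cvgM; first exact: cvg_cst.
  by apply: cvgM; [exact: cw|exact: schwartz_line_continuous].
by apply: cvgM; [exact: cw|exact: (schwartz_line_continuous (f := fun z => 'D_(basis3 i) chi z))].
Qed.

(** One more power of [bracket] is 1 plus the sum of the squared coordinates, and each squared
    coordinate becomes a second derivative of [chi] after two integrations by parts. The induction
    therefore quantifies over all phases and all Schwartz functions. *)
Lemma Fph_rapid_decay (k : nat) : forall (theta : R) (chi : R3 -> R), schwartz chi ->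
  exists M : R, forall x, bracket x ^+ k * `|Fph theta chi x| <= M.
Proof.
elim: k => [|k IH] theta chi sc.
  exists (\int[mu]_xi `|chi xi|) => x; rewrite expr0 mul1r.
  exact/Fph_bounded/schwartz_rapid.
have [M0 H0] := IH theta chi sc.
have H i := IH (theta + pi / 2 + pi / 2) _ (schwartz_derive i (schwartz_derive i sc)).
have [M1 H1] := H (@Ordinal 3 0 isT); have [M2 H2] := H (@Ordinal 3 1 isT).
have [M3 H3] := H (@Ordinal 3 2 isT).
exists (M0 + M1 + M2 + M3) => x.
have {}H0 := H0 x; have {}H1 := H1 x; have {}H2 := H2 x; have {}H3 := H3 x.
have D (i : 'I_3) : dot3 (basis3 i) x ^+ 2 * Fph theta chi x =
    Fph (theta + pi / 2 + pi / 2) (fun xi => 'D_(basis3 i) (fun xi => 'D_(basis3 i) chi xi) xi) x.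
  by rewrite -Fph_derive; [rewrite -Fph_derive// expr2 mulrA|exact: schwartz_derive].
rewrite -D in H1; rewrite -D in H2; rewrite -D in H3.
rewrite exprSr -mulrA {2}/bracket sum_basis_sqr mulrDl mul1r 2!mulrDl.
rewrite !mulrDr !addrA; apply: lerD; first apply: lerD; first apply: lerD => //.
- by move: H1; rewrite normrM (ger0_norm (sqr_ge0 _)).
- by move: H2; rewrite normrM (ger0_norm (sqr_ge0 _)).
- by move: H3; rewrite normrM (ger0_norm (sqr_ge0 _)).
Qed.

(** A class containing the wave symbols and closed under partial derivatives: the cosine symbol
    leads to the sine symbol, the latter to the transform of a ball indicator, and this to further
    transforms of rapidly decreasing functions. *)
Inductive multiplier : (R3 -> R) -> Prop :=
| multiplier_const c : multiplier (fun=> c)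
| multiplier_dot v : multiplier (dot3 v)
| multiplier_cos t : 0 <= t -> multiplier (cos_symbol t)
| multiplier_sin t : 0 <= t -> multiplier (sin_symbol t)
| multiplier_Fph theta a : rapid a -> multiplier (Fph theta a)
| multiplier_mul m1 m2 : multiplier m1 -> multiplier m2 -> multiplier (fun x => m1 x * m2 x)
| multiplier_add m1 m2 : multiplier m1 -> multiplier m2 -> multiplier (fun x => m1 x + m2 x).

Lemma measurable_cos_symbol (t : R) : measurable_fun setT (@cos_symbol R t).
Proof. by apply: measurable_fun_cos; apply: measurable_funM => //; exact: measurable_norm3. Qed.

Lemma measurable_sin_symbol (t : R) : measurable_fun setT (@sin_symbol R t).
Proof.
have mn := @measurable_norm3 R; apply: measurable_fun_ifT => //.
  exact: measurable_fun_eqr.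
apply: measurable_funM; last exact: measurable_funV.
by apply: measurable_fun_sin; apply: measurable_funM.
Qed.

Lemma sin_symbol_bounded (t : R) (xi : R3) : `|sin_symbol t xi| <= `|t|.
Proof.
rewrite /sin_symbol; case: eqP => // /eqP n0.
rewrite normrM normfV ler_pdivrMr ?normr_gt0// -normrM; exact: norm_sin_le.
Qed.

Lemma multiplier_measurable m : multiplier m -> measurable_fun setT m.
Proof.
elim=> [c|v|t _|t _|theta a ra|m1 m2 _ h1 _ h2|m1 m2 _ h1 _ h2].
- exact: measurable_cst.
- rewrite (_ : dot3 v = fun x => dot3 x v); first exact: measurable_dot3.
  by apply/funext => x; exact: dot3C.
- exact: measurable_cos_symbol.
- exact: measurable_sin_symbol.
- exact: measurable_Fph.
- exact: measurable_funM.
- exact: measurable_funD.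
Qed.

Lemma multiplier_growth m : multiplier m ->
  exists (C : R) (j : nat), forall x, `|m x| <= C * bracket x ^+ j.
Proof.
have bge0 x : 0 <= bracket x :> R by exact/ltW/bracket_gt0.
elim=> [c|v|t _|t _|theta a ra|m1 m2 _ [C1 [j1 h1]] _ [C2 [j2 h2]]|
  m1 m2 _ [C1 [j1 h1]] _ [C2 [j2 h2]]].
- by exists `|c|, 0%N => x; rewrite expr0 mulr1.
- by exists (1 + dot3 v v), 1%N => x; rewrite expr1; exact: dot3_bracket.
- by exists 1, 0%N => x; rewrite expr0 mulr1; exact: cos_max.
- by exists `|t|, 0%N => x; rewrite expr0 mulr1; exact: sin_symbol_bounded.
- exists (\int[mu]_xi `|a xi|), 0%N => x; rewrite expr0 mulr1; exact: Fph_bounded.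
- exists (C1 * C2), (j1 + j2)%N => x; rewrite normrM exprD mulrACA ler_pM//.
- exists (`|C1| + `|C2|), (j1 + j2)%N => x.
  rewrite (le_trans (ler_normD _ _))// mulrDl lerD//.
    rewrite (le_trans (h1 x))// ler_pM ?exprn_ge0 ?ler_norm//.
    + by have := h1 x; rewrite -ler_pdivrMr ?exprn_gt0 ?bracket_gt0//; apply: le_trans; rewrite divr_ge0// exprn_ge0.
    + by rewrite exprD ler_peMr ?exprn_ge0// exprn_ege1// bracket_ge1.
  rewrite (le_trans (h2 x))// ler_pM ?exprn_ge0 ?ler_norm//.
  + by have := h2 x; rewrite -ler_pdivrMr ?exprn_gt0 ?bracket_gt0//; apply: le_trans; rewrite divr_ge0// exprn_ge0.
  + by rewrite exprD ler_peMl ?exprn_ge0// exprn_ege1// bracket_ge1.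
Qed.

Lemma multiplier_derive (i : 'I_3) m : multiplier m ->
  exists2 m', multiplier m' & forall x, is_derive x (basis3 i) m (m' x).
Proof.
elim=> [c|v|t t0|t t0|theta a ra|m1 m2 M1 [m1' M1' d1] M2 [m2' M2' d2]|
  m1 m2 _ [m1' M1' d1] _ [m2' M2' d2]].
- exists (fun=> 0); first exact: multiplier_const.
  by move=> x; exact: is_derive_cst.
- exists (fun=> dot3 v (basis3 i)); first exact: multiplier_const.
  move=> x; apply: (@is_derive_quadratic _ _ _ _ _ _ 0) => h.
  by rewrite mul0r dot3C dot3Dl dot3Zl !(dot3C _ v) addrK subrr normr0.
- exists (fun x => - t * (dot3 (basis3 i) x * sin_symbol t x)).
    apply: multiplier_mul; first exact: multiplier_const.
    by apply: multiplier_mul; [exact: multiplier_dot|exact: multiplier_sin].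
  by move=> x; exact: is_derive_cos_symbol.
- exists (fun x => - (4 * kappa)^-1 * (dot3 (basis3 i) x * Fph 0 (ball_ind t) x)).
    apply: multiplier_mul; first exact: multiplier_const.
    apply: multiplier_mul; [exact: multiplier_dot|apply: multiplier_Fph].
    exact: rapid_ball_ind.
  by move=> x; exact: is_derive_sin_symbol.
- exists (Fph (theta + pi / 2) (fun xi => dot3 (basis3 i) xi * a xi)).
    by apply: multiplier_Fph; exact: rapid_dot.
  by move=> x; exact: is_derive_Fph.
- exists (fun x => m1 x * m2' x + m2 x * m1' x).
    by apply: multiplier_add; exact: multiplier_mul.
  by move=> x; exact: is_deriveM.
- exists (fun x => m1' x + m2' x); first exact: multiplier_add.
  by move=> x; exact: is_deriveD.
Qed.

(** Products of a multiplier and a Schwartz function are not visibly closed under differentiation,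
    but their finite sums are, by the product rule. This is the invariant class for
    [schwartz_coind]. *)
Inductive schwartz_span : (R3 -> R) -> Prop :=
| schwartz_span_mul m psi : multiplier m -> schwartz psi -> schwartz_span (fun x => m x * psi x)
| schwartz_span_add f g : schwartz_span f -> schwartz_span g -> schwartz_span (fun x => f x + g x).

Lemma schwartz_span_rapid f : schwartz_span f -> rapid f.
Proof.
elim=> [m psi Mm spsi|g h _ [mg rg] _ [mh rh]].
  have [C [j mC]] := multiplier_growth Mm.
  by apply: (rapid_mul (multiplier_measurable Mm) mC); exact: schwartz_rapid.
split; first exact: measurable_funD.
move=> k; have [M gM] := rg k; have [M' hM'] := rh k; exists (M + M') => x.
rewrite (le_trans _ (lerD (gM x) (hM' x)))// -mulrDr ler_wpM2l ?ler_normD// exprn_ge0//.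
exact/ltW/bracket_gt0.
Qed.

Lemma schwartz_span_derive (i : 'I_3) f : schwartz_span f ->
  exists2 f', schwartz_span f' & forall x, is_derive x (basis3 i) f (f' x).
Proof.
elim=> [m psi Mm spsi|g h _ [g' G' dg] _ [h' H' dh]].
  have [m' M' dm] := multiplier_derive i Mm.
  exists (fun x => m x * 'D_(basis3 i) psi x + m' x * psi x).
    apply: schwartz_span_add; last exact: schwartz_span_mul.
    by apply: schwartz_span_mul => //; exact: schwartz_derive.
  move=> x; have dp : is_derive x (basis3 i) psi ('D_(basis3 i) psi x).
    by apply: DeriveDef => //; exact: schwartz_derivable.
  by apply: (is_derive_eq (is_deriveM (dm x) dp)); rewrite /GRing.scale/= [_ * m' x]mulrC.
exists (fun x => g' x + h' x); first exact: schwartz_span_add.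
by move=> x; exact: is_deriveD.
Qed.

Lemma schwartz_multiplier m psi : multiplier m -> schwartz psi ->
  schwartz (fun x => m x * psi x).
Proof.
move=> Mm spsi; apply: (schwartz_coind (P := schwartz_span)); last exact: schwartz_span_mul.
move=> g sg; split.
- move=> i x; have [g' _ dg] := schwartz_span_derive i sg.
  by have := dg x; move=> ?; exact: ex_derive.
- by case: (schwartz_span_rapid sg).
- move=> i; have [g' sg' dg] := schwartz_span_derive i sg.
  rewrite (_ : (fun x => _) = g')//; apply/funext => x.
  by have := dg x; move=> ?; exact: derive_val.
Qed.

(** The invariant class consists of all transforms with arbitrary phase: a derivative turns the
    phase and multiplies the transformed function by a linear factor, which keeps it Schwartz. *)
Lemma schwartz_Fph (theta : R) (chi : R3 -> R) : schwartz chi -> schwartz (Fph theta chi).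
Proof.
move=> sc; pose P (f : R3 -> R) := exists theta' chi', schwartz chi' /\ f = Fph theta' chi'.
apply: (schwartz_coind (P := P)); last by exists theta, chi.
move=> _ [theta' [chi' [sc' ->]]]; split.
- move=> i x; have := is_derive_Fph theta' x (basis3 i) (schwartz_rapid sc').
  by move=> ?; exact: ex_derive.
- by move=> k; exact: Fph_rapid_decay.
- move=> i; exists (theta' + pi / 2), (fun xi => dot3 (basis3 i) xi * chi' xi); split.
    by apply: schwartz_multiplier => //; exact: multiplier_dot.
  apply/funext => x; have := is_derive_Fph theta' x (basis3 i) (schwartz_rapid sc').
  by move=> ?; exact: derive_val.
Qed.

End schwartz_class.

(** * The radial wave propagators on the Fourier side *)

Section radial_wave_operators.
Context {R : realType}.
Local Notation leb := (@lebesgue_measure R).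
Local Notation R3 := (R * R * R)%type.
Local Notation mu := (lebesgue3 R).
Local Notation R' := (measurableTypeR R).
Local Notation kappa := (@disc_area R).

(* The profile at radius r of sin(t sqrt(-Delta))/sqrt(-Delta) applied to F(|x|) *)
Definition sphere_mean (t : R) (F : R -> R) (r : R) : R :=
  (2 * r)^-1 * \int[leb]_rho (if (`|r - t| < rho) && (rho < r + t) then rho * F rho else 0).

(* The profile at time t of the free outgoing wave with data g(|x|) *)
Definition outgoing_wave (t : R) (g : R -> R) (r : R) : R :=
  if t < r then (r - t) / r * g (r - t) else 0.

Lemma measurable_sphere_mean d (T : measurableType d) (a b : T -> R) (f : T * R' -> R) :
  measurable_fun setT a -> measurable_fun setT b -> measurable_fun setT f ->
  measurable_fun setT (fun z => sphere_mean (a z) (fun rho => f (z, rho)) (b z)).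
Proof.
move=> ma mb mf; apply: measurable_funM.
  by apply: measurable_funV; exact: measurable_funM.
have ma1 : measurable_fun setT (fun z : T * R' => a z.1) by exact: measurableT_comp.
have mb1 : measurable_fun setT (fun z : T * R' => b z.1) by exact: measurableT_comp.
apply: (@measurable_fun_Rintegral _ _ _ _ _ leb (fun z : T * R' =>
  if (`|b z.1 - a z.1| < z.2) && (z.2 < b z.1 + a z.1) then z.2 * f z else 0)).
apply: measurable_fun_ifT => //; last exact: measurable_funM.
apply: measurable_and; apply: measurable_fun_ltr => //; last exact: measurable_funD.
apply: (measurableT_comp (@normr_measurable R setT)) => //; exact: measurable_funB.
Qed.

Lemma measurable_sphere_mean1 (t : R) (F : R -> R) : measurable_fun setT F ->
  measurable_fun setT (sphere_mean t F).
Proof.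
move=> mF; apply: (@measurable_sphere_mean _ R' (fun=> t) id (fun z => F z.2)) => //.
exact: measurableT_comp.
Qed.

Lemma measurable_outgoing_wave d (T : measurableType d) (a b : T -> R) (g : R -> R) :
  measurable_fun setT a -> measurable_fun setT b -> measurable_fun setT g ->
  measurable_fun setT (fun z => outgoing_wave (a z) g (b z)).
Proof.
move=> ma mb mg; have mba : measurable_fun setT (fun z => b z - a z) by exact: measurable_funB.
apply: measurable_fun_indlt => //; apply: measurable_funM; last exact: (measurableT_comp mg).
by apply: measurable_funM => //; exact: measurable_funV.
Qed.

Lemma outgoing_wave_bounded (t : R) (g : R -> R) (B : R) r : 0 <= t ->
  (forall r, `|g r| <= B) -> `|outgoing_wave t g r| <= B.
Proof.
move=> t0 gB; rewrite /outgoing_wave; case: ifPn => [tr|_]; last first.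
  by rewrite normr0 (le_trans _ (gB 0)).
have r0 : 0 < r by exact: le_lt_trans tr.
rewrite normrM -[leRHS]mul1r ler_pM// ger0_norm; last by rewrite divr_ge0 ?subr_ge0 ?(ltW tr) ?(ltW r0).
by rewrite ler_pdivrMr// mul1r gerBl.
Qed.

Lemma sphere_mean_integrand_bounded (t r B : R) (F : R -> R) : 0 <= t -> measurable_fun setT F ->
  (forall r, `|F r| <= B) ->
  leb.-integrable setT (EFin \o (fun rho =>
    if (`|r - t| < rho) && (rho < r + t) then rho * F rho else 0)).
Proof.
move=> t0 mF FB; apply: (@integrable_bounded_interval _ (fun rho => rho * F rho) _ _ ((r + t) * B)).
  exact: measurable_funM.
move=> z z1 z2; rewrite normrM ler_pM// gtr0_norm ?ltW// (le_lt_trans _ z1)//.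
Qed.

Lemma Rintegral_id_interval (a b : R) : a <= b ->
  \int[leb]_z (if (a < z) && (z < b) then z else 0) = (b ^+ 2 - a ^+ 2) / 2.
Proof.
move=> ab.
have dz (z : R) : is_derive z (1 : R) (fun z => z ^+ 2 / 2) z.
  by apply: is_derive_eq; rewrite /GRing.scale/=; field.
rewrite (integral_interval_derive ab dz); first by field.
by move=> z; exact: cvg_id.
Qed.

(** The integral of rho from |r - t| to r + t is ((r + t)^2 - (r - t)^2)/2 = 2rt, and the prefactor
    1/(2r) leaves t. For r <= 0 the interval is empty. *)
Lemma sphere_mean_bounded (t B : R) (F : R -> R) (r : R) : 0 <= t -> measurable_fun setT F ->
  (forall r, `|F r| <= B) -> `|sphere_mean t F r| <= t * B.
Proof.
move=> t0 mF FB.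
have B0 : 0 <= B by exact: le_trans (FB 0).
have [r0|r0] := leP r 0.
  rewrite /sphere_mean (_ : \int[leb]_rho _ = 0) ?mulr0 ?normr0 ?mulr_ge0//.
  rewrite /Rintegral integral0_eq// => rho _; case: ifPn => // /andP[h1 h2].
  exfalso; move: h1; rewrite ltr_norml => /andP[h1 h3]; lra.
have rt : `|r - t| <= r + t by rewrite ler_norml; apply/andP; split; lra.
have iid : leb.-integrable setT (EFin \o (fun rho : R =>
    if (`|r - t| < rho) && (rho < r + t) then rho else 0)).
  apply: (@integrable_bounded_interval _ (fun rho => rho) _ _ (r + t)) => // z z1 z2.
  by rewrite gtr0_norm ?ltW// (le_lt_trans _ z1).
rewrite /sphere_mean normrM gtr0_norm ?invr_gt0 ?mulr_gt0// ler_pdivrMl ?mulr_gt0//.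
apply: (@le_trans _ _ (\int[leb]_rho (B * (if (`|r - t| < rho) && (rho < r + t) then rho else 0)))).
  apply: le_normr_Rintegral_dominated.
  - exact: (integrableZl measurableT B iid).
  - have iF := @sphere_mean_integrand_bounded t r B F t0 mF FB.
    exact: (integrable_measurable_fun iF).
  - move=> rho; case: ifPn => [/andP[h _]|_]; last by rewrite normr0 mulr0.
    rewrite normrM mulrC ler_pM// gtr0_norm// (le_lt_trans _ h)//.
rewrite RintegralZl//.
rewrite Rintegral_id_interval// real_normK ?num_real// le_eqVlt; apply/orP; left; apply/eqP.
by field.
Qed.

Lemma sphere_mean_support (t A : R) (F : R -> R) : (forall r, A <= r -> F r = 0) ->
  forall r, A + t <= r -> sphere_mean t F r = 0.
Proof.
move=> F0 r Ar; rewrite /sphere_mean (_ : \int[leb]_rho _ = 0) ?mulr0//.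
rewrite /Rintegral integral0_eq// => rho _; case: ifPn => // /andP[h1 _].
rewrite F0 ?mulr0//; move: h1; rewrite ltr_norml => /andP[_ h1]; lra.
Qed.

Lemma sphere_meanB (t B : R) (F G : R -> R) (r : R) : 0 <= t ->
  measurable_fun setT F -> measurable_fun setT G ->
  (forall r, `|F r| <= B) -> (forall r, `|G r| <= B) ->
  sphere_mean t F r - sphere_mean t G r = sphere_mean t (fun r => F r - G r) r.
Proof.
move=> t0 mF mG FB GB; rewrite /sphere_mean -mulrBr -RintegralB//.
- congr (_ * _); apply: eq_Rintegral => rho _; case: ifP => _; last by rewrite subrr.
  by rewrite mulrBr.
- exact: sphere_mean_integrand_bounded FB.
- exact: sphere_mean_integrand_bounded GB.
Qed.

Lemma measurable_sin_symbol_time (xi : R3) : measurable_fun setT (fun r : R' => sin_symbol r xi).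
Proof.
have -> : (fun r : R' => sin_symbol r xi) = if norm3 xi == 0 then id else
    fun r : R' => sin (r * norm3 xi) / norm3 xi.
  by apply/funext => r; rewrite /sin_symbol; case: ifP.
case: ifP => _; first exact: measurable_id.
by apply: measurable_funM => //; apply: measurable_fun_sin; exact: measurable_funM.
Qed.

Lemma measurable_cos_symbol_time (xi : R3) : measurable_fun setT (fun r : R' => cos_symbol r xi).
Proof. by apply: measurable_fun_cos; exact: measurable_funM. Qed.

Lemma continuous_sin_scale (d : R) : continuous (fun z : R => sin (z * d)).
Proof.
rewrite (_ : (fun z : R => _) = (fun z : R => sin (d * z))); last first.
  by apply/funext => y; rewrite mulrC.
move=> z; apply: (@continuous_comp _ _ _ (fun z : R => d * z) (@sin R)).
  exact: mulrl_continuous.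
exact: continuous_sin.
Qed.

Definition cutoff (A : R) (F : R -> R) (r : R) : R := if r < A then F r else 0.

Lemma measurable_cutoff A F : measurable_fun setT F -> measurable_fun setT (cutoff A F).
Proof. by move=> mF; exact: measurable_fun_indlt. Qed.

Lemma cutoff_bounded A F B r : (forall r, `|F r| <= B) -> `|cutoff A F r| <= B.
Proof.
by move=> FB; rewrite /cutoff; case: ifP => // _; rewrite normr0 (le_trans _ (FB 0)).
Qed.

Section compact_support.
Variables (F : R -> R) (A B : R).
Hypotheses (mF : measurable_fun setT F) (FB : forall r, `|F r| <= B)
  (F0 : forall r, A <= r -> F r = 0).

Lemma integrable_compact_radial (S : R -> R) (C : R) : measurable_fun setT S ->
  (forall r, 0 < r -> r < A -> `|S r| <= C) ->
  leb.-integrable setT (EFin \o (fun r => if 0 < r then r * F r * S r else 0)).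
Proof.
move=> mS SC.
rewrite (_ : (fun r => _) = (fun r => if (0 < r) && (r < A) then r * F r * S r else 0)); last first.
  apply/funext => r; case: ifP => //= _; case: ltP => // Ar.
  by rewrite F0// mulr0 mul0r.
apply: (@integrable_bounded_interval _ (fun r => r * F r * S r) _ _ (A * B * C)).
  by apply: measurable_funM => //; exact: measurable_funM.
move=> z z1 z2; rewrite !normrM ler_pM ?mulr_ge0 ?SC// ler_pM// gtr0_norm// ltW//.
Qed.

Lemma radial_cos_transform (xi : R3) :
  mu.-integrable setT (EFin \o (fun x => F (norm3 x) * cos (dot3 x xi))) /\
  \int[mu]_x (F (norm3 x) * cos (dot3 x xi)) =
  4 * kappa * \int[leb]_r (if 0 < r then r * F r * sin_symbol r xi else 0).
Proof.
have [d dE H] := Rintegral_radial xi.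
have [] := H F (@cos R) A (`|A| * B) 1 mF.
- exact: measurable_fun_cos.
- exact: F0.
- move=> r r0; have [Ar|rA] := leP A r.
    by rewrite F0// normr0 mulr0 mulr_ge0// (le_trans _ (FB 0)).
  by rewrite ler_pM ?(ltW r0)// (le_trans (ltW rA))// ler_norm.
- by move=> s; rewrite mul1r (le_trans (cos_max _))// lerDl.
move=> iF ->; split => //.
rewrite -RintegralZl//; last first.
  apply: (@integrable_compact_radial (fun r => sin_symbol r xi) `|A|).
    exact: measurable_sin_symbol_time.
  move=> r r0 rA; rewrite (le_trans (sin_symbol_bounded _ _))// gtr0_norm//.
  by rewrite (le_trans (ltW rA))// ler_norm.
apply: eq_Rintegral => r _; rewrite integral_ball_cos (sin_symbol_root _ dE).
by case: ifP => _; ring.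
Qed.

(** Counterpart of the cosine transform for the outgoing velocity: the integral of K(dz) over |z| <
    r is 2r cos(rd), and one factor r cancels against F(r)/r. *)
Lemma radial_kernel_transform (xi : R3) :
  mu.-integrable setT (EFin \o (fun x => F (norm3 x) / norm3 x *
     (cos (dot3 x xi) - dot3 x xi * sin (dot3 x xi)))) /\
  \int[mu]_x (F (norm3 x) / norm3 x * (cos (dot3 x xi) - dot3 x xi * sin (dot3 x xi))) =
  4 * kappa * \int[leb]_r (if 0 < r then r * F r * cos_symbol r xi else 0).
Proof.
have [d dE H] := Rintegral_radial xi.
have [] := H (fun r => F r / r) (fun s => cos s - s * sin s) A B 1.
- by apply: measurable_funM => //; exact: measurable_funV.
- apply: measurable_funB; first exact: measurable_fun_cos.
  by apply: measurable_funM => //; exact: measurable_fun_sin.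
- by move=> r Ar; rewrite F0// mul0r.
- move=> r r0; rewrite normrM normfV (gtr0_norm r0) mulrCA divff ?gt_eqF// mulr1.
  exact: FB.
- move=> s; rewrite mul1r (le_trans (ler_normB _ _))// lerD ?cos_max//.
  by rewrite normrM ler_piMr// sin_max.
move=> iF ->; split => //.
rewrite -RintegralZl//; last first.
  apply: (@integrable_compact_radial (fun r => cos_symbol r xi) 1).
    exact: measurable_cos_symbol_time.
  by move=> r _ _; exact: cos_max.
apply: eq_Rintegral => r _; rewrite integral_ball_kernel (cos_symbol_root _ dE).
by case: ifPn => r0; last ring; field; rewrite gt_eqF.
Qed.

End compact_support.

(** Under the radial integral, cos(td) sin(rd)/d + sin(td) cos(rd)/d = sin((r + t)d)/d. Substituting
    r + t for r on the right turns the translated profile back into r F(r). *)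
Lemma outgoing_wave_transform (F : R -> R) (A B t : R) (xi : R3) :
  measurable_fun setT F -> (forall r, `|F r| <= B) -> (forall r, A <= r -> F r = 0) -> 0 <= t ->
  cos_symbol t xi * \int[mu]_x (F (norm3 x) * cos (dot3 x xi)) +
  sin_symbol t xi * \int[mu]_x (F (norm3 x) / norm3 x *
     (cos (dot3 x xi) - dot3 x xi * sin (dot3 x xi))) =
  \int[mu]_x (outgoing_wave t F (norm3 x) * cos (dot3 x xi)).
Proof.
move=> mF FB F0 t0.
have dE : norm3 xi ^+ 2 = dot3 xi xi by exact: sqr_norm3.
have ms := measurable_sin_symbol_time xi.
have mc := measurable_cos_symbol_time xi.
rewrite (radial_cos_transform mF FB F0 xi).2 (radial_kernel_transform mF FB F0 xi).2.
have mL : measurable_fun setT (outgoing_wave t F).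
  by apply: (@measurable_outgoing_wave _ R' (fun=> t) id).
have LB r : `|outgoing_wave t F r| <= B by exact: outgoing_wave_bounded.
have L0 r : A + t <= r -> outgoing_wave t F r = 0.
  by move=> Ar; rewrite /outgoing_wave F0 ?mulr0 ?lerBrDr//; case: ifP.
rewrite (radial_cos_transform mL LB L0 xi).2.
rewrite !(mulrCA _ (4 * kappa)) -mulrDr; congr (_ * _).
have is1 : leb.-integrable setT (EFin \o (fun r => if 0 < r then r * F r * sin_symbol r xi else 0)).
  apply: (integrable_compact_radial mF FB F0 (S := fun r => sin_symbol r xi) (C := `|A|)) => //.
  move=> r r0 rA; rewrite (le_trans (sin_symbol_bounded _ _))// gtr0_norm//.
  by rewrite (le_trans (ltW rA))// ler_norm.
have ic1 : leb.-integrable setT (EFin \o (fun r => if 0 < r then r * F r * cos_symbol r xi else 0)).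
  apply: (integrable_compact_radial mF FB F0 (S := fun r => cos_symbol r xi) (C := 1)) => //.
  by move=> r _ _; exact: cos_max.
rewrite -!RintegralZl// -RintegralD//; last 2 first.
- exact: (integrableZl measurableT _ is1).
- exact: (integrableZl measurableT _ ic1).
rewrite -[RHS](Rintegral_preserves (preserves_translation t))/=; last first.
  apply: measurable_fun_indlt => //; apply: measurable_funM => //; exact: measurable_funM.
apply: eq_Rintegral => r _; rewrite /outgoing_wave.
have [r0|r0] := ltP 0 (r : R); last first.
  rewrite !mulr0 addr0; case: ifPn => // _; rewrite ifF; first by rewrite mulr0 mul0r.
  by apply/negbTE; rewrite -leNgt gerDr.
have rt0 : 0 < r + t by rewrite ltr_wpDr.
rewrite rt0 ltrDr r0 addrK.
rewrite (_ : (r + t) * (r / (r + t) * F r) = r * F r); last first.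
  by field; rewrite gt_eqF.
rewrite !(sin_symbol_root _ dE) !(cos_symbol_root _ dE) /sinc_root.
case: eqP => [->|/eqP n0].
  by rewrite !mulr0 cos0; ring.
by rewrite mulrDl sinD; field.
Qed.

(** The primitive is -cos(dz)/d^2; since cosine is even, the absolute value in the lower limit
    disappears, and cos(d(r - t)) - cos(d(r + t)) = 2 sin(dt) sin(dr). *)
Lemma Rintegral_sin_symbol (t r : R) (xi : R3) : 0 <= t -> 0 < r ->
  \int[leb]_s (if (`|r - t| < s) && (s < r + t) then sin_symbol s xi else 0) =
  2 * sin_symbol t xi * sin_symbol r xi.
Proof.
move=> t0 r0; have dE : norm3 xi ^+ 2 = dot3 xi xi by exact: sqr_norm3.
have rt : `|r - t| <= r + t by rewrite ler_norml; apply/andP; split; lra.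
under eq_Rintegral do rewrite (sin_symbol_root _ dE).
rewrite !(sin_symbol_root _ dE) /sinc_root; case: eqP => [d0|/eqP d0].
  rewrite Rintegral_id_interval// real_normK ?num_real//; by field.
set d := norm3 xi.
have dz (z : R) : is_derive z (1 : R) (fun z => - d ^- 2 * cos (d * z)) (sin (z * d) / d).
  by apply: is_derive_eq; rewrite /GRing.scale/= (mulrC z d); field.
rewrite (integral_interval_derive rt dz); last first.
  move=> z; apply: cvgM; last exact: cvg_cst.
  exact: (continuous_sin_scale (d := d)).
have -> : cos (d * `|r - t|) = cos (d * (r - t)).
  have [_|_] := ger0P (r - t); first by [].
  by rewrite mulrN cosN.
rewrite mulrBr mulrDr cosB cosD (mulrC t) (mulrC r); by field.
Qed.

(** The domain of integration says that r, rho and t satisfy the strict triangle inequalities, so it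
    is symmetric in r and rho. After Fubini the integral over r is the one in
    [Rintegral_sin_symbol]. *)
Lemma sphere_mean_transform (F : R -> R) (A B t : R) (xi : R3) :
  measurable_fun setT F -> (forall r, `|F r| <= B) -> (forall r, A <= r -> F r = 0) -> 0 <= t ->
  sin_symbol t xi * \int[mu]_x (F (norm3 x) * cos (dot3 x xi)) =
  \int[mu]_x (sphere_mean t F (norm3 x) * cos (dot3 x xi)).
Proof.
move=> mF FB F0 t0.
have dE : norm3 xi ^+ 2 = dot3 xi xi by exact: sqr_norm3.
have ms := measurable_sin_symbol_time xi.
have mW := measurable_sphere_mean1 t mF.
have WB r : `|sphere_mean t F r| <= t * B by exact: sphere_mean_bounded.
have W0 r : A + t <= r -> sphere_mean t F r = 0 by exact: sphere_mean_support.
rewrite (radial_cos_transform mF FB F0 xi).2 (radial_cos_transform mW WB W0 xi).2.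
rewrite mulrCA; congr (_ * _).
pose k (p : R' * R') : R := if (0 < (p.1 : R)) && ((`|p.1 - t| < p.2) && (p.2 < p.1 + t))
  then p.2 * F p.2 / 2 * sin_symbol p.1 xi else 0.
have kE (r rho : R) : k (r, rho) = if (0 < rho) && ((`|rho - t| < r) && (r < rho + t))
    then rho * F rho / 2 * sin_symbol r xi else 0.
  rewrite /k/=; congr (if _ then _ else _).
  rewrite !ltr_norml; apply/idP/idP => /and3P[h1 /andP[h2 h3] h4];
    by apply/and3P; split; [lra|apply/andP; split; lra|lra].
have mF2 : measurable_fun setT (fun p : R' * R' => F p.2) by exact: measurableT_comp.
have ms1 : measurable_fun setT (fun p : R' * R' => sin_symbol p.1 xi).
  exact: (measurableT_comp ms).
have mk : measurable_fun setT k.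
  apply: measurable_fun_ifT => //; last first.
    by apply: measurable_funM => //; apply: measurable_funM => //; exact: measurable_funM.
  apply: measurable_and; first exact: measurable_fun_ltr.
  apply: measurable_and; apply: measurable_fun_ltr => //; last exact: measurable_funD.
  apply: (measurableT_comp (@normr_measurable R setT)) => //; exact: measurable_funB.
pose S := `[- (`|A| + t), `|A| + t]%classic `*` `[- `|A|, `|A|]%classic : set (R' * R').
have ik : (leb \x leb)%E.-integrable setT (EFin \o k).
  apply: (@integrable_indic_dominated _ _ _ _ _ S (`|A| * B / 2 * (`|A| + t))) => //.
  - exact: measurableX.
  - rewrite /= /S product_measure1E//= !lebesgue_measure_itv/= !lte_fin.
    by do 2 case: ifP => _; rewrite ?mule0 ?mul0e ?ltry// -!EFinB -EFinM ltry.
  - move=> [r rho] [/=]; rewrite !in_itv/= => /andP[r1 r2] /andP[rho1 rho2].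
    have B0 : 0 <= B by exact: le_trans (FB 0).
    rewrite /k/=; case: ifPn => [/and3P[r0 h1 h2]|_]; last first.
      by rewrite normr0 !mulr_ge0 ?addr_ge0 ?invr_ge0.
    have rho0 : 0 < rho by rewrite (le_lt_trans _ h1).
    rewrite !normrM (gtr0_norm rho0) (gtr0_norm (_ : 0 < 2^-1)) ?invr_gt0//.
    rewrite ler_pM ?mulr_ge0 ?(ltW rho0) ?invr_ge0//.
      by rewrite ler_pM ?mulr_ge0 ?(ltW rho0) ?invr_ge0// ler_pM// ltW.
    by rewrite (le_trans (sin_symbol_bounded _ _))// gtr0_norm.
  - move=> [r rho] nS; rewrite /k/=; case: ifPn => // /and3P[r0 h1 h2].
    have rho0 : 0 < rho by rewrite (le_lt_trans _ h1).
    have [Ar|rA] := leP A rho; first by rewrite F0// mulr0 !mul0r.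
    exfalso; apply: nS; move: h1; rewrite ltr_norml => /andP[h1 h3].
    have AA := ler_norm A.
    by split; rewrite /= in_itv/=; apply/andP; split; lra.
transitivity (\int[leb]_r \int[leb]_rho k (r, rho)); last first.
  apply: eq_Rintegral => r _; rewrite /k/=.
  have [r0|r0] /= := boolP (0 < (r : R)); last by rewrite /Rintegral integral0_eq.
  rewrite /sphere_mean mulrA [X in _ = X * _ * _](_ : r * (2 * r)^-1 = 2^-1); last first.
    by field; rewrite gt_eqF.
  rewrite mulrAC -RintegralZl//; last exact: sphere_mean_integrand_bounded FB.
  apply: eq_Rintegral => rho _; case: ifP => _; last by rewrite mulr0.
  by ring.
rewrite (Rintegral_exchange ik) -RintegralZl//; last first.
  apply: (integrable_compact_radial mF FB F0 (S := fun r => sin_symbol r xi) (C := `|A|)) => //.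
  move=> r r0 rA; rewrite (le_trans (sin_symbol_bounded _ _))// gtr0_norm//.
  by rewrite (le_trans (ltW rA))// ler_norm.
apply: eq_Rintegral => rho _; under [RHS]eq_Rintegral do rewrite kE.
have [rho0|rho0] /= := boolP (0 < (rho : R)); last by rewrite mulr0 /Rintegral integral0_eq.
transitivity (rho * F rho / 2 * \int[leb]_r (if (`|rho - t| < r) && (r < rho + t)
    then sin_symbol r xi else 0)).
  by rewrite Rintegral_sin_symbol//; field.
rewrite -RintegralZl//.
  by apply: eq_Rintegral => r _; case: ifP => _; rewrite ?mulr0.
apply: (@integrable_bounded_interval _ (fun r => sin_symbol r xi) _ _ (rho + t)) => // z z1 z2.
rewrite (le_trans (sin_symbol_bounded _ _))// gtr0_norm ?ltW// (le_lt_trans _ z1)//.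
Qed.

End radial_wave_operators.

(** * Pairing with test functions *)

Section wave_identities.
Context {R : realType}.
Local Notation leb := (@lebesgue_measure R).
Local Notation R3 := (R * R * R)%type.
Local Notation mu := (lebesgue3 R).
Local Notation R' := (measurableTypeR R).

Lemma integrable_normr d (T : measurableType d) (m : {measure set T -> \bar R}) (f : T -> R) :
  m.-integrable setT (EFin \o f) -> m.-integrable setT (EFin \o (fun x => `|f x|)).
Proof. by move=> /integrable_abse. Qed.

Lemma integrable_bounded_mul d (T : measurableType d) (m : {measure set T -> \bar R})
    (a f : T -> R) (C : R) : measurable_fun setT a -> (forall x, `|a x| <= C) ->
  m.-integrable setT (EFin \o f) -> m.-integrable setT (EFin \o (fun x => a x * f x)).
Proof.
move=> ma aC fi; have fi' := integrable_normr fi.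
apply: (@integrable_dominated _ _ _ m _ (fun x => C * `|f x|)).
- exact: (integrableZl measurableT _ fi').
- by apply: measurable_funM => //; exact: (integrable_measurable_fun fi).
- by move=> x; rewrite normrM ler_wpM2r.
Qed.

Lemma rapid_kernel (K : R' -> R) (chi : R3 -> R) x : measurable_fun setT K ->
  (forall s, `|K s| <= 1 + `|s|) -> rapid chi -> rapid (fun xi => K (dot3 x xi) * chi xi).
Proof.
move=> mK KB rc; apply: (@rapid_mul _ (fun xi => K (dot3 x xi)) chi (2 + dot3 x x) 1) => //.
  exact: (measurableT_comp mK (multiplier_measurable (multiplier_dot x))).
move=> xi; rewrite expr1 (le_trans (KB _))// (_ : 2 + _ = 1 + (1 + dot3 x x)); last ring.
by rewrite mulrDl mul1r lerD ?bracket_ge1// dot3_bracket.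
Qed.

Lemma Fph0E (chi : R3 -> R) :
  Fph 0 chi = fun x => \int[mu]_xi (cos (dot3 x xi) * chi xi).
Proof.
by apply/funext => x; rewrite /Fph; apply: eq_Rintegral => xi _; rewrite addr0.
Qed.

(** Fubini. On the support of [a] one has |x| < A, so |K(x.xi)| is at most a constant times
    [bracket xi], which the decay of [chi] absorbs. *)
Lemma pair_kernel (a : R3 -> R) (A : R) (K : R' -> R) (chi : R3 -> R) :
  mu.-integrable setT (EFin \o a) -> (forall x, A <= norm3 x -> a x = 0) ->
  measurable_fun setT K -> (forall s, `|K s| <= 1 + `|s|) -> rapid chi ->
  mu.-integrable setT (EFin \o (fun xi => chi xi * \int[mu]_x (a x * K (dot3 x xi)))) /\
  \int[mu]_x (a x * \int[mu]_xi (K (dot3 x xi) * chi xi)) =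
  \int[mu]_xi (chi xi * \int[mu]_x (a x * K (dot3 x xi))).
Proof.
move=> ia a0 mK KB rc.
have ma := integrable_measurable_fun ia.
have mchi := rc.1.
have aK x xi : `|a x * K (dot3 x xi)| <= (2 + A ^+ 2) * `|a x| * bracket xi.
  have [Ax|xA] := leP A (norm3 x); first by rewrite a0// mul0r normr0 mulr0 mul0r.
  rewrite normrM mulrAC mulrC ler_wpM2r// (le_trans (KB _))//.
  rewrite (_ : 2 + _ = 1 + (1 + A ^+ 2)); last ring.
  rewrite mulrDl mul1r lerD ?bracket_ge1// (le_trans (dot3_bracket _ _))//.
  rewrite ler_wpM2r ?(ltW (bracket_gt0 _))// lerD2l -sqr_norm3.
  by rewrite ler_sqr ?nnegrE ?norm3_ge0 ?(ltW xA)// (le_trans (norm3_ge0 x))// ltW.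
have mKd : measurable_fun setT (fun z : R3 * R3 => K (dot3 z.1 z.2)).
  exact: (measurableT_comp mK measurable_dot3_pair).
have ib : mu.-integrable setT (EFin \o (fun xi => bracket xi * `|chi xi|)).
  have rb : rapid (fun xi => bracket xi * chi xi).
    apply: (@rapid_mul _ _ _ 1 1) => //; first exact: measurable_bracket.
    by move=> x; rewrite mul1r expr1 gtr0_norm ?bracket_gt0.
  have := integrable_normr (integrable_rapid rb).
  congr (mu.-integrable _ (EFin \o _)).
  by apply/funext => x; rewrite normrM gtr0_norm ?bracket_gt0.
pose f (z : R3 * R3) := a z.1 * (K (dot3 z.1 z.2) * chi z.2).
have iff : (mu \x mu)%E.-integrable setT (EFin \o f).
  apply: (@integrable_tensor _ _ _ _ _ mu mu f (fun x => (2 + A ^+ 2) * `|a x|) _ _ ib).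
  - have ia' := integrable_normr ia; exact: (integrableZl measurableT _ ia').
  - apply: measurable_funM; first exact: (measurableT_comp ma).
    by apply: measurable_funM => //; exact: (measurableT_comp mchi).
  - move=> [x xi]; rewrite /f/= mulrA normrM mulrA ler_wpM2r// aK.
have fE xi : \int[mu]_x f (x, xi) = chi xi * \int[mu]_x (a x * K (dot3 x xi)).
  rewrite /f/= -RintegralZl//; first by apply: eq_Rintegral => x _; ring.
  apply: (@integrable_dominated _ _ _ mu _ (fun x => ((2 + A ^+ 2) * bracket xi) * `|a x|)).
  - have ia' := integrable_normr ia; exact: (integrableZl measurableT _ ia').
  - apply: measurable_funM => //; apply: (measurableT_comp mK); exact: measurable_dot3.
  - by move=> x; rewrite (le_trans (aK _ _))// mulrAC.
split.
  have := integrable_Rintegral1 (integrable_swap iff); congr (mu.-integrable _ (EFin \o _)).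
  by apply/funext => xi; rewrite -fE.
transitivity (\int[mu]_x \int[mu]_xi f (x, xi)).
  apply: eq_Rintegral => x _; rewrite /f/= RintegralZl//.
  apply: integrable_rapid; exact: rapid_kernel.
by rewrite (Rintegral_exchange iff); apply: eq_Rintegral => xi _; rewrite fE.
Qed.

(** The test function against which u_0 is paired in place of u_1: the adjoint of the radial
    derivative contributes phi_r + 2 phi/r, and the term -u_0/r removes one phi/r. *)
Definition outgoing_test (phi : R3 -> R) (x : R3) : R := rderiv phi x + phi x / norm3 x.

Lemma rderiv_Fph theta chi x : rapid chi ->
  rderiv (Fph theta chi) x = (norm3 x)^-1 *
    \int[mu]_xi (cos (dot3 x xi + (theta + pi / 2)) * (dot3 x xi * chi xi)).
Proof.
move=> rc; rewrite /rderiv.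
have := @is_derive_Fph R theta chi x ((norm3 x)^-1 *: x) rc.
move=> H; rewrite derive_val /Fph -RintegralZl//; last first.
  by apply: integrable_rapid; apply: rapid_wave; exact: rapid_dot.
by apply: eq_Rintegral => xi _; rewrite dot3Zl; ring.
Qed.

Lemma ratio_norm3_le1 (c : R) (x : R3) : c ^+ 2 <= dot3 x x -> `|c / norm3 x| <= 1.
Proof.
move=> cx; have [x0|x0] := eqVneq (norm3 x) 0; first by rewrite x0 invr0 mulr0 normr0.
have xp : 0 < norm3 x by rewrite lt_neqAle eq_sym x0 norm3_ge0.
rewrite normrM normfV (gtr0_norm xp) ler_pdivrMr// mul1r.
by rewrite -ler_sqr ?nnegrE ?norm3_ge0// sqr_norm3 real_normK ?num_real.
Qed.

(** The radial derivative is the sum over the coordinates of x_i/|x|, bounded by 1, times a partial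
    derivative of the transform, which is again a Schwartz function. *)
Lemma integrable_rderiv_Fph theta chi : schwartz chi ->
  mu.-integrable setT (EFin \o rderiv (Fph theta chi)).
Proof.
move=> sc; have rc := schwartz_rapid sc.
pose H (v : R3) := Fph (theta + pi / 2) (fun xi => dot3 v xi * chi xi).
have iH (c : R3 -> R) v : measurable_fun setT c -> (forall x, c x ^+ 2 <= dot3 x x) ->
    mu.-integrable setT (EFin \o (fun x => c x / norm3 x * H v x)).
  move=> mc cx; apply: integrable_rapid; apply: (@rapid_bounded_mul _ _ _ 1).
  - by apply: measurable_funM => //; apply: measurable_funV; exact: measurable_norm3.
  - by move=> x; exact: ratio_norm3_le1.
  - apply/schwartz_rapid/schwartz_Fph; apply: schwartz_multiplier => //.
    exact: multiplier_dot.
have i1 : mu.-integrable setT (EFin \o (fun x => x.1.1 / norm3 x * H (1, 0, 0) x)).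
  apply: (iH (fun x => x.1.1)); first exact: (measurableT_comp measurable_fst measurable_fst).
  by move=> x; rewrite /dot3 -!expr2; nra.
have i2 : mu.-integrable setT (EFin \o (fun x => x.1.2 / norm3 x * H (0, 1, 0) x)).
  apply: (iH (fun x => x.1.2)); first exact: (measurableT_comp measurable_snd measurable_fst).
  by move=> x; rewrite /dot3 -!expr2; nra.
have i3 : mu.-integrable setT (EFin \o (fun x => x.2 / norm3 x * H (0, 0, 1) x)).
  apply: (iH (fun x => x.2)); first exact: measurable_snd.
  by move=> x; rewrite /dot3 -!expr2; nra.
have := integrableD measurableT (integrableD measurableT i1 i2) i3.
congr (mu.-integrable _ _); apply/funext => x; rewrite /= -!EFinD; congr EFin.
have iw v c : mu.-integrable setT (EFin \o (fun xi =>
    c * (cos (dot3 x xi + (theta + pi / 2)) * (dot3 v xi * chi xi)))).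
  have iw0 : mu.-integrable setT (EFin \o (fun xi =>
      cos (dot3 x xi + (theta + pi / 2)) * (dot3 v xi * chi xi))).
    by apply: integrable_rapid; apply: rapid_wave; exact: rapid_dot.
  exact: (integrableZl measurableT c iw0).
have iw1 v : mu.-integrable setT (EFin \o (fun xi =>
    cos (dot3 x xi + (theta + pi / 2)) * (dot3 v xi * chi xi))).
  by apply: integrable_rapid; apply: rapid_wave; exact: rapid_dot.
rewrite rderiv_Fph// /H /Fph -!RintegralZl//.
have j12 := integrableD measurableT (iw (1, 0, 0) (x.1.1 / norm3 x)) (iw (0, 1, 0) (x.1.2 / norm3 x)).
rewrite -!RintegralD//; apply: eq_Rintegral => xi _; rewrite /dot3/=; ring.
Qed.

(** The radial derivative contributes s cos(s + pi/2) = -s sin s with s = x.xi, and division by |x|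
    contributes cos s; both carry the same factor 1/|x|. *)
Lemma outgoing_test_Fph chi x : rapid chi ->
  outgoing_test (Fph 0 chi) x = (norm3 x)^-1 *
    \int[mu]_xi ((cos (dot3 x xi) - dot3 x xi * sin (dot3 x xi)) * chi xi).
Proof.
move=> rc; rewrite /outgoing_test rderiv_Fph// [X in _ + X = _]mulrC -mulrDr; congr (_ * _).
rewrite /Fph -RintegralD//; last 2 first.
- by apply: integrable_rapid; apply: rapid_wave; exact: rapid_dot.
- by apply: integrable_rapid; exact: rapid_wave.
apply: eq_Rintegral => xi _; rewrite addr0 add0r cosDpihalf; ring.
Qed.

Lemma integrable_outgoing_test theta chi : schwartz chi ->
  mu.-integrable setT (EFin \o outgoing_test (Fph theta chi)).
Proof.
move=> sc.
have H1 := integrable_rderiv_Fph theta sc.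
have H2 := integrable_rapid_over_norm (schwartz_rapid (schwartz_Fph theta sc)).
have := integrableD measurableT H1 H2; congr (mu.-integrable _ _).
by apply/funext => x; rewrite /= -EFinD /outgoing_test (mulrC (Fph theta chi x)).
Qed.



Lemma cvg_pairing d (T : measurableType d) (m : {measure set T -> \bar R})
    (G : nat -> T -> R) (G' phi : T -> R) (C : R) :
  m.-integrable setT (EFin \o phi) -> (forall n, measurable_fun setT (G n)) ->
  (forall n x, `|G n x| <= C) ->
  (forall x, exists n0, forall n, (n0 <= n)%N -> G n x = G' x) ->
  (fun n : nat => \int[m]_x (G n x * phi x)) @ \oo --> \int[m]_x (G' x * phi x).
Proof.
move=> iphi mG GC GE.
have mphi := integrable_measurable_fun iphi.
have iphi' := integrable_normr iphi.
have iC : m.-integrable setT (EFin \o (fun x => C * `|phi x|)).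
  exact: (integrableZl measurableT _ iphi').
have cG x : G ^~ x @ \oo --> G' x.
  have [n0 H] := GE x; apply: cvg_near_cst; exists n0 => // n /= ?; exact: H.
have mG' : measurable_fun setT G' by exact: (measurable_fun_cvg mG).
have [iG' _ cvgE] := @dominated_convergence _ _ _ m setT measurableT
  (fun n x => (G n x * phi x)%:E) (fun x => (G' x * phi x)%:E) (fun x => (C * `|phi x|)%:E)
  ltac:(move=> n; apply/measurable_EFinP; exact: measurable_funM)
  ltac:(apply/measurable_EFinP; exact: measurable_funM)
  ltac:(apply: aeW => x _; apply: cvg_EFin; [by apply: nearW|
    apply: cvgM; [exact: cG|exact: cvg_cst]])
  iC
  ltac:(apply: aeW => x n _; by rewrite /= lee_fin normrM ler_wpM2r).
have fG' : (\int[m]_x (G' x * phi x)%:E)%E \is a fin_num.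
  exact: (integrable_fin_num _ iG').
apply: fine_cvg; by rewrite fineK.
Qed.

Lemma cvg_seq_unique (u v : nat -> R) (a b : R) :
  u @ \oo --> a -> v @ \oo --> b -> (forall n, u n = v n) -> a = b.
Proof.
move=> ua vb uv; apply: (cvg_unique _ ua); first exact: Rhausdorff.
by rewrite (_ : u = v)//; apply/funext.
Qed.

Lemma cvg_seq_sum_unique (u u' v : nat -> R) (a a' b : R) :
  u @ \oo --> a -> u' @ \oo --> a' -> v @ \oo --> b -> (forall n, u n + u' n = v n) -> a + a' = b.
Proof. by move=> ua ua'; apply: cvg_seq_unique; exact: cvgD. Qed.

Lemma schwartz_sin_symbol t (psi : R3 -> R) : 0 <= t -> schwartz psi ->
  schwartz (fun xi => sin_symbol t xi * psi xi).
Proof. by move=> t0 sp; apply: schwartz_multiplier => //; exact: multiplier_sin. Qed.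

Lemma schwartz_cos_symbol t (psi : R3 -> R) : 0 <= t -> schwartz psi ->
  schwartz (fun xi => cos_symbol t xi * psi xi).
Proof. by move=> t0 sp; apply: schwartz_multiplier => //; exact: multiplier_cos. Qed.

Lemma integrable_Fph theta (psi : R3 -> R) : schwartz psi ->
  mu.-integrable setT (EFin \o Fph theta psi).
Proof. by move=> sp; apply/integrable_rapid/schwartz_rapid/schwartz_Fph. Qed.

Section compact_support_pairing.
Variables (F : R -> R) (A B : R).
Hypotheses (mF : measurable_fun setT F) (FB : forall r, `|F r| <= B)
  (F0 : forall r, A <= r -> F r = 0).

(** This is the integrability part of the cosine transform at frequency 0, where the cosine equals
    1. *)
Lemma integrable_compact_profile : mu.-integrable setT (EFin \o (fun x => F (norm3 x))).
Proof.
have [H _] := radial_cos_transform mF FB F0 0; move: H; congr (mu.-integrable _ (EFin \o _)).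
by apply/funext => x; rewrite dot3C -(scale0r 0) dot3Zl mul0r cos0 mulr1.
Qed.

Lemma integrable_compact_profile_over_norm :
  mu.-integrable setT (EFin \o (fun x => F (norm3 x) / norm3 x)).
Proof.
have [H _] := radial_kernel_transform mF FB F0 0; move: H; congr (mu.-integrable _ (EFin \o _)).
by apply/funext => x; rewrite dot3C -(scale0r 0) dot3Zl !mul0r cos0 subr0 mulr1.
Qed.

Lemma pair_Fph chi : rapid chi ->
  mu.-integrable setT (EFin \o (fun xi => chi xi * \int[mu]_x (F (norm3 x) * cos (dot3 x xi)))) /\
  \int[mu]_x (F (norm3 x) * Fph 0 chi x) =
  \int[mu]_xi (chi xi * \int[mu]_x (F (norm3 x) * cos (dot3 x xi))).
Proof.
move=> rc; have [|||||H1 H2] := @pair_kernel (fun x => F (norm3 x)) A (@cos R) chi.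
- exact: integrable_compact_profile.
- by move=> x; exact: F0.
- exact: measurable_fun_cos.
- by move=> s; rewrite (le_trans (cos_max _))// lerDl.
- by [].
by split; [exact: H1|rewrite Fph0E; exact: H2].
Qed.

Lemma pair_outgoing_test chi : rapid chi ->
  mu.-integrable setT (EFin \o (fun xi => chi xi * \int[mu]_x (F (norm3 x) / norm3 x *
     (cos (dot3 x xi) - dot3 x xi * sin (dot3 x xi))))) /\
  \int[mu]_x (F (norm3 x) * outgoing_test (Fph 0 chi) x) =
  \int[mu]_xi (chi xi * \int[mu]_x (F (norm3 x) / norm3 x *
     (cos (dot3 x xi) - dot3 x xi * sin (dot3 x xi)))).
Proof.
move=> rc; have [|||||H1 H2] := @pair_kernel (fun x => F (norm3 x) / norm3 x) A
  (fun s : R => cos s - s * sin s) chi.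
- exact: integrable_compact_profile_over_norm.
- by move=> x Ax; rewrite F0// mul0r.
- apply: measurable_funB; first exact: measurable_fun_cos.
  by apply: measurable_funM => //; exact: measurable_fun_sin.
- move=> s; rewrite (le_trans (ler_normB _ _))// lerD ?cos_max//.
  by rewrite normrM ler_piMr// sin_max.
- by [].
split=> //; rewrite -H2; apply: eq_Rintegral => x _.
by rewrite outgoing_test_Fph// mulrA.
Qed.

End compact_support_pairing.

(** * From compactly supported to bounded profiles *)

Section removing_the_cutoff.
Variables (B t : R) (F : R -> R) (psi : R3 -> R).
Hypotheses (mF : measurable_fun setT F) (FB : forall r, `|F r| <= B) (t0 : 0 <= t)
  (sp : schwartz psi).

Lemma measurable_radial_profile (G : R' -> R) : measurable_fun setT G ->
  measurable_fun setT (fun x : R3 => G (norm3 x)).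
Proof. by move=> mG; exact: (measurableT_comp mG measurable_norm3). Qed.

Lemma cutoff_eq0 (A r : R) : A <= r -> cutoff A F r = 0.
Proof. by move=> Ar; rewrite /cutoff ltNge Ar. Qed.

Lemma cvg_cutoff (phi : R3 -> R) : mu.-integrable setT (EFin \o phi) ->
  (fun n : nat => \int[mu]_x (cutoff n%:R F (norm3 x) * phi x)) @ \oo -->
  \int[mu]_x (F (norm3 x) * phi x).
Proof.
move=> iphi; apply: (@cvg_pairing _ _ mu _ _ _ B) => //.
- by move=> n; apply: measurable_radial_profile; exact: measurable_cutoff.
- by move=> n x; exact: cutoff_bounded.
- move=> x; exists (Num.truncn (norm3 x)).+1 => n xn.
  rewrite /cutoff ifT// (lt_le_trans (truncnS_gt _))// ler_nat//.
Qed.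

Lemma cvg_sphere_mean_cutoff (phi : R3 -> R) : mu.-integrable setT (EFin \o phi) ->
  (fun n : nat => \int[mu]_x (sphere_mean t (cutoff n%:R F) (norm3 x) * phi x)) @ \oo -->
  \int[mu]_x (sphere_mean t F (norm3 x) * phi x).
Proof.
move=> iphi; apply: (@cvg_pairing _ _ mu _ _ _ (t * B)) => //.
- move=> n; apply: measurable_radial_profile.
  by apply: measurable_sphere_mean1; exact: measurable_cutoff.
- move=> n x; apply: sphere_mean_bounded => //; first exact: measurable_cutoff.
  by move=> r; exact: cutoff_bounded.
(* Finite speed of propagation: the mean at radius r only involves radii below r + t, so a cutoff
   beyond that radius has no effect. *)
- move=> x; exists (Num.truncn (norm3 x + t)).+1 => n xn.
  rewrite /sphere_mean; congr (_ * _); apply: eq_Rintegral => rho _.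
  case: ifP => // /andP[_ h]; congr (_ * _); rewrite /cutoff ifT//.
  by rewrite (lt_trans h)// (lt_le_trans (truncnS_gt _))// ler_nat.
Qed.

Lemma cvg_outgoing_wave_cutoff (phi : R3 -> R) : mu.-integrable setT (EFin \o phi) ->
  (fun n : nat => \int[mu]_x (outgoing_wave t (cutoff n%:R F) (norm3 x) * phi x)) @ \oo -->
  \int[mu]_x (outgoing_wave t F (norm3 x) * phi x).
Proof.
move=> iphi; apply: (@cvg_pairing _ _ mu _ _ _ B) => //.
- move=> n; apply: measurable_radial_profile.
  by apply: (@measurable_outgoing_wave _ _ R' (fun=> t) id) => //; exact: measurable_cutoff.
- by move=> n x; apply: outgoing_wave_bounded => // r; exact: cutoff_bounded.
- move=> x; exists (Num.truncn (norm3 x)).+1 => n xn.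
  rewrite /outgoing_wave; case: ifP => // _; congr (_ * _); rewrite /cutoff ifT//.
  by rewrite (le_lt_trans (_ : _ <= norm3 x)) ?gerBl// (lt_le_trans (truncnS_gt _))// ler_nat.
Qed.

(** The weak form of the statement that sin(t sqrt(-Delta))/sqrt(-Delta) maps F(|x|) to its
    [sphere_mean], now for profiles that need not decay. *)
Lemma sphere_mean_pairing :
  \int[mu]_x (F (norm3 x) * Fph 0 (fun xi => sin_symbol t xi * psi xi) x) =
  \int[mu]_x (sphere_mean t F (norm3 x) * Fph 0 psi x).
Proof.
have rp := schwartz_rapid sp.
have rs := schwartz_rapid (schwartz_sin_symbol t0 sp).
have H1 := cvg_cutoff (integrable_Fph 0 (schwartz_sin_symbol t0 sp)).
have H2 := cvg_sphere_mean_cutoff (integrable_Fph 0 sp).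
apply: (cvg_seq_unique H1 H2) => n.
have mc := @measurable_cutoff R n%:R F mF.
have cB r : `|cutoff n%:R F r| <= B by exact: cutoff_bounded.
have c0 (r : R) : n%:R <= r -> cutoff n%:R F r = 0 by exact: cutoff_eq0.
have mW := measurable_sphere_mean1 t mc.
have WB r : `|sphere_mean t (cutoff n%:R F) r| <= t * B by exact: sphere_mean_bounded.
have W0 r : n%:R + t <= r -> sphere_mean t (cutoff n%:R F) r = 0.
  exact: (sphere_mean_support c0).
rewrite (pair_Fph mW WB W0 rp).2; apply: (etrans (pair_Fph mc cB c0 rs).2).
apply: eq_Rintegral => xi _.
by rewrite -(sphere_mean_transform _ mc cB c0 t0) mulrA (mulrC (psi xi)).
Qed.

(** The weak form of the explicit free evolution: the second summand is the contribution of the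
    outgoing velocity, transferred to the test function. *)
Lemma outgoing_wave_pairing :
  \int[mu]_x (F (norm3 x) * Fph 0 (fun xi => cos_symbol t xi * psi xi) x) +
  \int[mu]_x (F (norm3 x) * outgoing_test (Fph 0 (fun xi => sin_symbol t xi * psi xi)) x) =
  \int[mu]_x (outgoing_wave t F (norm3 x) * Fph 0 psi x).
Proof.
have rp := schwartz_rapid sp.
have rs := schwartz_rapid (schwartz_sin_symbol t0 sp).
have rcs := schwartz_rapid (schwartz_cos_symbol t0 sp).
have H1 := cvg_cutoff (integrable_Fph 0 (schwartz_cos_symbol t0 sp)).
have H1' := cvg_cutoff (integrable_outgoing_test 0 (schwartz_sin_symbol t0 sp)).
have H2 := cvg_outgoing_wave_cutoff (integrable_Fph 0 sp).
apply: (cvg_seq_sum_unique H1 H1' H2) => n.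
have mc := @measurable_cutoff R n%:R F mF.
have cB r : `|cutoff n%:R F r| <= B by exact: cutoff_bounded.
have c0 (r : R) : n%:R <= r -> cutoff n%:R F r = 0 by exact: cutoff_eq0.
have mW : measurable_fun setT (outgoing_wave t (cutoff n%:R F)).
  exact: (@measurable_outgoing_wave _ _ R' (fun=> t) id).
have WB r : `|outgoing_wave t (cutoff n%:R F) r| <= B by exact: outgoing_wave_bounded.
have W0 r : n%:R + t <= r -> outgoing_wave t (cutoff n%:R F) r = 0.
  by move=> Ar; rewrite /outgoing_wave c0 ?mulr0 ?lerBrDr//; case: ifP.
rewrite (pair_Fph mW WB W0 rp).2.
have [i1 E1] := pair_Fph mc cB c0 rcs; have [i2 E2] := pair_outgoing_test mc cB c0 rs.
apply: (etrans (congr2 +%R E1 E2)).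
rewrite -(RintegralD measurableT i1 i2).
apply: eq_Rintegral => xi _.
rewrite -(outgoing_wave_transform _ mc cB c0 t0); ring.
Qed.

End removing_the_cutoff.

End wave_identities.

(** * Odd pairings and outgoing data *)

Section odd_pairings.
Context {R : realType}.
Local Notation leb := (@lebesgue_measure R).
Local Notation R3 := (R * R * R)%type.
Local Notation mu := (lebesgue3 R).
Local Notation R' := (measurableTypeR R).

Lemma preserves_opp_snd d (T : measurableType d)
    (m : {sigma_finite_measure set T -> \bar R}) :
  preserves (m \x leb)%E (fun p => (p.1, - p.2)).
Proof.
split; first by apply: measurable_fun_pair => //=; exact: measurableT_comp.
move=> A mA; rewrite /product_measure1; apply: eq_integral => x _ /=.
rewrite -[RHS]lebesgue_measureN; last exact: measurable_xsection.
congr (leb _); apply/seteqP; split=> y; rewrite /= /xsection/= !inE.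
Qed.

Lemma preserves_opp3 : preserves mu (fun x => - x).
Proof.
have N3 : preserves mu (fun x : R3 => (x.1, - x.2)) by exact: preserves_opp_snd.
have N2 := preserves_comp (@preserves_snd_swap R) (preserves_comp N3 (@preserves_snd_swap R)).
have N1 := preserves_comp (@preserves_fst_swap R) (preserves_comp N2 (@preserves_fst_swap R)).
have := preserves_comp N3 (preserves_comp N2 N1).
by congr (preserves _ _); apply/funext => -[[a b] c].
Qed.

Lemma Rintegral_odd (f : R3 -> R) : mu.-integrable setT (EFin \o f) ->
  (forall x, f (- x) = - f x) -> \int[mu]_x f x = 0.
Proof.
move=> fi fN; have mf := integrable_measurable_fun fi.
have := Rintegral_preserves preserves_opp3 mf.
under eq_Rintegral do rewrite fN.
rewrite RintegralN// => /eqP; rewrite eq_sym -addr_eq0 -mulr2n mulrn_eq0/= => /eqP.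
by [].
Qed.

Lemma norm3N (x : R3) : norm3 (- x) = norm3 x.
Proof. by rewrite /norm3 /dot3/= !mulrNN. Qed.

Lemma dot3N (x y : R3) : dot3 (- x) y = - dot3 x y.
Proof. by rewrite /dot3/=; ring. Qed.

Lemma FphNpihalfE (chi : R3 -> R) :
  Fph (- (pi / 2)) chi = fun x => \int[mu]_xi (sin (dot3 x xi) * chi xi).
Proof.
apply/funext => x; rewrite /Fph; apply: eq_Rintegral => xi _; congr (_ * _).
by rewrite cosB sin_pihalf cos_pihalf mulr0 add0r mulr1.
Qed.

Lemma FphNpihalf_odd (chi : R3 -> R) x : rapid chi ->
  Fph (- (pi / 2)) chi (- x) = - Fph (- (pi / 2)) chi x.
Proof.
move=> rc; rewrite /Fph -RintegralN; last by apply: integrable_rapid; exact: rapid_wave.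
apply: eq_Rintegral => xi _; rewrite dot3N -[RHS]mulNr; congr (_ * _).
by rewrite !cosB sin_pihalf cos_pihalf !mulr0 !add0r !mulr1 sinN.
Qed.

(** The sine transform is odd, and both the radial derivative and division by |x| preserve
    parity. *)
Lemma outgoing_test_odd (chi : R3 -> R) x : rapid chi ->
  outgoing_test (Fph (- (pi / 2)) chi) (- x) = - outgoing_test (Fph (- (pi / 2)) chi) x.
Proof.
move=> rc; rewrite /outgoing_test FphNpihalf_odd// norm3N opprD mulNr; congr (_ - _).
rewrite !rderiv_Fph// norm3N -[RHS]mulrN -RintegralN; last first.
  by apply: integrable_rapid; apply: rapid_wave; exact: rapid_dot.
congr (_ * _); apply: eq_Rintegral => xi _; rewrite dot3N addNr !addr0 cosN; ring.
Qed.

Lemma integrable_radial_mul (F : R -> R) (B : R) (phi : R3 -> R) : measurable_fun setT F ->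
  (forall r, `|F r| <= B) -> mu.-integrable setT (EFin \o phi) ->
  mu.-integrable setT (EFin \o (fun x => F (norm3 x) * phi x)).
Proof.
move=> mF FB; apply: (@integrable_bounded_mul _ _ _ mu _ _ B) => [|x]; last exact: FB.
exact: measurable_radial_profile.
Qed.

Lemma radial_odd_pairing (F : R -> R) (B : R) (phi : R3 -> R) : measurable_fun setT F ->
  (forall r, `|F r| <= B) -> mu.-integrable setT (EFin \o phi) ->
  (forall x, phi (- x) = - phi x) -> \int[mu]_x (F (norm3 x) * phi x) = 0.
Proof.
move=> mF FB iphi phiN; apply: Rintegral_odd; last first.
  by move=> x; rewrite norm3N phiN mulrN.
exact: integrable_radial_mul FB iphi.
Qed.

End odd_pairings.

(** * Pairings of the initial data with test functions *)

Section outgoing_data.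
Context {R : realType}.
Local Notation R3 := (R * R * R)%type.
Local Notation mu := (lebesgue3 R).
Variables (u0 : R3 -> R) (u1 : tdistr R) (g : R -> R) (M : R).
Hypotheses (mu0 : measurable_fun setT u0) (mg : measurable_fun setT g)
  (gM : forall r, `|g r| <= M) (u0E : {ae mu, forall x, u0 x = g (norm3 x)})
  (out : outgoing u0 u1).

Lemma radial_data_pairing (phi : R3 -> R) : measurable_fun setT phi ->
  \int[mu]_x (u0 x * phi x) = \int[mu]_x (g (norm3 x) * phi x).
Proof.
move=> mphi; rewrite /Rintegral; congr fine; apply: ae_eq_integral => //.
- by apply/measurable_EFinP; exact: measurable_funM.
- by apply/measurable_EFinP; apply: measurable_funM => //; exact: measurable_radial_profile.
- have [N [mN N0 sN]] := u0E; exists N; split=> // x /= h.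
  by apply: sN => /= E; apply: h => _; rewrite E.
Qed.

(** The outgoing condition applies because the transform is Schwartz. Splitting the integrals needs
    phi_r and phi/r to be integrable separately, 1/r being integrable near the origin. *)
Lemma outgoing_data_pairing theta chi : schwartz chi ->
  u1 (Fph theta chi) = \int[mu]_x (g (norm3 x) * outgoing_test (Fph theta chi) x).
Proof.
move=> sc; set phi := Fph theta chi.
have sphi : schwartz phi by exact: schwartz_Fph.
have i1 := integrable_rderiv_Fph theta sc.
have i2 : mu.-integrable setT (EFin \o (fun x => phi x / norm3 x)).
  have := integrable_rapid_over_norm (schwartz_rapid sphi).
  by congr (mu.-integrable _ (EFin \o _)); apply/funext => x; rewrite mulrC.
have m1 := integrable_measurable_fun i1.
have m2 := integrable_measurable_fun i2.
have j1 := integrable_radial_mul mg gM i1.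
have j2 := integrable_radial_mul mg gM i2.
have i22 : mu.-integrable setT (EFin \o (fun x => 2 * (phi x / norm3 x))).
  exact: (integrableZl measurableT _ i2).
have j22 := integrable_radial_mul mg gM i22.
rewrite out// /distr_rderiv /distr_over_r opprK.
transitivity (\int[mu]_x (g (norm3 x) * (rderiv phi x + 2 * (phi x / norm3 x))) -
  \int[mu]_x (g (norm3 x) * (phi x / norm3 x))).
  congr (_ - _).
    rewrite -radial_data_pairing; last by apply: measurable_funD => //; exact: measurable_funM.
    by apply: eq_Rintegral => x _; congr (_ * (_ + _)); ring.
  by rewrite -radial_data_pairing//; apply: eq_Rintegral => x _; ring.
have j3 := integrableD measurableT j1 j22.
rewrite -RintegralB//; first by apply: eq_Rintegral => x _; rewrite /outgoing_test; ring.
move: j3; congr (mu.-integrable _ _); apply/funext => x /=; rewrite -EFinD; congr EFin; ring.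
Qed.

End outgoing_data.

(** * Picard iteration for the radial profile *)

Section picard_iteration.
Context {R : realType}.
Local Notation leb := (@lebesgue_measure R).
Local Notation R' := (measurableTypeR R).

Definition power_nonlin (N : nat) (a : R) : R := `|a| ^+ N * a.

Lemma measurable_power_nonlin d (T : measurableType d) N (f : T -> R) : measurable_fun setT f ->
  measurable_fun setT (fun x => power_nonlin N (f x)).
Proof.
move=> mf; apply: measurable_funM => //; apply: measurable_funX.
exact: (measurableT_comp (@normr_measurable R setT)).
Qed.

Lemma power_nonlin_bounded N (a B : R) : `|a| <= B -> `|power_nonlin N a| <= B ^+ N.+1.
Proof.
by move=> aB; rewrite normrM normrX normr_id -exprSr lerXn2r ?nnegrE// (le_trans _ aB).
Qed.

(** Induction through |a|(P(a) - P(b)) + (|a| - |b|)P(b), where P is the nonlinearity of one degree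
    less. Each step adds one term B^(N+1)|a - b|, whence the factor N + 1. *)
Lemma power_nonlin_lipschitz N (a b B : R) : `|a| <= B -> `|b| <= B ->
  `|power_nonlin N a - power_nonlin N b| <= N.+1%:R * B ^+ N * `|a - b|.
Proof.
move=> aB bB; have B0 : 0 <= B by exact: le_trans aB.
elim: N => [|N IH]; first by rewrite /power_nonlin !expr0 !mul1r.
rewrite (_ : _ - _ = `|a| * (power_nonlin N a - power_nonlin N b) +
  (`|a| - `|b|) * power_nonlin N b); last by rewrite /power_nonlin !exprS; ring.
rewrite (le_trans (ler_normD _ _))//.
rewrite (_ : N.+2%:R * B ^+ N.+1 * `|a - b| =
  B * (N.+1%:R * B ^+ N * `|a - b|) + `|a - b| * B ^+ N.+1); last first.
  by rewrite -(natr1 N.+1) exprS; ring.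
rewrite lerD// normrM; first by rewrite normr_id ler_pM.
by rewrite ler_pM// ?power_nonlin_bounded// ler_dist_dist.
Qed.

Section time_integral.
(** The restriction to [0, t] sits inside the integrand, so that Fubini and measurability in
    parameters apply to functions on the whole line; [time_integralE] returns to the interval. *)
Definition time_integral (t : R) (h : R -> R) : R :=
  \int[leb]_s (if (0 <= s) && (s <= t) then h s else 0).

Variables (t D : R) (h : R' -> R).
Hypotheses (mh : measurable_fun setT h) (hD : forall s, 0 <= s -> s <= t -> `|h s| <= D).

Lemma measurable_time_indic (k : R' -> R) : measurable_fun setT k ->
  measurable_fun setT (fun s : R' => if (0 <= (s : R)) && ((s : R) <= t) then k s else 0).
Proof.
move=> mk; apply: measurable_fun_ifT => //; apply: measurable_and; exact: measurable_fun_ler.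
Qed.

Lemma integrable_time_indic :
  leb.-integrable setT (EFin \o (fun s => if (0 <= s) && (s <= t) then h s else 0)).
Proof.
apply: (@integrable_indic_dominated _ R' _ leb _ `[0, t]%classic D) => //.
- by rewrite /= lebesgue_measure_itv/=; case: ifP => _; rewrite ?ltry// -EFinB ltry.
- exact: measurable_time_indic.
- by move=> s /=; rewrite in_itv/= => /andP[s0 st]; rewrite s0 st hD.
- by move=> s /= /negP; rewrite in_itv/= => /negbTE ->.
Qed.

Hypothesis t0 : 0 <= t.

Lemma Rintegral_time_indic (c : R) :
  \int[leb]_s (if (0 <= s) && (s <= t) then c else 0) = t * c.
Proof.
transitivity (\int[leb]_(s in `[0, t]) c).
  rewrite [RHS]Rintegral_mkcond; apply: eq_Rintegral => s _.
  by rewrite patchE mem_setE in_itv.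
rewrite Rintegral_cst//= lebesgue_measure_itv/= lte_fin mulrC; congr (_ * _).
by move: t0; rewrite le_eqVlt => /orP[/eqP <-|->]; rewrite ?ltxx//= subr0.
Qed.

Lemma time_integral_bounded : `|time_integral t h| <= t * D.
Proof.
have D0 : 0 <= D by exact: le_trans (hD (lexx 0) t0).
rewrite -Rintegral_time_indic; apply: le_normr_Rintegral_dominated.
- apply: (@integrable_indic_dominated _ R' _ leb _ `[0, t]%classic D) => //.
  + by rewrite /= lebesgue_measure_itv/=; case: ifP => _; rewrite ?ltry// -EFinB ltry.
  + exact: measurable_time_indic.
  + by move=> s /=; rewrite in_itv/= => /andP[s0 st]; rewrite s0 st ger0_norm.
  + by move=> s /= /negP; rewrite in_itv/= => /negbTE ->.
- exact: measurable_time_indic.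
- by move=> s; case: ifP => [/andP[s0 st]|_]; [exact: hD|rewrite normr0].
Qed.

End time_integral.

Lemma time_integralB (t D1 D2 : R) (h1 h2 : R -> R) :
  measurable_fun setT h1 -> measurable_fun setT h2 ->
  (forall s, 0 <= s -> s <= t -> `|h1 s| <= D1) -> (forall s, 0 <= s -> s <= t -> `|h2 s| <= D2) ->
  time_integral t h1 - time_integral t h2 = time_integral t (fun s => h1 s - h2 s).
Proof.
move=> m1 m2 b1 b2; have i1 := integrable_time_indic m1 b1; have i2 := integrable_time_indic m2 b2.
rewrite /time_integral -RintegralB//; apply: eq_Rintegral => s _.
by case: ifP => _; rewrite ?subr0.
Qed.

Section fixed_point.
Variables (N : nat) (sg : bool) (g : R -> R) (M : R) (J : R -> bool).
Hypotheses (mg : measurable_fun setT g) (gM : forall r, `|g r| <= M)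
  (mJ : measurable_fun setT (J : R' -> bool)) (J0 : forall t, J t -> 0 <= t)
  (Jball : forall t, J t -> t * (t * (2 * M) ^+ N.+1) <= M)
  (Jcontr : forall t, J t -> t * (t * (N.+1%:R * (2 * M) ^+ N)) <= 2^-1).

(** Radial profile at radius r of the Duhamel integrand, that is, of sin((t - s)
    sqrt(-Delta))/sqrt(-Delta) applied to |u(s)|^N u(s). *)
Definition source (f : R' * R' -> R) (t r s : R) : R :=
  sphere_mean (t - s) (fun rho => power_nonlin N (f (s, rho))) r.

(** The value 0 outside the admissible times [J] lets the bounds below hold at every point of the
    plane, so suprema are taken over all arguments. *)
Definition picard (f : R' * R' -> R) (z : R' * R') : R :=
  if J z.1 then outgoing_wave z.1 g z.2 - (-1) ^+ sg * time_integral z.1 (source f z.1 z.2)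
  else 0.

Lemma M_ge0 : 0 <= M. Proof. exact: le_trans (gM 0). Qed.

Lemma measurable_profile_at (f : R' * R' -> R) (s : R') : measurable_fun setT f ->
  measurable_fun setT (fun rho : R' => f (s, rho)).
Proof. by move=> mf; apply: (measurableT_comp mf); exact: measurable_fun_pair. Qed.

Lemma measurable_source (f : R' * R' -> R) : measurable_fun setT f ->
  measurable_fun setT (fun z : R' * R' * R' => source f z.1.1 z.1.2 z.2).
Proof.
move=> mf; apply: (@measurable_sphere_mean _ _ (R' * R' * R')%type
  (fun z => z.1.1 - z.2) (fun z => z.1.2)
  (fun w : R' * R' * R' * R' => power_nonlin N (f (w.1.2, w.2)))).
- apply: measurable_funB => //; exact: (measurableT_comp measurable_fst).
- exact: (measurableT_comp measurable_snd).
- apply: measurable_power_nonlin; apply: (measurableT_comp mf).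
  by apply: measurable_fun_pair => //; exact: (measurableT_comp measurable_snd).
Qed.

Lemma measurable_source1 (f : R' * R' -> R) (t r : R') : measurable_fun setT f ->
  measurable_fun setT (fun s : R' => source f t r s).
Proof.
move=> mf.
have m3 : measurable_fun setT (fun s : R' => (t, r, s) : R' * R' * R').
  by apply: measurable_fun_pair.
exact: (measurableT_comp (measurable_source mf) m3).
Qed.

Lemma source_bounded (f : R' * R' -> R) (B : R) (t r s : R) : measurable_fun setT f ->
  (forall z, `|f z| <= B) -> 0 <= s -> s <= t -> `|source f t r s| <= t * B ^+ N.+1.
Proof.
move=> mf fB s0 st; have B0 : 0 <= B by exact: le_trans (fB (0, 0)).
apply: (@le_trans _ _ ((t - s) * B ^+ N.+1)); last by rewrite ler_wpM2r ?exprn_ge0// gerBl.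
apply: sphere_mean_bounded; rewrite ?subr_ge0//.
  by apply: measurable_power_nonlin; exact: measurable_profile_at.
by move=> rho; exact: power_nonlin_bounded.
Qed.

Lemma measurable_picard (f : R' * R' -> R) : measurable_fun setT f ->
  measurable_fun setT (picard f).
Proof.
move=> mf; apply: measurable_fun_ifT => //; first exact: (measurableT_comp mJ).
apply: measurable_funB; first exact: measurable_outgoing_wave.
apply: measurable_funM => //.
apply: (@measurable_fun_Rintegral _ _ _ _ _ leb (fun w : R' * R' * R' =>
  if (0 <= (w.2 : R)) && ((w.2 : R) <= w.1.1) then source f w.1.1 w.1.2 w.2 else 0)).
apply: measurable_fun_ifT => //; last exact: measurable_source.
apply: measurable_and; apply: measurable_fun_ler => //.
exact: (measurableT_comp measurable_fst).
Qed.

(** The free part is at most M. The Duhamel part gains one factor t from the spherical mean and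
    another from the time integral, and [Jball] makes it at most M as well. *)
Lemma picard_bounded (f : R' * R' -> R) z : measurable_fun setT f ->
  (forall z, `|f z| <= 2 * M) -> `|picard f z| <= 2 * M.
Proof.
move=> mf fM; rewrite /picard; have [Jt|_] := boolP (J z.1); last first.
  by rewrite normr0 mulr_ge0// M_ge0.
have t0 := J0 Jt.
rewrite (le_trans (ler_normB _ _))// mulr_natl mulr2n lerD//; first exact: outgoing_wave_bounded.
rewrite normrM normrX normrN1 expr1n mul1r (le_trans _ (Jball Jt))//.
apply: time_integral_bounded => //; first exact: measurable_source1.
by move=> s s0 st; exact: source_bounded.
Qed.

(** The Lipschitz constant of the nonlinearity on the ball of radius 2M, times the two factors t, is
    at most 1/2 by [Jcontr]. *)
Lemma picard_contraction (f h : R' * R' -> R) (delta : R) z :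
  measurable_fun setT f -> measurable_fun setT h ->
  (forall z, `|f z| <= 2 * M) -> (forall z, `|h z| <= 2 * M) ->
  (forall z, `|f z - h z| <= delta) -> `|picard f z - picard h z| <= delta / 2.
Proof.
move=> mf mh fM hM fh; have d0 : 0 <= delta by exact: le_trans (fh (0, 0)).
rewrite /picard; have [Jt|_] := boolP (J z.1); last by rewrite subrr normr0 divr_ge0.
have t0 := J0 Jt.
rewrite (_ : forall a b c : R, a - b - (a - c) = c - b); last by move=> a b c; ring.
rewrite -mulrBr normrM normrX normrN1 expr1n mul1r distrC.
rewrite (@time_integralB _ (z.1 * (2 * M) ^+ N.+1) (z.1 * (2 * M) ^+ N.+1)); last 4 first.
- exact: measurable_source1.
- exact: measurable_source1.
- by move=> s s0 st; exact: source_bounded.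
- by move=> s s0 st; exact: source_bounded.
apply: (@le_trans _ _ (z.1 * (z.1 * (N.+1%:R * (2 * M) ^+ N * delta)))); last first.
  by rewrite !mulrA (mulrC delta) ler_wpM2r// -!mulrA Jcontr.
apply: time_integral_bounded => //.
  by apply: measurable_funB; exact: measurable_source1.
move=> s s0 st; rewrite /source (@sphere_meanB _ _ ((2 * M) ^+ N.+1)) ?subr_ge0//; last 4 first.
- by apply: measurable_power_nonlin; exact: measurable_profile_at.
- by apply: measurable_power_nonlin; exact: measurable_profile_at.
- by move=> r; exact: power_nonlin_bounded.
- by move=> r; exact: power_nonlin_bounded.
have c0 : 0 <= N.+1%:R * (2 * M) ^+ N * delta.
  by rewrite !mulr_ge0// exprn_ge0// mulr_ge0// M_ge0.
apply: (@le_trans _ _ ((z.1 - s) * (N.+1%:R * (2 * M) ^+ N * delta))); last first.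
  by rewrite ler_wpM2r// gerBl.
apply: sphere_mean_bounded; rewrite ?subr_ge0//.
  by apply: measurable_funB; apply: measurable_power_nonlin; exact: measurable_profile_at.
move=> r; rewrite (le_trans (power_nonlin_lipschitz _ (fM _) (hM _)))//.
by rewrite ler_wpM2l// mulr_ge0// exprn_ge0// mulr_ge0// M_ge0.
Qed.

Definition picard_iterate (n : nat) : R' * R' -> R := iter n picard (fun=> 0).

Lemma picard_iterate_spec n :
  [/\ measurable_fun setT (picard_iterate n), forall z, `|picard_iterate n z| <= 2 * M &
      forall z, `|picard_iterate n.+1 z - picard_iterate n z| <= 2 * M * 2^-1 ^+ n].
Proof.
elim: n => [|n [mf fM fd]].
  have H : `|(0 : R)| <= 2 * M by rewrite normr0 mulr_ge0// M_ge0.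
  split; [exact: measurable_cst|by move=> z; exact: H|] => z; rewrite /picard_iterate/= expr0 mulr1 subr0; exact: picard_bounded.
have mf1 := measurable_picard mf.
have fM1 z : `|picard_iterate n.+1 z| <= 2 * M by exact: picard_bounded.
split => // z; rewrite exprSr mulrA; exact: picard_contraction.
Qed.

(** The increments from step n on sum to at most 2A/2^n. Lowering and raising [u] by this tail gives
    a nondecreasing and a nonincreasing sequence with the same limit, which yields both convergence
    and the rate. *)
Lemma cvg_geometric_rate (u : nat -> R) (A B : R) : 0 <= A -> (forall n, `|u n| <= B) ->
  (forall n, `|u n.+1 - u n| <= A * 2^-1 ^+ n) ->
  u @ \oo --> lim (u @ \oo) /\ forall n, `|u n - lim (u @ \oo)| <= 2 * A * 2^-1 ^+ n.
Proof.
move=> A0 uB ud.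
have half0 : (fun n : nat => 2 * A * 2^-1 ^+ n : R) @ \oo --> (0 : R).
  rewrite -(mulr0 (2 * A)); apply: cvgMr; apply: cvg_expr.
  by rewrite ger0_norm// invf_lt1 ?ltr1n.
have e0 n : 0 <= 2 * A * 2^-1 ^+ n by rewrite !mulr_ge0// exprn_ge0.
have eS n : 2 * A * 2^-1 ^+ n.+1 = A * 2^-1 ^+ n.
  by rewrite exprS; field.
have e2 n : 2 * A * 2^-1 ^+ n = A * 2^-1 ^+ n + A * 2^-1 ^+ n by ring.
pose a n := u n - 2 * A * 2^-1 ^+ n.
pose b n := u n + 2 * A * 2^-1 ^+ n.
have aS : nondecreasing_seq a.
  apply/nondecreasing_seqP => n; rewrite /a eS e2.
  by have := ud n; rewrite ler_norml => /andP[h1 h2]; lra.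
have bS : nonincreasing_seq b.
  apply/nonincreasing_seqP => n; rewrite /b eS e2.
  by have := ud n; rewrite ler_norml => /andP[h1 h2]; lra.
have ca : cvgn a.
  apply: nondecreasing_is_cvgn => //; exists B => _ [n _ <-].
  by rewrite /a (le_trans _ (le_trans (ler_norm _) (uB n)))// gerBl.
have ca' : a @ \oo --> lim (a @ \oo) by [].
have cu : u @ \oo --> lim (a @ \oo).
  rewrite -[X in _ --> X]addr0.
  have -> : u = fun n => a n + 2 * A * 2^-1 ^+ n by apply/funext => n; rewrite /a subrK.
  exact: cvgD.
have limE : lim (u @ \oo) = lim (a @ \oo) by apply/cvg_lim.
have cb : b @ \oo --> lim (a @ \oo).
  by rewrite -[X in _ --> X]addr0; exact: cvgD.
rewrite limE; split => // n.
have h1 : a n <= lim (a @ \oo) by exact: nondecreasing_cvgn_le.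
have h2 : lim (a @ \oo) <= b n.
  have -> : lim (a @ \oo) = lim (b @ \oo) by apply/esym/cvg_lim.
  apply: nonincreasing_cvgn_ge => //; apply/cvg_ex; by exists (lim (a @ \oo)).
by move: h1 h2; rewrite /a /b ler_norml => h1 h2; apply/andP; split; lra.
Qed.

(** The limit is taken at every point and inherits measurability and the bound from the iterates.
    The fixed-point equation then holds everywhere, hence on each single time slice. *)
Lemma picard_fixed_point : exists f : R' * R' -> R,
  [/\ measurable_fun setT f, forall z, `|f z| <= 2 * M & forall z, f z = picard f z].
Proof.
have M2 : 0 <= 2 * M by rewrite mulr_ge0// M_ge0.
pose f z := lim ((fun n => picard_iterate n z) @ \oo).
have H z : (fun n => picard_iterate n z) @ \oo --> f z /\
    forall n, `|picard_iterate n z - f z| <= 2 * (2 * M) * 2^-1 ^+ n.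
  by apply: cvg_geometric_rate => // n; have [_ h1 h2] := picard_iterate_spec n.
have mf : measurable_fun setT f.
  apply: (@measurable_fun_cvg _ _ _ _ picard_iterate).
    by move=> n; have [] := picard_iterate_spec n.
  by move=> z _; exact: (H z).1.
have fM z : `|f z| <= 2 * M.
  have fin n : - (2 * M) <= picard_iterate n z <= 2 * M.
    by have [_ h _] := picard_iterate_spec n; rewrite -ler_norml.
  have cz : cvgn (fun n => picard_iterate n z) by apply/cvg_ex; exists (f z); exact: (H z).1.
  rewrite ler_norml; apply/andP; split.
    by apply: limr_ge => //; apply: nearW => n; have /andP[] := fin n.
  by apply: limr_le => //; apply: nearW => n; have /andP[] := fin n.
exists f; split => // z.
(* Both terms of the triangle inequality are half of the right-hand side: the rate at n + 1, and the
   contraction applied to the rate at n. *)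
have e n : `|f z - picard f z| <= 2 * (2 * M) * 2^-1 ^+ n.
  have [mn nM _] := picard_iterate_spec n.
  have h1 := (H z).2 n.+1.
  have h2 : `|picard_iterate n.+1 z - picard f z| <= 2 * (2 * M) * 2^-1 ^+ n / 2.
    by apply: picard_contraction => // w; exact: (H w).2.
  rewrite distrC in h1.
  have := ler_normD (f z - picard_iterate n.+1 z) (picard_iterate n.+1 z - picard f z).
  rewrite addrA subrK => /le_trans; apply.
  rewrite (le_trans (lerD h1 h2))// exprS le_eqVlt; apply/orP; left; apply/eqP; by field.
apply/eqP; rewrite -subr_eq0 -normr_eq0 eq_le normr_ge0 andbT.
have half0 : (fun n : nat => 2 * (2 * M) * 2^-1 ^+ n : R) @ \oo --> (0 : R).
  rewrite -(mulr0 (2 * (2 * M))); apply: cvgMr; apply: cvg_expr.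
  by rewrite ger0_norm// invf_lt1 ?ltr1n.
rewrite -(cvg_lim _ half0)//; apply: limr_ge; first by apply/cvg_ex; exists 0.
by apply: nearW.
Qed.

End fixed_point.
End picard_iteration.

(** * The mild solution *)

Section essential_bounds.
Context d (T : measurableType d) (R : realType) (m : {measure set T -> \bar R}).
Implicit Type f : T -> R.

Lemma Lnorm_infty_le f (c : R) : 0 <= c -> (forall x, `|f x| <= c) ->
  ('N[m]_+oo [EFin \o f] <= c%:E)%E.
Proof.
move=> c0 fc; rewrite unlock /=; case: ifP => _; last by rewrite lee_fin.
by apply/ess_supP; apply: aeW => x; rewrite /= lee_fin.
Qed.

Lemma Lfun_infty_bounded f (c : R) : measurable_fun setT f -> (forall x, `|f x| <= c) ->
  f \in Lfun m +oo%E.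
Proof.
move=> mf fc; have [c0|c0] := leP 0 c.
  apply/andP; split; rewrite inE//; apply: (le_lt_trans (Lnorm_infty_le c0 fc)).
  exact: ltry.
have fc0 x : `|f x| <= 0 by rewrite (le_trans (fc x))// ltW.
apply/andP; split; rewrite inE//; apply: (le_lt_trans (Lnorm_infty_le (lexx 0) fc0)).
exact: ltry.
Qed.

Lemma Lfun_infty_ae_le f : f \in Lfun m +oo%E ->
  {ae m, forall x, `|f x| <= fine ('N[m]_+oo [EFin \o f])%E}.
Proof.
move=> /andP[_]; rewrite inE /finite_norm/= => fin.
have fN : ('N[m]_+oo [EFin \o f])%E \is a fin_num by rewrite ge0_fin_numE ?Lnorm_ge0.
have [N0 | mT0] := boolP (0 < m setT)%E.
  suff : {ae m, forall x, (`|(f x)%:E| <= 'N[m]_+oo [EFin \o f])%E}.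
    move=> [N [mN mN0 sN]]; exists N; split => // x /= h; apply: sN => /= E; apply: h.
    by rewrite -lee_fin fineK.
  rewrite unlock /= N0; exact: ess_sup_ge.
(* If the whole space is null, then any almost-everywhere statement holds with [setT] as the
   exceptional set. *)
exists setT; split => //; apply/eqP; rewrite eq_le measure_ge0 andbT.
by rewrite leNgt.
Qed.

End essential_bounds.

Section time_exchange.
Context {R : realType}.
Local Notation leb := (@lebesgue_measure R).
Local Notation R3 := (R * R * R)%type.
Local Notation mu := (lebesgue3 R).
Local Notation R' := (measurableTypeR R).

Lemma time_integralE (t : R) (h : R -> R) :
  time_integral t h = \int[leb]_(s in `[0, t]) h s.
Proof.
rewrite [RHS]Rintegral_mkcond; apply: eq_Rintegral => s _.
by rewrite patchE mem_setE in_itv.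
Qed.

Variables (N : nat) (f : R' * R' -> R) (B t : R) (phi : R3 -> R).
Hypotheses (mf : measurable_fun setT f) (fB : forall z, `|f z| <= B) (t0 : 0 <= t)
  (iphi : mu.-integrable setT (EFin \o phi)).

(** Fubini on [0, t] times space: the source is bounded by the constant [D], so [D] times |phi| is a
    majorant of product form. *)
Lemma time_integral_pairing :
  mu.-integrable setT (EFin \o (fun x => time_integral t (source N f t (norm3 x)) * phi x)) /\
  \int[mu]_x (time_integral t (source N f t (norm3 x)) * phi x) =
  time_integral t (fun s => \int[mu]_x (source N f t (norm3 x) s * phi x)).
Proof.
have B0 : 0 <= B by exact: le_trans (fB (0, 0)).
pose D := t * B ^+ N.+1.
have D0 : 0 <= D by rewrite mulr_ge0// exprn_ge0.
pose k (z : R' * R3) : R :=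
  if (0 <= (z.1 : R)) && ((z.1 : R) <= t) then source N f t (norm3 z.2) z.1 * phi z.2 else 0.
have mphi := integrable_measurable_fun iphi.
have mn : measurable_fun setT (fun z : R' * R3 => norm3 z.2).
  exact: (measurableT_comp measurable_norm3).
have mk : measurable_fun setT k.
  apply: measurable_fun_ifT => //.
    by apply: measurable_and; exact: measurable_fun_ler.
  apply: measurable_funM; last exact: (measurableT_comp mphi).
  have m3 : measurable_fun setT (fun z : R' * R3 => (t, norm3 z.2, z.1) : R' * R' * R').
    by apply: measurable_fun_pair => //; exact: measurable_fun_pair.
  exact: (measurableT_comp (measurable_source N mf) m3).
have iD : leb.-integrable setT (EFin \o (fun s : R => if (0 <= s) && (s <= t) then D else 0)).
  by apply: (@integrable_time_indic _ _ D) => // s _ _; rewrite ger0_norm.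
have ia := integrable_normr iphi.
have ik : (leb \x mu)%E.-integrable setT (EFin \o k).
  apply: (@integrable_tensor _ _ _ _ _ leb mu k _ _ iD ia) => // -[s x].
  rewrite /k/=; case: ifP => [/andP[s0 st]|_]; last by rewrite normr0 mul0r.
  by rewrite normrM ler_wpM2r//; exact: source_bounded.
have kE x : \int[leb]_s k (s, x) = time_integral t (source N f t (norm3 x)) * phi x.
  rewrite mulrC -RintegralZl//; last first.
    apply: (@integrable_time_indic _ _ D); first exact: measurable_source1.
    by move=> s s0 st; exact: source_bounded.
  by apply: eq_Rintegral => s _; rewrite /k/=; case: ifP => _; rewrite ?mulr0// mulrC.
split.
  have := integrable_Rintegral1 (integrable_swap ik); congr (mu.-integrable _ (EFin \o _)).
  by apply/funext => x; rewrite -kE.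
transitivity (\int[mu]_x \int[leb]_s k (s, x)).
  by apply: eq_Rintegral => x _; rewrite kE.
rewrite -(Rintegral_exchange ik); apply: eq_Rintegral => s _; rewrite /k/=.
by case: ifP => // _; rewrite /Rintegral integral0.
Qed.

End time_exchange.

(** * The Duhamel formula for the fixed point *)

Section duhamel_formula.
Context {R : realType}.
Local Notation leb := (@lebesgue_measure R).
Local Notation R3 := (R * R * R)%type.
Local Notation mu := (lebesgue3 R).
Local Notation R' := (measurableTypeR R).

Lemma fourier_reE (T : tdistr R) psi : fourier_re T psi = T (Fph 0 psi).
Proof. by rewrite Fph0E. Qed.

Lemma fourier_imE (T : tdistr R) psi : fourier_im T psi = - T (Fph (- (pi / 2)) psi).
Proof. by rewrite FphNpihalfE. Qed.

Variables (N : nat) (sg : bool) (u0 : R3 -> R) (u1 : tdistr R) (g : R -> R) (M : R).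
Variables (f : R' * R' -> R) (B t : R).
Hypotheses (mu0 : measurable_fun setT u0) (mg : measurable_fun setT g)
  (gM : forall r, `|g r| <= M) (u0E : {ae mu, forall x, u0 x = g (norm3 x)})
  (out : outgoing u0 u1) (mf : measurable_fun setT f) (fB : forall z, `|f z| <= B) (t0 : 0 <= t).

Let u (t : R) (x : R3) : R := f (t, norm3 x).

(** The fixed-point equation is paired with the cosine transform of [psi]. Its free part becomes the
    two data terms by [outgoing_wave_pairing], and its time integral becomes the weak Duhamel term
    by Fubini and [sphere_mean_pairing] at each time s. *)
Lemma duhamel_re :
  (forall r, f (t, r) = outgoing_wave t g r - (-1) ^+ sg * time_integral t (source N f t r)) ->
  duhamel (@fourier_re R) N sg u0 u1 u t.
Proof.
move=> fE psi sp; rewrite /distr_mul !fourier_reE /distr_of.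
have sc := schwartz_cos_symbol t0 sp; have ss := schwartz_sin_symbol t0 sp.
have ip := integrable_Fph 0 sp.
have rc := schwartz_rapid (schwartz_Fph 0 sc).
have -> : \int[mu]_x (u0 x * Fph 0 (fun xi => cos_symbol t xi * psi xi) x) =
    \int[mu]_x (g (norm3 x) * Fph 0 (fun xi => cos_symbol t xi * psi xi) x).
  by apply: radial_data_pairing => //; exact: rc.1.
rewrite (outgoing_data_pairing mu0 mg gM u0E out 0 ss).
rewrite (outgoing_wave_pairing mg gM t0 sp).
have [i1 E1] := time_integral_pairing N mf fB t0 ip.
have mw : measurable_fun setT (outgoing_wave t g : R' -> R).
  exact: (@measurable_outgoing_wave _ _ R' (fun=> t) id).
have i2 : mu.-integrable setT (EFin \o (fun x => outgoing_wave t g (norm3 x) * Fph 0 psi x)).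
  by apply: (integrable_radial_mul mw (B := M)) => // r; exact: outgoing_wave_bounded.
have i3 : mu.-integrable setT (EFin \o (fun x =>
    (-1) ^+ sg * (time_integral t (source N f t (norm3 x)) * Fph 0 psi x))).
  exact: (integrableZl measurableT _ i1).
transitivity (\int[mu]_x (outgoing_wave t g (norm3 x) * Fph 0 psi x -
    (-1) ^+ sg * (time_integral t (source N f t (norm3 x)) * Fph 0 psi x))).
  by apply: eq_Rintegral => x _; rewrite /u fE mulrBl mulrA.
rewrite RintegralB//; congr (_ - _).
rewrite RintegralZl//; congr (_ * _); rewrite E1 time_integralE.
apply: eq_Rintegral => s; rewrite inE/= in_itv/= => /andP[s0 st].
rewrite fourier_reE.
have mF : measurable_fun setT (fun rho : R' => power_nonlin N (f (s, rho))).
  by apply: measurable_power_nonlin; exact: measurable_profile_at.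
have FB r : `|power_nonlin N (f (s, r))| <= B ^+ N.+1 by exact: power_nonlin_bounded.
have ts : 0 <= t - s by rewrite subr_ge0.
by rewrite -(sphere_mean_pairing mF FB ts sp).
Qed.

Lemma duhamel_im : duhamel (@fourier_im R) N sg u0 u1 u t.
Proof.
have odd0 (G : R -> R) (C : R) (psi : R3 -> R) : measurable_fun setT G ->
    (forall r, `|G r| <= C) -> schwartz psi ->
    \int[mu]_x (G (norm3 x) * Fph (- (pi / 2)) psi x) = 0.
  move=> mG GC sp; apply: radial_odd_pairing GC _ _ => //.
    exact: integrable_Fph.
  by move=> x; apply: FphNpihalf_odd; exact: schwartz_rapid.
move=> psi sp; rewrite /distr_mul !fourier_imE /distr_of.
have sc := schwartz_cos_symbol t0 sp; have ss := schwartz_sin_symbol t0 sp.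
have rc := schwartz_rapid (schwartz_Fph (- (pi / 2)) sc).
have -> : \int[mu]_x (u t x * Fph (- (pi / 2)) psi x) = 0.
  by apply: (odd0 (fun r => f (t, r)) B) => //; exact: measurable_profile_at.
have -> : \int[mu]_x (u0 x * Fph (- (pi / 2)) (fun xi => cos_symbol t xi * psi xi) x) = 0.
  rewrite (radial_data_pairing mu0 mg u0E rc.1); exact: (odd0 g M).
have -> : u1 (Fph (- (pi / 2)) (fun xi => sin_symbol t xi * psi xi)) = 0.
  rewrite (outgoing_data_pairing mu0 mg gM u0E out _ ss).
  apply: radial_odd_pairing gM _ _ => //; first exact: integrable_outgoing_test.
  by move=> x; apply: outgoing_test_odd; exact: schwartz_rapid.
rewrite oppr0 !add0r (_ : \int[_]_(s in _) _ = 0) ?mulr0 ?oppr0//.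
transitivity (\int[leb]_(s in `[0, t]) (fun=> (0 : R)) s); last first.
  by rewrite /Rintegral integral0.
apply: eq_Rintegral => s; rewrite inE/= in_itv/= => /andP[s0 st].
rewrite fourier_imE; apply/eqP; rewrite oppr_eq0; apply/eqP.
apply: (odd0 (fun r => power_nonlin N (f (s, r))) (B ^+ N.+1)).
- by apply: measurable_power_nonlin; exact: measurable_profile_at.
- by move=> r; exact: power_nonlin_bounded.
- by apply: schwartz_sin_symbol => //; rewrite subr_ge0.
Qed.

End duhamel_formula.

(** * Truncation of the profile, lifespan and existence *)

Section existence.
Context {R : realType}.
Local Notation R3 := (R * R * R)%type.
Local Notation mu := (lebesgue3 R).
Local Notation R' := (measurableTypeR R).

(** The profile supplied by [radial] may be large on a null set of radii. Replacing it by 0 where it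
    exceeds M affects only points outside the two full-measure sets, since there g(|x|) = u_0(x). *)
Lemma radial_truncation (u0 : R3 -> R) (M : R) : 0 <= M -> radial u0 ->
  {ae mu, forall x, `|u0 x| <= M} ->
  exists g : R -> R, [/\ measurable_fun setT g, forall r, `|g r| <= M &
    {ae mu, forall x, u0 x = g (norm3 x)}].
Proof.
move=> M0 [g mg [N1 [mN1 N10 sN1]]] [N2 [mN2 N20 sN2]].
exists (fun r => if `|g r| <= M then g r else 0); split.
- apply: measurable_fun_ifT => //; apply: measurable_fun_ler => //.
  exact: (measurableT_comp (@normr_measurable R setT)).
- by move=> r; case: ifP => // _; rewrite normr0.
- exists (N1 `|` N2); split; first exact: measurableU.
    by rewrite null_set_setU.
  move=> x /= h; apply: contrapT => /not_orP[n1 n2]; apply: h.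
  have h1 : u0 x = g (norm3 x) by apply: contrapT => h; apply: n1; exact: sN1.
  have h2 : `|u0 x| <= M by apply: contrapT => h; apply: n2; exact: sN2.
  by rewrite -h1 h2.
Qed.

Lemma measurable_time_interval (T : \bar R) : measurable (time_interval T : set R').
Proof.
case: T => [T| |].
- rewrite (_ : time_interval _ = `[0, T]%classic); first exact: measurable_itv.
  by apply/seteqP; split => t; rewrite /time_interval/= in_itv/= lee_fin => /andP.
- rewrite (_ : time_interval _ = `[0, +oo[%classic); first exact: measurable_itv.
  apply/seteqP; split => t; rewrite /time_interval/= in_itv/= andbT; first by case.
  by move=> ?; split => //; exact: leey.
- rewrite (_ : time_interval _ = set0)//.
  by apply/seteqP; split => t // -[_]; rewrite leeNy_eq.
Qed.

(** For M > 0 this is t <= c M^(-N/2), squared. For M = 0 the extended inverse makes the interval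
    the whole half-line, and the conclusion holds because 0^N = 0. *)
Lemma time_interval_lifespan (N : nat) (c M t : R) : (0 < N)%N -> 0 < c -> 0 <= M ->
  time_interval (c%:E * (M%:E `^ (N%:R / 2)%R)^-1)%E t -> t ^+ 2 * M ^+ N <= c ^+ 2.
Proof.
move=> N0 c0 M0 [t0]; rewrite poweR_EFin.
have [M0'|M0'] := eqVneq M 0.
  by move=> _; rewrite M0' expr0n eqn0Ngt N0/= mulr0 sqr_ge0.
have Mp : 0 < M by rewrite lt_neqAle eq_sym M0' M0.
have pp : 0 < M `^ (N%:R / 2) by exact: powR_gt0.
rewrite inver gt_eqF// -EFinM lee_fin ler_pdivlMr// => h.
have -> : M ^+ N = (M `^ (N%:R / 2)) ^+ 2.
  by rewrite -[RHS]powR_mulrn ?powR_ge0// -powRrM divfK// powR_mulrn.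
by rewrite -exprMn ler_sqr ?nnegrE// ?(ltW c0)// mulr_ge0// ltW.
Qed.

(** Since N >= 1, both N + 1 and 2^N are at least 2, so c <= 1/4 and c 2^N <= 1/2. The first product
    is at most 2c(c 2^N)M, hence at most M; the second is at most c^2 (N + 1) 2^N = c. *)
Lemma lifespan_constants (N : nat) (M t : R) : (0 < N)%N -> 0 <= M ->
  let c : R := (N.+1%:R * 2 ^+ N)^-1 in t ^+ 2 * M ^+ N <= c ^+ 2 ->
  t * (t * (2 * M) ^+ N.+1) <= M /\ t * (t * (N.+1%:R * (2 * M) ^+ N)) <= 2^-1.
Proof.
move=> N0 M0 c h.
have x2 : 2 <= N.+1%:R :> R by rewrite ler_nat.
have y2 : 2 <= 2 ^+ N :> R.
  by case: N N0 {h c x2} => // n _; rewrite exprS ler_pMr// exprn_ege1// ler1n.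
set x : R := N.+1%:R in x2 *; set y : R := 2 ^+ N in y2 *.
have x0 : 0 < x by lra.
have y0 : 0 < y by lra.
have cE : c = (x * y)^-1 by [].
have cxy : c * (x * y) = 1 by rewrite cE mulVf// mulf_neq0// gt_eqF.
have cp : 0 < c by rewrite cE invr_gt0 mulr_gt0.
have xy4 : 4 <= x * y by nra.
have c4 : c <= 4^-1 by rewrite cE lef_pV2 ?posrE// mulr_gt0.
split.
  rewrite (_ : _ * _ = t ^+ 2 * M ^+ N * (2 * y) * M); last first.
    by rewrite /y exprMn !exprS; ring.
  rewrite -[leRHS]mul1r ler_wpM2r// (le_trans (ler_wpM2r _ h)) ?mulr_ge0 ?(ltW y0)//.
  have cy : c * y <= 2^-1.
    have : 2 * (c * y) <= x * (c * y) by rewrite ler_wpM2r// mulr_ge0// ltW.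
    rewrite [x * _]mulrCA cxy.
    lra.
  have : 0 <= c * y by rewrite mulr_ge0// ltW.
  rewrite expr2; nra.
rewrite (_ : _ * _ = t ^+ 2 * M ^+ N * (x * y)); last first.
  by rewrite /y exprMn; ring.
rewrite (le_trans (ler_wpM2r _ h)) ?mulr_ge0 ?(ltW y0) ?(ltW x0)//.
rewrite expr2 -mulrA cxy mulr1; lra.
Qed.

Lemma mild_solution_exists (N : nat) (sg : bool) (u0 : R3 -> R) (u1 : tdistr R) :
  (0 < N)%N -> u0 \in Lfun mu +oo%E -> radial u0 -> outgoing u0 u1 ->
  let I := time_interval (((N.+1%:R * 2 ^+ N)^-1)%:E * (Linfty u0 `^ (N%:R / 2)%R)^-1)%E in
  exists2 u : R -> R3 -> R, mild_solution N sg u0 u1 I u &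
    (Linfty_tx I u <= 2%:E * Linfty u0)%E.
Proof.
move=> N0 u0L u0rad out I.
have mu0 : measurable_fun setT u0 by have /andP[] := u0L; rewrite inE.
have fin : Linfty u0 \is a fin_num.
  by rewrite ge0_fin_numE ?Lnorm_ge0//; have /andP[_] := u0L; rewrite inE.
pose M := fine (Linfty u0).
have ME : Linfty u0 = M%:E by rewrite fineK.
have M0 : 0 <= M by rewrite -lee_fin -ME Lnorm_ge0.
have [g [mg gM u0E]] := radial_truncation M0 u0rad (Lfun_infty_ae_le u0L).
pose c : R := (N.+1%:R * 2 ^+ N)^-1.
have c0 : 0 < c by rewrite invr_gt0 mulr_gt0// exprn_gt0.
(* Admissibility is stated without division: this set contains [I] and is the whole half-line when M
   = 0. *)
pose J (t : R) := (0 <= t) && (t ^+ 2 * M ^+ N <= c ^+ 2).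
have mJ : measurable_fun setT (J : R' -> bool).
  apply: measurable_and; first exact: measurable_fun_ler.
  apply: measurable_fun_ler => //; apply: measurable_funM => //; exact: measurable_funX.
have J0 t : J t -> 0 <= t by case/andP.
have Jball t : J t -> t * (t * (2 * M) ^+ N.+1) <= M.
  by case/andP => _ h; have [] := lifespan_constants N0 M0 h.
have Jcontr t : J t -> t * (t * (N.+1%:R * (2 * M) ^+ N)) <= 2^-1.
  by case/andP => _ h; have [] := lifespan_constants N0 M0 h.
have IJ t : I t -> J t.
  rewrite /I ME => It; apply/andP; split; first by case: It.
  exact: (time_interval_lifespan N0 c0 M0 It).
have [f [mf fM fE]] := picard_fixed_point sg mg gM mJ J0 Jball Jcontr.
exists (fun t x => f (t, norm3 x)).
  split.
  - apply: (@Lfun_infty_bounded _ _ _ _ _ (2 * M)).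
      apply/measurable_restrict => //.
        by apply: measurableX => //; exact: measurable_time_interval.
      apply: measurable_funTS.
      have mz : measurable_fun setT (fun p : R' * R3 => (p.1, norm3 p.2) : R' * R').
        by apply: measurable_fun_pair => //; exact: (measurableT_comp measurable_norm3).
      exact: (measurableT_comp mf mz).
    move=> p; rewrite /on_slab patchE; case: ifP => _ //.
    by rewrite normr0 mulr_ge0.
  - move=> t _; apply: (@Lfun_infty_bounded _ _ _ _ _ (2 * M)) => //.
    exact: (measurable_radial_profile (measurable_profile_at t mf)).
  - move=> t It; have Jt := IJ t It; have t0 := J0 t Jt; split.
      apply: (duhamel_re mu0 mg gM u0E out mf fM t0) => r.
      by rewrite {1}fE /picard/= Jt.
    exact: (duhamel_im N sg mu0 mg gM u0E out mf fM t0).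
rewrite ME -EFinM; apply: Lnorm_infty_le; first by rewrite mulr_ge0.
by move=> p; rewrite /on_slab patchE; case: ifP => _ //; rewrite normr0 mulr_ge0.
Qed.

End existence.

Theorem proposition5p1 (R : realType) (N : nat) (hN : (0 < N)%N) :
  exists C C' : R, 0 < C /\
    forall (sg : bool) (u0 : R * R * R -> R) (u1 : tdistr R),
      u0 \in Lfun (lebesgue3 R) +oo%E -> radial u0 -> outgoing u0 u1 ->
      exists (T : \bar R) (u : R -> R * R * R -> R),
        [/\ (C%:E * (Linfty u0 `^ (N%:R / 2)%R)^-1 <= T)%E,
            mild_solution N sg u0 u1 (time_interval T) u &
            (Linfty_tx (time_interval T) u <= C'%:E * Linfty u0)%E].
Proof.
(* The constant 2 is the ratio of the radius 2M of the iteration ball to the norm of the data. The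
   final time is taken equal to its lower bound, which is infinite when the data vanish almost
   everywhere. *)
exists (N.+1%:R * 2 ^+ N)^-1, 2; split.
  by rewrite invr_gt0 mulr_gt0// exprn_gt0.
move=> sg u0 u1 u0L u0rad out.
have [u H1 H2] := mild_solution_exists sg hN u0L u0rad out.
by eexists; exists u; split; [exact: lexx|exact: H1|exact: H2].
Qed.
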